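(* Let $H$ be a subgroup of a finite group $G$, let $\mathcal{V}$ be a $K$-linear strict $2$-category ($K$ a field), and let $\rho$ be a strict $2$-categorical action of $H$ on $\mathcal{V}$. Then the $2$-categorical trace takes the induced strict $2$-categorical action to the induced categorical action of the associated inertia groupoids: $$\mathbb{T}r_2(\mathrm{Ind}_H^G\rho)=\mathrm{Ind}_{\Lambda(H)}^{\Lambda(G)}\mathbb{T}r_2(\rho).$$ Explicitly: write $\widehat\rho=\mathrm{Ind}_H^G\rho$, let $f\in G$, let $[f]_G\cap H=[h_1]_H\cup\cdots\cup[h_n]_H$ be the decomposition into distinct $H$-conjugacy classes, and choose $r_i\in G$ with $r_i^{-1}fr_i=h_i$. Then the category $\mathbb{T}r_2\widehat\rho_f$ with its categorical action of $C_G(f)$ is equivalent to $$\bigoplus_{i=1}^n\mathrm{Ind}_{C_H(h_i)}^{C_G(h_i)}\mathbb{T}r_2\rho_{h_i},$$ where $g\in C_G(f)$ acts on the $i$-th summand through $r_i^{-1}gr_i\in C_G(h_i)$ by the categorical action induced from the categorical action of $C_H(h_i)$ on $\mathbb{T}r_2\rho_{h_i}$.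
   Context: **Conventions.** In a strict $3$-category, $\#_p$ is composition along a common $p$-dimensional boundary, and composing a lower-dimensional arrow with a higher one means whiskering. $\#_1$ and $\#_2$ are written in natural order. For functors, $\rho_h\#_0\rho_g=\rho_h\rho_g$ means $w\mapsto\rho_h(\rho_g(w))$. $C_G(f)$ is the centralizer, $[f]_G$ the conjugacy class, $g^*=g^{-1}$. **Strict $2$-categorical action.** For a strict $2$-category $\mathcal{V}$ let $\mathcal{V}^*$ be the $3$-category with one object $\mathcal{V}$, $1$-arrows the $2$-functors $\mathcal{V}\to\mathcal{V}$, $2$-arrows the pseudonatural transformations, $3$-arrows the modifications (all $K$-linear in the $K$-linear case). A strict $2$-categorical action of a group $H$ on $\mathcal{V}$ is a $3$-representation of $H$ in a strict $3$-subcategory $\mathcal{W}$ of $\mathcal{V}^*$, that is: $1$-isomorphisms $\rho_h:\mathcal{V}\to\mathcal{V}$ (invertible up to $2$-isomorphism in $\mathcal{W}$), $2$-isomorphisms $\phi_{h,g}:\rho_h\rho_g\Rightarrow\rho_{hg}$, $3$-isomorphisms $$\Phi_{g_3,g_2,g_1}:(\rho_{g_3}\#_0\phi_{g_2,g_1})\#_1\phi_{g_3,g_2g_1}\to(\phi_{g_3,g_2}\#_0\rho_{g_1})\#_1\phi_{g_3g_2,g_1},$$ with (standing assumption) $\rho_1=1_{\mathcal{V}}$ and $\phi_{1,g},\phi_{g,1}$ identities, satisfying the $3$-cocycle condition $$\{[\rho_{g_4}\#_0\Phi_{g_3,g_2,g_1}]\#_1\phi_{g_4,g_3g_2g_1}\}\#_2\{[\rho_{g_4}\#_0\phi_{g_3,g_2}\#_0\rho_{g_1}]\#_1\Phi_{g_4,g_3g_2,g_1}\}\#_2\{[\Phi_{g_4,g_3,g_2}\#_0\rho_{g_1}]\#_1\phi_{g_4g_3g_2,g_1}\}$$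 $$=\{[(\rho_{g_4}\rho_{g_3})\#_0\phi_{g_2,g_1}]\#_1\Phi_{g_4,g_3,g_2g_1}\}\#_2\{[\phi_{g_4,g_3}\#_0(\rho_{g_2}\rho_{g_1})]\#_1\Phi_{g_4g_3,g_2,g_1}\}.$$ **$2$-categorical trace and the centralizer action.** $\mathbb{T}r_2\rho_f$ is the category with objects the $2$-arrows $\chi:1_{\mathcal{V}}\Rightarrow\rho_f$ of $\mathcal{W}$ and morphisms the $3$-arrows between them. The centralizer of $f$ acts categorically on it by $\{\psi_g,\Gamma_{h,g}\}$: with $u_g=\phi_{g,g^*}^{-1}$, $$\psi_g(\omega)=u_g\#_1[\rho_g\#_0\omega\#_0\rho_{g^*}]\#_1[\phi_{g,f}\#_0\rho_{g^*}]\#_1\phi_{gf,g^*}$$ on objects and morphisms $\omega$. For $e\in\{f,1\}$ let $$\begin{aligned} L^e&=[\rho_h\#_0\phi_{g,e}\#_0(\rho_{g^*}\rho_{h^*})]\#_1[\rho_h\#_0\phi_{ge,g^*}\#_0\rho_{h^*}]\#_1[\phi_{h,geg^*}\#_0\rho_{h^*}]\#_1\phi_{hgeg^*,h^*},\\ R^e&=[\phi_{h,g}\#_0(\rho_e\rho_{g^*}\rho_{h^*})]\#_1[\phi_{hg,e}\#_0(\rho_{g^*}\rho_{h^*})]\#_1[\rho_{hge}\#_0\phi_{g^*,h^*}]\#_1\phi_{hge,g^*h^*}, \end{aligned}$$ and let $\Lambda^e:L^e\to R^e$ be the $\#_2$-composite of $[\rho_h\#_0\phi_{g,e}\#_0(\rho_{g^*}\rho_{h^*})]\#_1[\Phi_{h,ge,g^*}\#_0\rho_{h^*}]\#_1\phi_{hgeg^*,h^*}$,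 then $[\Phi_{h,g,e}\#_0(\rho_{g^*}\rho_{h^*})]\#_1[\phi_{hge,g^*}\#_0\rho_{h^*}]\#_1\phi_{hgeg^*,h^*}$, then $[\phi_{h,g}\#_0(\rho_e\rho_{g^*}\rho_{h^*})]\#_1[\phi_{hg,e}\#_0(\rho_{g^*}\rho_{h^*})]\#_1\Phi^{-1}_{hge,g^*,h^*}$. Then $\Gamma_{h,g}(\chi)=\big((L^1)^{-1}\#_1(\Lambda^1)^{-1}\#_1(R^1)^{-1}\big)\#_1[(\rho_h\rho_g)\#_0\chi\#_0(\rho_{g^*}\rho_{h^*})]\#_1\Lambda^f:\psi_h\psi_g(\chi)\to\psi_{hg}(\chi)$. A categorical action of a group on a category consists of equivalences $\psi_g$ and natural isomorphisms $\Gamma_{h,g}:\psi_h\circ\psi_g\to\psi_{hg}$ that are associative (the two composites $\psi_k\psi_h\psi_g\to\psi_{khg}$ agree), together with a compatible isomorphism $\psi_1\cong\mathrm{id}$. **Induced strict $2$-categorical action.** Let $\mathcal{R}=\{r_1,\dots,r_m\}$ be representatives of the left cosets of $H$ in $G$ (not the same labels as the $r_i$ in the claim), $m=|G/H|$. $\mathrm{Ind}_H^G(\mathcal{V})$ is identified with $\mathcal{V}^m$ (componentwise compositions). Functors on $\mathcal{V}^m$ are $m\times m$ matrices $(a_{jk})$ of functors on $\mathcal{V}$ belonging to $\mathcal{W}$, with at most one nonzero entry in each row and column, acting by $(w_k)_k\mapsto(\sum_ka_{jk}(w_k))_j$ and composed by matrix multiplication. Transformations and modifications between them are matrices of transformations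 and modifications between the corresponding entries in $\mathcal{W}$, where the only transformation with a zero functor as source or target is zero; $1_{\mathcal{V}^m}=\mathrm{diag}(1_{\mathcal{V}},\dots,1_{\mathcal{V}})$. The induced action $\widehat\rho=\mathrm{Ind}_H^G\rho$ of $G$ is: $(\widehat\rho_g)_{ji}=\rho_h$ if $gr_i=r_jh$ with $h\in H$, and $0$ otherwise. If $g_1r_i=r_jh_1$, $g_2r_j=r_kh_2$, $g_3r_k=r_lh_3$ with $h_1,h_2,h_3\in H$, then $(\widehat\phi_{g_2,g_1})_{ki}=\phi_{h_2,h_1}$ and $(\widehat\Phi_{g_3,g_2,g_1})_{li}=\Phi_{h_3,h_2,h_1}$, all other entries being zero. The trace $\mathbb{T}r_2\widehat\rho_f$ is the category of such matrix transformations $1_{\mathcal{V}^m}\Rightarrow\widehat\rho_f$ and modifications between them, with the categorical action $\{\widetilde\psi_g,\widetilde\Gamma_{h,g}\}$ of $C_G(f)$ given, for $g,h\in C_G(f)$, by $$\widetilde\psi_g(\omega)=\widehat\phi_{g,g^*}^{-1}\#_1[\widehat\rho_g\#_0\omega\#_0\widehat\rho_{g^*}]\#_1[\widehat\phi_{g,f}\#_0\widehat\rho_{g^*}]\#_1\widehat\phi_{gf,g^*}$$ on objects and morphisms $\omega$, and $$\widetilde\Gamma_{h,g}(\chi)=\big((\widehat L^1)^{-1}\#_1(\widehat\Lambda^1)^{-1}\#_1(\widehat R^1)^{-1}\big)\#_1[(\widehat\rho_h\widehat\rho_g)\#_0\chi\#_0(\widehat\rho_{g^*}\widehat\rho_{h^*})]\#_1\widehat\Lambda^f:\widetilde\psi_h\widetilde\psi_g(\chi)\to\widetilde\psi_{hg}(\chi),$$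 where, for $e\in\{f,1\}$, $$\begin{aligned} \widehat L^e&=[\widehat\rho_h\#_0\widehat\phi_{g,e}\#_0(\widehat\rho_{g^*}\widehat\rho_{h^*})]\#_1[\widehat\rho_h\#_0\widehat\phi_{ge,g^*}\#_0\widehat\rho_{h^*}]\#_1[\widehat\phi_{h,geg^*}\#_0\widehat\rho_{h^*}]\#_1\widehat\phi_{hgeg^*,h^*},\\ \widehat R^e&=[\widehat\phi_{h,g}\#_0(\widehat\rho_e\widehat\rho_{g^*}\widehat\rho_{h^*})]\#_1[\widehat\phi_{hg,e}\#_0(\widehat\rho_{g^*}\widehat\rho_{h^*})]\#_1[\widehat\rho_{hge}\#_0\widehat\phi_{g^*,h^*}]\#_1\widehat\phi_{hge,g^*h^*}, \end{aligned}$$ and $\widehat\Lambda^e:\widehat L^e\to\widehat R^e$ is the $\#_2$-composite of $[\widehat\rho_h\#_0\widehat\phi_{g,e}\#_0(\widehat\rho_{g^*}\widehat\rho_{h^*})]\#_1[\widehat\Phi_{h,ge,g^*}\#_0\widehat\rho_{h^*}]\#_1\widehat\phi_{hgeg^*,h^*}$, then $[\widehat\Phi_{h,g,e}\#_0(\widehat\rho_{g^*}\widehat\rho_{h^*})]\#_1[\widehat\phi_{hge,g^*}\#_0\widehat\rho_{h^*}]\#_1\widehat\phi_{hgeg^*,h^*}$, then $[\widehat\phi_{h,g}\#_0(\widehat\rho_e\widehat\rho_{g^*}\widehat\rho_{h^*})]\#_1[\widehat\phi_{hg,e}\#_0(\widehat\rho_{g^*}\widehat\rho_{h^*})]\#_1\widehat\Phi^{-1}_{hge,g^*,h^*}$.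 **Induced categorical action of a group.** For a subgroup $A\le B$ of finite index $m$ with coset representatives $b_1,\dots,b_m$ and a categorical action $\{\psi_a,\Gamma_{a,a'}\}$ of $A$ on $\mathcal{U}$, $\mathrm{Ind}_A^B\mathcal{U}=\mathcal{U}^m$, where $b\in B$ acts by the matrix with $(j,i)$ entry $\psi_a$ if $bb_i=b_ja$, $a\in A$, and $0$ otherwise, the structure isomorphisms being the corresponding matrices of $\Gamma$'s. **Inertia groupoids.** $\Lambda(G)$ (called the ''initia groupoid'' in the source) has as objects the elements of $G$ and one morphism $u\to v$ for each $g\in G$ with $v=gug^{-1}$. It is equivalent to the groupoid whose objects are the conjugacy classes, with automorphism group $C_G(g_i)$ at $[g_i]$. $\mathbb{T}r_2(\rho)$ denotes the family of categories $\mathbb{T}r_2\rho_h$ with their centralizer actions, regarded as a categorical action of $\Lambda(H)$. $\mathrm{Ind}_{\Lambda(H)}^{\Lambda(G)}\mathbb{T}r_2(\rho)$ has at $f\in G$ the category $\bigoplus_i\mathrm{Ind}_{C_H(h_i)}^{C_G(h_i)}\mathbb{T}r_2\rho_{h_i}$ with the $C_G(f)$-action described in the claim (an empty sum is the trivial category). *)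

(* Defs.v *)
From mathcomp Require Import all_boot all_algebra all_fingroup.

Set Implicit Arguments.
Unset Strict Implicit.
Unset Printing Implicit Defensive.

Local Open Scope group_scope.

(** * Strict 2-categories

  Higher cells are presented with source and target maps, so that the strict
  associativity and unit laws are plain equations, without transport along
  equalities of 1-cells.  Compositions are total functions, and the axioms
  constrain them on composable pairs only; any partially defined composition
  extends in this way.  All compositions are in natural (diagrammatic) order:
  [x --f--> y --g--> z] composes to [cmp1 f g]. *)

Record strict2cat := Strict2Cat {
  cell0 : Type; cell1 : Type; cell2 : Type;
  src1 : cell1 -> cell0; tgt1 : cell1 -> cell0;
  src2 : cell2 -> cell1; tgt2 : cell2 -> cell1;
  idc1 : cell0 -> cell1; idc2 : cell1 -> cell2;
  cmp1 : cell1 -> cell1 -> cell1;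
  vcmp : cell2 -> cell2 -> cell2;
  hcmp : cell2 -> cell2 -> cell2;
  src1_src2 a : src1 (src2 a) = src1 (tgt2 a);
  tgt1_src2 a : tgt1 (src2 a) = tgt1 (tgt2 a);
  src_idc1 x : src1 (idc1 x) = x;
  tgt_idc1 x : tgt1 (idc1 x) = x;
  src_cmp1 f g : tgt1 f = src1 g -> src1 (cmp1 f g) = src1 f;
  tgt_cmp1 f g : tgt1 f = src1 g -> tgt1 (cmp1 f g) = tgt1 g;
  cmp1A f g h : tgt1 f = src1 g -> tgt1 g = src1 h ->
    cmp1 f (cmp1 g h) = cmp1 (cmp1 f g) h;
  cmp1idl f : cmp1 (idc1 (src1 f)) f = f;
  cmp1idr f : cmp1 f (idc1 (tgt1 f)) = f;
  src_idc2 f : src2 (idc2 f) = f;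
  tgt_idc2 f : tgt2 (idc2 f) = f;
  src_vcmp a b : tgt2 a = src2 b -> src2 (vcmp a b) = src2 a;
  tgt_vcmp a b : tgt2 a = src2 b -> tgt2 (vcmp a b) = tgt2 b;
  vcmpA a b c : tgt2 a = src2 b -> tgt2 b = src2 c ->
    vcmp a (vcmp b c) = vcmp (vcmp a b) c;
  vcmpidl a : vcmp (idc2 (src2 a)) a = a;
  vcmpidr a : vcmp a (idc2 (tgt2 a)) = a;
  src_hcmp a b : tgt1 (src2 a) = src1 (src2 b) ->
    src2 (hcmp a b) = cmp1 (src2 a) (src2 b);
  tgt_hcmp a b : tgt1 (src2 a) = src1 (src2 b) ->
    tgt2 (hcmp a b) = cmp1 (tgt2 a) (tgt2 b);
  hcmpA a b c : tgt1 (src2 a) = src1 (src2 b) ->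
    tgt1 (src2 b) = src1 (src2 c) ->
    hcmp a (hcmp b c) = hcmp (hcmp a b) c;
  hcmpidl a : hcmp (idc2 (idc1 (src1 (src2 a)))) a = a;
  hcmpidr a : hcmp a (idc2 (idc1 (tgt1 (src2 a)))) = a;
  hcmp_idc2 f g : tgt1 f = src1 g ->
    hcmp (idc2 f) (idc2 g) = idc2 (cmp1 f g);
  hcmp_vcmp a a' b b' : tgt2 a = src2 a' -> tgt2 b = src2 b' ->
    tgt1 (src2 a) = src1 (src2 b) ->
    hcmp (vcmp a a') (vcmp b b') = vcmp (hcmp a b) (hcmp a' b')
}.

Definition par1 (V : strict2cat) (f g : cell1 V) : Prop :=
  src1 f = src1 g /\ tgt1 f = tgt1 g.
Definition par2 (V : strict2cat) (a b : cell2 V) : Prop :=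
  src2 a = src2 b /\ tgt2 a = tgt2 b.

(** Each set of 2-cells between two parallel 1-cells is a K-vector space, and
    both compositions of 2-cells are K-bilinear. *)
Record klinear2cat (K : fieldType) := KLinear2Cat {
  k2cat :> strict2cat;
  cadd : cell2 k2cat -> cell2 k2cat -> cell2 k2cat;
  cscale : K -> cell2 k2cat -> cell2 k2cat;
  czero : cell1 k2cat -> cell1 k2cat -> cell2 k2cat;
  par_cadd a b : par2 a b -> par2 (cadd a b) a;
  par_cscale k a : par2 (cscale k a) a;
  src_czero f g : par1 f g -> src2 (czero f g) = f;
  tgt_czero f g : par1 f g -> tgt2 (czero f g) = g;
  caddA a b c : par2 a b -> par2 b c ->
    cadd a (cadd b c) = cadd (cadd a b) c;
  caddC a b : par2 a b -> cadd a b = cadd b a;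
  cadd0 a : cadd (czero (src2 a) (tgt2 a)) a = a;
  caddN a : cadd a (cscale (-1)%R a) = czero (src2 a) (tgt2 a);
  cscaleA k l a : cscale k (cscale l a) = cscale (k * l)%R a;
  cscale1 a : cscale 1%R a = a;
  cscaleDr k a b : par2 a b ->
    cscale k (cadd a b) = cadd (cscale k a) (cscale k b);
  cscaleDl k l a : cscale (k + l)%R a = cadd (cscale k a) (cscale l a);
  vcmpDl a b c : par2 a b -> tgt2 a = src2 c ->
    vcmp (cadd a b) c = cadd (vcmp a c) (vcmp b c);
  vcmpDr a b c : par2 b c -> tgt2 a = src2 b ->
    vcmp a (cadd b c) = cadd (vcmp a b) (vcmp a c);
  vcmpZl k a b : tgt2 a = src2 b ->
    vcmp (cscale k a) b = cscale k (vcmp a b);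
  vcmpZr k a b : tgt2 a = src2 b ->
    vcmp a (cscale k b) = cscale k (vcmp a b);
  hcmpDl a b c : par2 a b -> tgt1 (src2 a) = src1 (src2 c) ->
    hcmp (cadd a b) c = cadd (hcmp a c) (hcmp b c);
  hcmpDr a b c : par2 b c -> tgt1 (src2 a) = src1 (src2 b) ->
    hcmp a (cadd b c) = cadd (hcmp a b) (hcmp a c);
  hcmpZl k a b : tgt1 (src2 a) = src1 (src2 b) ->
    hcmp (cscale k a) b = cscale k (hcmp a b);
  hcmpZr k a b : tgt1 (src2 a) = src1 (src2 b) ->
    hcmp a (cscale k b) = cscale k (hcmp a b)
}.

(** * 2-functors, pseudonatural transformations, modifications *)

Section TwoFunctors.
Variables (K : fieldType) (V : klinear2cat K).

Record fun2 := Fun2 {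
  f0 : cell0 V -> cell0 V; f1 : cell1 V -> cell1 V; f2 : cell2 V -> cell2 V }.

Record is_2functor (F : fun2) : Prop := {
  f1_src f : src1 (f1 F f) = f0 F (src1 f);
  f1_tgt f : tgt1 (f1 F f) = f0 F (tgt1 f);
  f1_id x : f1 F (idc1 x) = idc1 (f0 F x);
  f1_cmp f g : tgt1 f = src1 g -> f1 F (cmp1 f g) = cmp1 (f1 F f) (f1 F g);
  f2_src a : src2 (f2 F a) = f1 F (src2 a);
  f2_tgt a : tgt2 (f2 F a) = f1 F (tgt2 a);
  f2_id f : f2 F (idc2 f) = idc2 (f1 F f);
  f2_vcmp a b : tgt2 a = src2 b -> f2 F (vcmp a b) = vcmp (f2 F a) (f2 F b);
  f2_hcmp a b : tgt1 (src2 a) = src1 (src2 b) ->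
    f2 F (hcmp a b) = hcmp (f2 F a) (f2 F b);
  f2_add a b : par2 a b -> f2 F (cadd a b) = cadd (f2 F a) (f2 F b);
  f2_scale k a : f2 F (cscale k a) = cscale k (f2 F a)
}.

Definition fun2_id : fun2 := Fun2 id id id.
Definition fun2_comp (F G : fun2) : fun2 :=
  Fun2 (f0 F \o f0 G) (f1 F \o f1 G) (f2 F \o f2 G).

Record trans2 := Trans2 { p0 : cell0 V -> cell1 V; p1 : cell1 V -> cell2 V }.

(** [s : F => G] has components [s_x : F x -> G x] and, for [f : x -> y],
    invertible 2-cells [s_f : F f ; s_y => s_x ; G f]. *)
Record is_pseudonat (F G : fun2) (s : trans2) : Prop := {
  p0_src x : src1 (p0 s x) = f0 F x;
  p0_tgt x : tgt1 (p0 s x) = f0 G x;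
  p1_src f : src2 (p1 s f) = cmp1 (f1 F f) (p0 s (tgt1 f));
  p1_tgt f : tgt2 (p1 s f) = cmp1 (p0 s (src1 f)) (f1 G f);
  p1_inv f : exists b, [/\ src2 b = tgt2 (p1 s f), tgt2 b = src2 (p1 s f),
    vcmp (p1 s f) b = idc2 (src2 (p1 s f)) &
    vcmp b (p1 s f) = idc2 (tgt2 (p1 s f))];
  p1_nat a :
    vcmp (hcmp (f2 F a) (idc2 (p0 s (tgt1 (src2 a))))) (p1 s (tgt2 a)) =
    vcmp (p1 s (src2 a)) (hcmp (idc2 (p0 s (src1 (src2 a)))) (f2 G a));
  p1_id x : p1 s (idc1 x) = idc2 (p0 s x);
  p1_cmp f g : tgt1 f = src1 g -> p1 s (cmp1 f g) =
    vcmp (hcmp (idc2 (f1 F f)) (p1 s g)) (hcmp (p1 s f) (idc2 (f1 G g)))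
}.

Definition trans2_id (F : fun2) : trans2 :=
  Trans2 (fun x => idc1 (f0 F x)) (fun f => idc2 (f1 F f)).
Definition trans2_comp (s t : trans2) : trans2 :=
  Trans2 (fun x => cmp1 (p0 s x) (p0 t x))
    (fun f => vcmp (hcmp (p1 s f) (idc2 (p0 t (tgt1 f))))
                   (hcmp (idc2 (p0 s (src1 f))) (p1 t f))).
Definition trans2_lw (F : fun2) (s : trans2) : trans2 :=
  Trans2 (f1 F \o p0 s) (f2 F \o p1 s).
Definition trans2_rw (s : trans2) (F : fun2) : trans2 :=
  Trans2 (p0 s \o f0 F) (p1 s \o f1 F).

Definition modif := cell0 V -> cell2 V.

Record is_modif (F G : fun2) (s t : trans2) (m : modif) : Prop := {
  m_src x : src2 (m x) = p0 s x;
  m_tgt x : tgt2 (m x) = p0 t x;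
  m_nat f : vcmp (p1 s f) (hcmp (m (src1 f)) (idc2 (f1 G f))) =
            vcmp (hcmp (idc2 (f1 F f)) (m (tgt1 f))) (p1 t f)
}.

Definition modif_id (s : trans2) : modif := fun x => idc2 (p0 s x).
Definition modif_vcomp (m n : modif) : modif := fun x => vcmp (m x) (n x).
Definition modif_hcomp (m n : modif) : modif := fun x => hcmp (m x) (n x).
Definition modif_lw (F : fun2) (m : modif) : modif := f2 F \o m.
Definition modif_rw (m : modif) (F : fun2) : modif := m \o f0 F.

End TwoFunctors.

(** * One-object 3-dimensional structures

  [T1], [T2 F G] and [T3 F G s t] select the 1-arrows, the 2-arrows [F => G]
  and the 3-arrows [s -> t] between 2-arrows [F => G].  [#o] is the composite
  of 1-arrows under #_0, [#l]/[#r] (resp. [#L]/[#R]) the left/right whiskering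
  of 2-arrows (resp. 3-arrows) by 1-arrows under #_0, [#1] (resp. [#I]) the
  composition of 2-arrows (resp. 3-arrows) under #_1, and [#2] the composition
  of 3-arrows under #_2.  Whiskering a 3-arrow [m] by a 2-arrow [s] under #_1
  is [id3 s #I m]. *)

Record sig3 := Sig3 {
  C1 : Type; C2 : Type; C3 : Type;
  T1 : C1 -> Prop;
  T2 : C1 -> C1 -> C2 -> Prop;
  T3 : C1 -> C1 -> C2 -> C2 -> C3 -> Prop;
  one1 : C1; id2 : C1 -> C2; id3 : C2 -> C3;
  comp0 : C1 -> C1 -> C1;
  lw2 : C1 -> C2 -> C2; rw2 : C2 -> C1 -> C2;
  lw3 : C1 -> C3 -> C3; rw3 : C3 -> C1 -> C3;
  comp1 : C2 -> C2 -> C2;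
  hcomp1 : C3 -> C3 -> C3;
  comp2 : C3 -> C3 -> C3
}.
Arguments one1 {_}.

Declare Scope sig3_scope.
Delimit Scope sig3_scope with S3.
Notation "F #o G" := (comp0 F G) (at level 38, left associativity) : sig3_scope.
Notation "F #l s" := (lw2 F s) (at level 38, left associativity) : sig3_scope.
Notation "s #r F" := (rw2 s F) (at level 38, left associativity) : sig3_scope.
Notation "F #L m" := (lw3 F m) (at level 38, left associativity) : sig3_scope.
Notation "m #R F" := (rw3 m F) (at level 38, left associativity) : sig3_scope.
Notation "s #1 t" := (comp1 s t) (at level 45, left associativity) : sig3_scope.
Notation "m #I n" := (hcomp1 m n) (at level 45, left associativity) : sig3_scope.
Notation "m #2 n" := (comp2 m n) (at level 57, left associativity) : sig3_scope.
Local Open Scope sig3_scope.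

(** The axioms of a strict 3-category with one object, in terms of whiskerings:
    #_0 of two 2-arrows (or 3-arrows) is the common value of the two composites
    in [interchange2] (or [interchange3]). *)
Record is_strict3 (S : sig3) : Prop := {
  T1_one : T1 (one1 : C1 S);
  T1_comp0 (F G : C1 S) : T1 F -> T1 G -> T1 (F #o G);
  comp0A (F G H : C1 S) : T1 F -> T1 G -> T1 H ->
    F #o (G #o H) = F #o G #o H;
  comp0idl (F : C1 S) : T1 F -> one1 #o F = F;
  comp0idr (F : C1 S) : T1 F -> F #o one1 = F;

  T2_T1 (F G : C1 S) s : T2 F G s -> T1 F /\ T1 G;
  T2_id2 (F : C1 S) : T1 F -> T2 F F (id2 F);
  T2_comp1 (F G H : C1 S) s t : T2 F G s -> T2 G H t -> T2 F H (s #1 t);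
  comp1A (F G H I : C1 S) s t u : T2 F G s -> T2 G H t -> T2 H I u ->
    s #1 (t #1 u) = s #1 t #1 u;
  comp1idl (F G : C1 S) s : T2 F G s -> id2 F #1 s = s;
  comp1idr (F G : C1 S) s : T2 F G s -> s #1 id2 G = s;

  T2_lw2 (H F G : C1 S) s : T1 H -> T2 F G s -> T2 (H #o F) (H #o G) (H #l s);
  T2_rw2 (F G H : C1 S) s : T2 F G s -> T1 H -> T2 (F #o H) (G #o H) (s #r H);
  lw2_id2 (H F : C1 S) : T1 H -> T1 F -> H #l id2 F = id2 (H #o F);
  rw2_id2 (F H : C1 S) : T1 F -> T1 H -> id2 F #r H = id2 (F #o H);
  lw2_comp1 (H F G I : C1 S) s t : T1 H -> T2 F G s -> T2 G I t ->
    H #l (s #1 t) = H #l s #1 H #l t;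
  rw2_comp1 (F G I H : C1 S) s t : T2 F G s -> T2 G I t -> T1 H ->
    (s #1 t) #r H = s #r H #1 t #r H;
  lw2_one (F G : C1 S) s : T2 F G s -> one1 #l s = s;
  rw2_one (F G : C1 S) s : T2 F G s -> s #r one1 = s;
  lw2_comp0 (H I F G : C1 S) s : T1 H -> T1 I -> T2 F G s ->
    (H #o I) #l s = H #l (I #l s);
  rw2_comp0 (F G H I : C1 S) s : T2 F G s -> T1 H -> T1 I ->
    s #r (H #o I) = s #r H #r I;
  lw2_rw2 (H F G I : C1 S) s : T1 H -> T2 F G s -> T1 I ->
    H #l s #r I = H #l (s #r I);
  interchange2 (F G F' G' : C1 S) s t : T2 F G s -> T2 F' G' t ->
    s #r F' #1 G #l t = F #l t #1 s #r G';

  T3_T2 (F G : C1 S) s t m : T3 F G s t m -> T2 F G s /\ T2 F G t;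
  T3_id3 (F G : C1 S) s : T2 F G s -> T3 F G s s (id3 s);
  T3_comp2 (F G : C1 S) s t u m n : T3 F G s t m -> T3 F G t u n ->
    T3 F G s u (m #2 n);
  comp2A (F G : C1 S) s t u v m n p :
    T3 F G s t m -> T3 F G t u n -> T3 F G u v p ->
    m #2 (n #2 p) = m #2 n #2 p;
  comp2idl (F G : C1 S) s t m : T3 F G s t m -> id3 s #2 m = m;
  comp2idr (F G : C1 S) s t m : T3 F G s t m -> m #2 id3 t = m;

  T3_hcomp1 (F G H : C1 S) s s' t t' m n :
    T3 F G s s' m -> T3 G H t t' n -> T3 F H (s #1 t) (s' #1 t') (m #I n);
  hcomp1A (F G H I : C1 S) s s' t t' u u' m n p :
    T3 F G s s' m -> T3 G H t t' n -> T3 H I u u' p ->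
    m #I (n #I p) = m #I n #I p;
  hcomp1idl (F G : C1 S) s t m : T3 F G s t m -> id3 (id2 F) #I m = m;
  hcomp1idr (F G : C1 S) s t m : T3 F G s t m -> m #I id3 (id2 G) = m;
  hcomp1_id3 (F G H : C1 S) s t : T2 F G s -> T2 G H t ->
    id3 s #I id3 t = id3 (s #1 t);
  hcomp1_comp2 (F G H : C1 S) s s' s'' t t' t'' m m' n n' :
    T3 F G s s' m -> T3 F G s' s'' m' -> T3 G H t t' n -> T3 G H t' t'' n' ->
    (m #2 m') #I (n #2 n') = (m #I n) #2 (m' #I n');

  T3_lw3 (H F G : C1 S) s t m : T1 H -> T3 F G s t m ->
    T3 (H #o F) (H #o G) (H #l s) (H #l t) (H #L m);
  T3_rw3 (F G H : C1 S) s t m : T3 F G s t m -> T1 H ->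
    T3 (F #o H) (G #o H) (s #r H) (t #r H) (m #R H);
  lw3_id3 (H F G : C1 S) s : T1 H -> T2 F G s -> H #L id3 s = id3 (H #l s);
  rw3_id3 (F G H : C1 S) s : T2 F G s -> T1 H -> id3 s #R H = id3 (s #r H);
  lw3_comp2 (H F G : C1 S) s t u m n :
    T1 H -> T3 F G s t m -> T3 F G t u n ->
    H #L (m #2 n) = H #L m #2 H #L n;
  rw3_comp2 (F G H : C1 S) s t u m n :
    T3 F G s t m -> T3 F G t u n -> T1 H ->
    (m #2 n) #R H = m #R H #2 n #R H;
  lw3_hcomp1 (H F G I : C1 S) s s' t t' m n :
    T1 H -> T3 F G s s' m -> T3 G I t t' n ->
    H #L (m #I n) = H #L m #I H #L n;
  rw3_hcomp1 (F G I H : C1 S) s s' t t' m n :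
    T3 F G s s' m -> T3 G I t t' n -> T1 H ->
    (m #I n) #R H = m #R H #I n #R H;
  lw3_one (F G : C1 S) s t m : T3 F G s t m -> one1 #L m = m;
  rw3_one (F G : C1 S) s t m : T3 F G s t m -> m #R one1 = m;
  lw3_comp0 (H I F G : C1 S) s t m : T1 H -> T1 I -> T3 F G s t m ->
    (H #o I) #L m = H #L (I #L m);
  rw3_comp0 (F G H I : C1 S) s t m : T3 F G s t m -> T1 H -> T1 I ->
    m #R (H #o I) = m #R H #R I;
  lw3_rw3 (H F G I : C1 S) s t m : T1 H -> T3 F G s t m -> T1 I ->
    H #L m #R I = H #L (m #R I);
  interchange3 (F G F' G' : C1 S) s s' t t' m n :
    T3 F G s s' m -> T3 F' G' t t' n ->
    m #R F' #I G #L n = F #L n #I m #R G'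
}.

(** All 2-functors, pseudonatural transformations and modifications of [V].
    (As interchange fails in general for pseudonatural transformations, one
    works inside a strict sub-3-category.) *)
Definition Vstar (K : fieldType) (V : klinear2cat K) : sig3 := {|
  C1 := fun2 V; C2 := trans2 V; C3 := modif V;
  T1 := @is_2functor K V; T2 := @is_pseudonat K V; T3 := @is_modif K V;
  one1 := fun2_id V; id2 := @trans2_id K V; id3 := @modif_id K V;
  comp0 := @fun2_comp K V;
  lw2 := @trans2_lw K V; rw2 := @trans2_rw K V;
  lw3 := @modif_lw K V; rw3 := @modif_rw K V;
  comp1 := @trans2_comp K V;
  hcomp1 := @modif_hcomp K V;
  comp2 := @modif_vcomp K V |}.

Record sub3 (S : sig3) := Sub3 {
  W1 : C1 S -> Prop;
  W2 : C1 S -> C1 S -> C2 S -> Prop;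
  W3 : C1 S -> C1 S -> C2 S -> C2 S -> C3 S -> Prop
}.

Definition sub3_sig (S : sig3) (W : sub3 S) : sig3 := {|
  C1 := C1 S; C2 := C2 S; C3 := C3 S; T1 := W1 W; T2 := W2 W; T3 := W3 W;
  one1 := one1; id2 := @id2 S; id3 := @id3 S; comp0 := @comp0 S;
  lw2 := @lw2 S; rw2 := @rw2 S; lw3 := @lw3 S; rw3 := @rw3 S;
  comp1 := @comp1 S; hcomp1 := @hcomp1 S; comp2 := @comp2 S |}.

Record is_strict_sub3 (S : sig3) (W : sub3 S) : Prop := {
  W1_T1 F : W1 W F -> T1 F;
  W2_T2 F G s : W2 W F G s -> T2 F G s;
  W3_T3 F G s t m : W3 W F G s t m -> T3 F G s t m;
  W_strict : is_strict3 (sub3_sig W)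
}.

(** * 3-representations *)

Section Representations.
Variables (gT : finGroupType) (S : sig3).

(** The inverses of the 2-isomorphisms and 3-isomorphisms are recorded as data
    (they are unique). *)
Record rep3 := Rep3 {
  rho : gT -> C1 S;
  phi : gT -> gT -> C2 S; phiV : gT -> gT -> C2 S;
  Phi : gT -> gT -> gT -> C3 S; PhiV : gT -> gT -> gT -> C3 S }.

Definition is_2iso (F G : C1 S) (s t : C2 S) : Prop :=
  [/\ T2 F G s, T2 G F t, s #1 t = id2 F & t #1 s = id2 G].

Definition is_3iso (F G : C1 S) (s t : C2 S) (m n : C3 S) : Prop :=
  [/\ T3 F G s t m, T3 F G t s n, m #2 n = id3 s & n #2 m = id3 t].

Definition is_1iso (F : C1 S) : Prop :=
  T1 F /\ exists F' : C1 S, [/\ T1 F',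
    exists s t, is_2iso (F #o F') one1 s t &
    exists s t, is_2iso (F' #o F) one1 s t].

Record is_rep3 (H : {set gT}) (X : rep3) : Prop := {
  rho_iso h : h \in H -> is_1iso (rho X h);
  phi_iso h g : h \in H -> g \in H ->
    is_2iso (rho X h #o rho X g) (rho X (h * g)) (phi X h g) (phiV X h g);
  Phi_iso g3 g2 g1 : g3 \in H -> g2 \in H -> g1 \in H ->
    is_3iso (rho X g3 #o rho X g2 #o rho X g1) (rho X (g3 * g2 * g1))
      (rho X g3 #l phi X g2 g1 #1 phi X g3 (g2 * g1))
      (phi X g3 g2 #r rho X g1 #1 phi X (g3 * g2) g1)
      (Phi X g3 g2 g1) (PhiV X g3 g2 g1);
  rho_1 : rho X 1 = one1;
  phi_1l g : g \in H -> phi X 1 g = id2 (rho X g);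
  phi_1r g : g \in H -> phi X g 1 = id2 (rho X g);
  Phi_cocycle g4 g3 g2 g1 :
    g4 \in H -> g3 \in H -> g2 \in H -> g1 \in H ->
    (rho X g4 #L Phi X g3 g2 g1) #I id3 (phi X g4 (g3 * g2 * g1))
    #2 id3 (rho X g4 #l phi X g3 g2 #r rho X g1) #I Phi X g4 (g3 * g2) g1
    #2 (Phi X g4 g3 g2 #R rho X g1) #I id3 (phi X (g4 * g3 * g2) g1)
    =
    id3 ((rho X g4 #o rho X g3) #l phi X g2 g1) #I Phi X g4 g3 (g2 * g1)
    #2 id3 (phi X g4 g3 #r (rho X g2 #o rho X g1)) #I Phi X (g4 * g3) g2 g1
}.

End Representations.

(** * Categories and categorical group actions

  The hom-set from [x] to [y] is the set of all [a] with [ishom x y a];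
  composition is in natural order. *)

Record cat := Cat {
  ob : Type; isob : ob -> Prop;
  ar : Type; ishom : ob -> ob -> ar -> Prop;
  idm : ob -> ar; cmp : ar -> ar -> ar }.

Record is_category (C : cat) : Prop := {
  hom_ob (x y : ob C) a : ishom x y a -> isob x /\ isob y;
  hom_id (x : ob C) : isob x -> ishom x x (idm x);
  hom_cmp (x y z : ob C) a b :
    ishom x y a -> ishom y z b -> ishom x z (cmp a b);
  cat_assoc (w x y z : ob C) a b c :
    ishom w x a -> ishom x y b -> ishom y z c ->
    cmp a (cmp b c) = cmp (cmp a b) c;
  cat_idl (x y : ob C) a : ishom x y a -> cmp (idm x) a = a;
  cat_idr (x y : ob C) a : ishom x y a -> cmp a (idm y) = a
}.

Definition is_iso (C : cat) (x y : ob C) (a : ar C) : Prop :=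
  exists b, [/\ ishom x y a, ishom y x b, cmp a b = idm x & cmp b a = idm y].

Record ftor (C D : cat) := Ftor { fob : ob C -> ob D; far : ar C -> ar D }.

Definition fid (C : cat) : ftor C C := Ftor id id.
(** First [F], then [G]. *)
Definition fthen (C D E : cat) (F : ftor C D) (G : ftor D E) : ftor C E :=
  Ftor (fob G \o fob F) (far G \o far F).

Record is_functor (C D : cat) (F : ftor C D) : Prop := {
  fob_ob x : isob x -> isob (fob F x);
  far_hom x y a : ishom x y a -> ishom (fob F x) (fob F y) (far F a);
  far_id x : isob x -> far F (idm x) = idm (fob F x);
  far_cmp x y z a b : ishom x y a -> ishom y z b ->
    far F (cmp a b) = cmp (far F a) (far F b)
}.

Record is_natiso (C D : cat) (F G : ftor C D) (t : ob C -> ar D) : Prop := {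
  natiso_iso x : isob x -> is_iso (fob F x) (fob G x) (t x);
  natiso_nat x y a : ishom x y a -> cmp (far F a) (t y) = cmp (t x) (far G a)
}.

Definition is_equivalence (C D : cat) (F : ftor C D) : Prop :=
  is_functor F /\ exists G : ftor D C, is_functor G /\
    (exists t, is_natiso (fthen F G) (fid C) t) /\
    (exists t, is_natiso (fthen G F) (fid D) t).

Section Actions.
Variable gT : finGroupType.

(** [act_gam h g] is the structure isomorphism [psi_h psi_g -> psi_(h * g)]. *)
Record cat_action (C : cat) := Action {
  act_fun : gT -> ftor C C;
  act_gam : gT -> gT -> ob C -> ar C }.

Definition is_unit (A : {set gT}) (C : cat) (X : cat_action C)
    (i : ob C -> ar C) : Prop :=
  [/\ is_natiso (act_fun X 1) (fid C) i,
      forall g x, g \in A -> isob x ->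
        act_gam X 1 g x = i (fob (act_fun X g) x) &
      forall g x, g \in A -> isob x ->
        act_gam X g 1 x = far (act_fun X g) (i x)].

Record is_cat_action (A : {set gT}) (C : cat) (X : cat_action C) : Prop := {
  action_cat : is_category C;
  action_equiv g : g \in A -> is_equivalence (act_fun X g);
  action_gam h g : h \in A -> g \in A ->
    is_natiso (fthen (act_fun X g) (act_fun X h)) (act_fun X (h * g))
      (act_gam X h g);
  action_assoc k h g x : k \in A -> h \in A -> g \in A -> isob x ->
    cmp (far (act_fun X k) (act_gam X h g x)) (act_gam X k (h * g) x) =
    cmp (act_gam X k h (fob (act_fun X g) x)) (act_gam X (k * h) g x);
  action_unit : exists i, is_unit A X i
}.

(** Equivalence of categories with [A]-action: an equivalence [F] with natural
    isomorphisms [t_g : F psi_g -> psi'_g F], compatible with the structure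
    isomorphisms and the unit isomorphisms. *)
Definition action_equivalent (A : {set gT}) (C D : cat)
    (X : cat_action C) (Y : cat_action D) : Prop :=
  exists (F : ftor C D) (t : gT -> ob C -> ar D),
  [/\ is_equivalence F,
      forall g, g \in A ->
        is_natiso (fthen (act_fun X g) F) (fthen F (act_fun Y g)) (t g),
      forall h g x, h \in A -> g \in A -> isob x ->
        cmp (far F (act_gam X h g x)) (t (h * g) x) =
        cmp (cmp (t h (fob (act_fun X g) x)) (far (act_fun Y h) (t g x)))
            (act_gam Y h g (fob F x)) &
      forall i j, is_unit A X i -> is_unit A Y j ->
        forall x, isob x -> far F (i x) = cmp (t 1 x) (j (fob F x))].

Definition coset_reps (B A : {set gT}) (m : nat) (b : 'I_m -> gT) : Prop :=
  (forall i, b i \in B) /\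
  (forall g, g \in B -> exists! i, g \in b i *: A).

(** Induction from [A] with coset representatives [b]: in [C^m], the [j]-th
    component of the image of [x] under [g] is [psi_a (x_i)], where [i] is the
    index with [g b_i = b_j a], [a] in [A].  (The default [j] is never used
    when [g] lies in the ambient group.) *)
Definition ind_idx (A : {set gT}) (m : nat) (b : 'I_m -> gT) (g : gT)
    (j : 'I_m) : 'I_m :=
  odflt j [pick i | (b j)^-1 * g * b i \in A].
Definition ind_elt (A : {set gT}) (m : nat) (b : 'I_m -> gT) (g : gT)
    (j : 'I_m) : gT :=
  (b j)^-1 * g * b (ind_idx A b g j).

Definition pow_cat (C : cat) (m : nat) : cat := {|
  ob := 'I_m -> ob C;
  isob := fun x => forall j, isob (x j);
  ar := 'I_m -> ar C;
  ishom := fun x y a => forall j, ishom (x j) (y j) (a j);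
  idm := fun x j => idm (x j);
  cmp := fun a b j => cmp (a j) (b j) |}.

Definition ind_action (A : {set gT}) (m : nat) (b : 'I_m -> gT)
    (C : cat) (X : cat_action C) : cat_action (pow_cat C m) :=
  @Action (pow_cat C m)
    (fun g => @Ftor (pow_cat C m) (pow_cat C m)
      (fun x j => fob (act_fun X (ind_elt A b g j)) (x (ind_idx A b g j)))
      (fun a j => far (act_fun X (ind_elt A b g j)) (a (ind_idx A b g j))))
    (fun h g x k =>
      let j := ind_idx A b h k in
      act_gam X (ind_elt A b h k) (ind_elt A b g j) (x (ind_idx A b g j))).

Definition sum_cat (n : nat) (C : 'I_n -> cat) : cat := {|
  ob := forall i, ob (C i);
  isob := fun x => forall i, isob (x i);
  ar := forall i, ar (C i);
  ishom := fun x y a => forall i, ishom (x i) (y i) (a i);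
  idm := fun x i => idm (x i);
  cmp := fun a b i => cmp (a i) (b i) |}.

(** [g] acts on the [i]-th summand through [g ^ r i = (r i)^-1 * g * r i]. *)
Definition sum_action (n : nat) (C : 'I_n -> cat)
    (X : forall i, cat_action (C i)) (r : 'I_n -> gT) : cat_action (sum_cat C) :=
  @Action (sum_cat C)
    (fun g => @Ftor (sum_cat C) (sum_cat C)
      (fun x i => fob (act_fun (X i) (g ^ r i)) (x i))
      (fun a i => far (act_fun (X i) (g ^ r i)) (a i)))
    (fun h g x i => act_gam (X i) (h ^ r i) (g ^ r i) (x i)).

End Actions.

(** * The 2-categorical trace and the action of the centralizer *)

Section Trace.
Variables (gT : finGroupType) (S : sig3) (X : rep3 gT S).

Definition trace_cat (f : gT) : cat := {|
  ob := C2 S; isob := T2 one1 (rho X f);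
  ar := C3 S; ishom := T3 one1 (rho X f);
  idm := @id3 S; cmp := @comp2 S |}.

Definition psi2 (f g : gT) (w : C2 S) : C2 S :=
  phiV X g g^-1 #1 (rho X g #l w #r rho X g^-1)
  #1 (phi X g f #r rho X g^-1) #1 phi X (g * f) g^-1.

Definition psi3 (f g : gT) (w : C3 S) : C3 S :=
  id3 (phiV X g g^-1) #I (rho X g #L w #R rho X g^-1)
  #I id3 (phi X g f #r rho X g^-1) #I id3 (phi X (g * f) g^-1).

Definition Lc (e h g : gT) : C2 S :=
  (rho X h #l phi X g e #r (rho X g^-1 #o rho X h^-1))
  #1 (rho X h #l phi X (g * e) g^-1 #r rho X h^-1)
  #1 (phi X h (g * e * g^-1) #r rho X h^-1)
  #1 phi X (h * g * e * g^-1) h^-1.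

Definition Rc (e h g : gT) : C2 S :=
  (phi X h g #r (rho X e #o rho X g^-1 #o rho X h^-1))
  #1 (phi X (h * g) e #r (rho X g^-1 #o rho X h^-1))
  #1 (rho X (h * g * e) #l phi X g^-1 h^-1)
  #1 phi X (h * g * e) (g^-1 * h^-1).

(** The #_1-inverses of [Lc e h g] and [Rc e h g]; see [Lc_iso], [Rc_iso]. *)
Definition LV (e h g : gT) : C2 S :=
  phiV X (h * g * e * g^-1) h^-1
  #1 (phiV X h (g * e * g^-1) #r rho X h^-1)
  #1 (rho X h #l phiV X (g * e) g^-1 #r rho X h^-1)
  #1 (rho X h #l phiV X g e #r (rho X g^-1 #o rho X h^-1)).

Definition RV (e h g : gT) : C2 S :=
  phiV X (h * g * e) (g^-1 * h^-1)
  #1 (rho X (h * g * e) #l phiV X g^-1 h^-1)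
  #1 (phiV X (h * g) e #r (rho X g^-1 #o rho X h^-1))
  #1 (phiV X h g #r (rho X e #o rho X g^-1 #o rho X h^-1)).

(** The 3-arrow [Lc e h g -> Rc e h g]. *)
Definition Lam (e h g : gT) : C3 S :=
  id3 (rho X h #l phi X g e #r (rho X g^-1 #o rho X h^-1))
    #I (Phi X h (g * e) g^-1 #R rho X h^-1)
    #I id3 (phi X (h * g * e * g^-1) h^-1)
  #2 (Phi X h g e #R (rho X g^-1 #o rho X h^-1))
    #I id3 (phi X (h * g * e) g^-1 #r rho X h^-1)
    #I id3 (phi X (h * g * e * g^-1) h^-1)
  #2 id3 (phi X h g #r (rho X e #o rho X g^-1 #o rho X h^-1))
    #I id3 (phi X (h * g) e #r (rho X g^-1 #o rho X h^-1))
    #I PhiV X (h * g * e) g^-1 h^-1.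

(** The #_2-inverse of [Lam e h g]; see [Lam_iso]. *)
Definition LamV (e h g : gT) : C3 S :=
  id3 (phi X h g #r (rho X e #o rho X g^-1 #o rho X h^-1))
    #I id3 (phi X (h * g) e #r (rho X g^-1 #o rho X h^-1))
    #I Phi X (h * g * e) g^-1 h^-1
  #2 (PhiV X h g e #R (rho X g^-1 #o rho X h^-1))
    #I id3 (phi X (h * g * e) g^-1 #r rho X h^-1)
    #I id3 (phi X (h * g * e * g^-1) h^-1)
  #2 id3 (rho X h #l phi X g e #r (rho X g^-1 #o rho X h^-1))
    #I (PhiV X h (g * e) g^-1 #R rho X h^-1)
    #I id3 (phi X (h * g * e * g^-1) h^-1).

Definition Gam (f h g : gT) (w : C2 S) : C3 S :=
  (id3 (LV 1 h g) #I LamV 1 h g #I id3 (RV 1 h g))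
  #I id3 ((rho X h #o rho X g) #l w #r (rho X g^-1 #o rho X h^-1))
  #I Lam f h g.

Definition trace_action (f : gT) : cat_action gT (trace_cat f) :=
  @Action gT (trace_cat f)
    (fun g => @Ftor (trace_cat f) (trace_cat f) (psi2 f g) (psi3 f g))
    (Gam f).

End Trace.

Section Inverses.
Variables (gT : finGroupType) (S : sig3) (HS : is_strict3 S).
Variables (H : {group gT}) (X : rep3 gT S) (HX : is_rep3 H X).
Local Notation r := (rho X).
Local Notation p := (phi X).
Local Notation q := (phiV X).
Local Lemma r1 h : h \in H -> T1 (r h). Proof. by case/(rho_iso HX). Qed.
Local Lemma T1c (F G : C1 S) : T1 F -> T1 G -> T1 (F #o G). Proof. exact: T1_comp0. Qed.
Ltac gr := rewrite ?(groupM, groupV, group1) //.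
Ltac t1 := repeat first [ assumption | apply: T1c | apply: r1; gr | exact: (T1_one HS)].
Local Lemma pT h g : h \in H -> g \in H -> T2 (r h #o r g) (r (h*g)) (p h g).
Proof. by move=> a b; case: (phi_iso HX a b). Qed.
Local Lemma T2e (F G F' G' : C1 S) s : T2 F G s -> F = F' -> G = G' -> T2 F' G' s.
Proof. by move=> ? <- <-. Qed.
Ltac ceq := rewrite ?(comp0A HS) ?mulgA ?mulgV ?mul1g ?mulg1 ?(rho_1 HX) ?(comp0idl HS) ?(comp0idr HS); t1; try done.
Local Lemma iso_c (F G I : C1 S) s s' t t' : is_2iso F G s s' -> is_2iso G I t t' -> is_2iso F I (s #1 t) (t' #1 s').
Proof.
case=> a b c d [a' b' c' d']; split; try (apply: T2_comp1; eassumption).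
- rewrite (comp1A HS (T2_comp1 HS a a') b' b) -(comp1A HS a a' b') c' (comp1idr HS a) //.
- rewrite (comp1A HS (T2_comp1 HS b' b) a a') -(comp1A HS b' b a) d (comp1idr HS b') //.
Qed.
Local Lemma iso_l (I F G : C1 S) s s' : T1 I -> is_2iso F G s s' -> is_2iso (I #o F) (I #o G) (I #l s) (I #l s').
Proof.
move=> h [a b c d]; split; try (apply: T2_lw2; eassumption).
 by rewrite -(lw2_comp1 HS h a b) c lw2_id2 //; case: (T2_T1 HS a).
 by rewrite -(lw2_comp1 HS h b a) d lw2_id2 //; case: (T2_T1 HS a).
Qed.
Local Lemma iso_r (I F G : C1 S) s s' : T1 I -> is_2iso F G s s' -> is_2iso (F #o I) (G #o I) (s #r I) (s' #r I).
Proof.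
move=> h [a b c d]; split; try (apply: T2_rw2; eassumption).
 by rewrite -(rw2_comp1 HS a b h) c rw2_id2 //; case: (T2_T1 HS a).
 by rewrite -(rw2_comp1 HS b a h) d rw2_id2 //; case: (T2_T1 HS a).
Qed.
Local Lemma iso_e (F G F' G' : C1 S) s t : is_2iso F G s t -> F = F' -> G = G' -> is_2iso F' G' s t.
Proof. by move=> ? <- <-. Qed.
Local Lemma pI h g : h \in H -> g \in H -> is_2iso (r h #o r g) (r (h*g)) (p h g) (q h g).
Proof. exact: (phi_iso HX). Qed.

Local Lemma comp1A4 (F G I J K' : C1 S) s t u v : T2 F G s -> T2 G I t -> T2 I J u -> T2 J K' v ->
  s #1 (t #1 (u #1 v)) = s #1 t #1 u #1 v.
Proof. move=> a b c d. rewrite !(comp1A HS a b (T2_comp1 HS c d)). by rewrite (comp1A HS (T2_comp1 HS a b) c d). Qed.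

Local Lemma iso4 (F G I J K' : C1 S) s t u v s' t' u' v' : is_2iso F G s s' -> is_2iso G I t t' -> is_2iso I J u u' -> is_2iso J K' v v' ->
  is_2iso F K' (s #1 t #1 u #1 v) (v' #1 u' #1 t' #1 s').
Proof.
move=> a b c d. have := iso_c (iso_c (iso_c a b) c) d.
case: a b c d => _ a _ _ [_ b _ _] [_ c _ _] [_ d _ _]. by rewrite (comp1A4 d c b a).
Qed.

Variables e h g : gT.
Hypotheses (eH : e \in H) (hH : h \in H) (gH : g \in H).
Lemma Lc_iso : is_2iso (r h #o r g #o r e #o r g^-1 #o r h^-1) (r (h * g * e * g^-1 * h^-1)) (Lc X e h g) (LV X e h g).
Proof.
apply: (@iso4 _ (r h #o r (g*e) #o r g^-1 #o r h^-1) (r h #o r (g*e*g^-1) #o r h^-1) (r (h * g * e * g^-1) #o r h^-1)).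
- apply: iso_e. apply: iso_r; last apply: iso_l; last apply: pI; t1. all: ceq.
- apply: iso_e. apply: iso_r; last apply: iso_l; last apply: pI; t1; gr. all: ceq.
- apply: iso_e. apply: iso_r; last apply: pI; t1; gr. all: ceq.
- apply: iso_e. apply: pI; t1; gr. all: ceq.
Qed.
Lemma Rc_iso : is_2iso (r h #o r g #o r e #o r g^-1 #o r h^-1) (r (h * g * e * g^-1 * h^-1)) (Rc X e h g) (RV X e h g).
Proof.
apply: (@iso4 _ (r (h*g) #o r e #o r g^-1 #o r h^-1) (r (h*g*e) #o r g^-1 #o r h^-1) (r (h * g * e) #o r (g^-1 * h^-1))).
- apply: iso_e. apply: iso_r; last apply: pI; t1. all: ceq.
- apply: iso_e. apply: iso_r; last apply: pI; t1; gr. all: ceq.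
- apply: iso_e. apply: iso_l; last apply: pI; t1; gr. all: ceq.
- apply: iso_e. apply: pI; t1; gr. all: ceq.
Qed.

Local Lemma i3id (F G : C1 S) s : T2 F G s -> is_3iso F G s s (id3 s) (id3 s).
Proof. move=> a; have b := T3_id3 HS a; split=> //; exact: (comp2idl HS b). Qed.
Local Lemma i3c (F G : C1 S) s t u m m' n n' : is_3iso F G s t m m' -> is_3iso F G t u n n' -> is_3iso F G s u (m #2 n) (n' #2 m').
Proof.
case=> a b c d [a' b' c' d']; split; try (apply: T3_comp2; eassumption).
- rewrite (comp2A HS (T3_comp2 HS a a') b' b) -(comp2A HS a a' b') c' (comp2idr HS a) //.
- rewrite (comp2A HS (T3_comp2 HS b' b) a a') -(comp2A HS b' b a) d (comp2idr HS b') //.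
Qed.
Local Lemma i3h (F G I : C1 S) s s' t t' m m' n n' : is_3iso F G s s' m m' -> is_3iso G I t t' n n' -> is_3iso F I (s #1 t) (s' #1 t') (m #I n) (m' #I n').
Proof.
case=> a b c d [a' b' c' d']; have [??] := T3_T2 HS a; have [??] := T3_T2 HS a'.
split; try (apply: T3_hcomp1; eassumption).
- by rewrite -(hcomp1_comp2 HS a b a' b') c c'; apply: hcomp1_id3; eassumption.
- by rewrite -(hcomp1_comp2 HS b a b' a') d d'; apply: hcomp1_id3; eassumption.
Qed.
Local Lemma i3r (I F G : C1 S) s s' m m' : T1 I -> is_3iso F G s s' m m' -> is_3iso (F #o I) (G #o I) (s #r I) (s' #r I) (m #R I) (m' #R I).
Proof.
move=> i [a b c d]; have [??] := T3_T2 HS a; split; try (apply: T3_rw3; eassumption).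
 by rewrite -(rw3_comp2 HS a b i) c; apply: rw3_id3; eassumption.
 by rewrite -(rw3_comp2 HS b a i) d; apply: rw3_id3; eassumption.
Qed.
Local Lemma i3e (F G F' G' : C1 S) s t s' t' m n : is_3iso F G s t m n -> F = F' -> G = G' -> s = s' -> t = t' -> is_3iso F' G' s' t' m n.
Proof. by move=> ? <- <- <- <-. Qed.
Ltac T2s := first [ eapply T2e; [apply: T2_rw2 => //; [eapply T2_lw2 => //; [|apply: pT; gr]|] |..]
  | eapply T2e; [apply: T2_rw2 => //; [apply: pT; gr|] | ..]
  | eapply T2e; [apply: T2_lw2 => //; [|apply: pT; gr] | ..]
  | eapply T2e; [apply: pT; gr | ..] ]; t1; ceq.

Lemma Lam_iso : is_3iso (r h #o r g #o r e #o r g^-1 #o r h^-1) (r (h * g * e * g^-1 * h^-1)) (Lc X e h g) (Rc X e h g) (Lam X e h g) (LamV X e h g).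
Proof.
have geH : g * e \in H by gr.
have hgeH : h * g * e \in H by gr.
have hgH : h * g \in H by gr.
have gV : g^-1 \in H by gr.
have hV : h^-1 \in H by gr.
set A := r h #l p g e #r (r g^-1 #o r h^-1).
set Z := p (h * g * e * g^-1) h^-1.
have TA : T2 (r h #o r g #o r e #o r g^-1 #o r h^-1) (r h #o r (g*e) #o r g^-1 #o r h^-1) A by T2s.
have TZ : T2 (r (h * g * e * g^-1) #o r h^-1) (r (h * g * e * g^-1 * h^-1)) Z by T2s.
pose B := r h #l p (g * e) g^-1 #r r h^-1.
have TB : T2 (r h #o r (g*e) #o r g^-1 #o r h^-1) (r h #o r (g*e*g^-1) #o r h^-1) B by T2s.
pose C := p h (g * e * g^-1) #r r h^-1.
have TC : T2 (r h #o r (g*e*g^-1) #o r h^-1) (r (h * g*e*g^-1) #o r h^-1) C by T2s.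
pose D := p h (g * e) #r (r g^-1 #o r h^-1).
have TD : T2 (r h #o r (g*e) #o r g^-1 #o r h^-1) (r (h * g*e) #o r g^-1 #o r h^-1) D by T2s.
pose E := p (h * g * e) g^-1 #r r h^-1.
have TE : T2 (r (h * g*e) #o r g^-1 #o r h^-1) (r (h * g*e*g^-1) #o r h^-1) E by T2s.
pose P := p h g #r (r e #o r g^-1 #o r h^-1).
have TP : T2 (r h #o r g #o r e #o r g^-1 #o r h^-1) (r (h * g) #o r e #o r g^-1 #o r h^-1) P by T2s.
pose Q := p (h * g) e #r (r g^-1 #o r h^-1).
have TQ : T2 (r (h * g) #o r e #o r g^-1 #o r h^-1) (r (h * g * e) #o r g^-1 #o r h^-1) Q by T2s.
pose M := r (h * g * e) #l p g^-1 h^-1.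
have TM : T2 (r (h * g * e) #o r g^-1 #o r h^-1) (r (h * g * e) #o r (g^-1 * h^-1)) M by T2s.
pose N := p (h * g * e) (g^-1 * h^-1).
have TN : T2 (r (h * g * e) #o r (g^-1 * h^-1)) (r (h * g * e * g^-1 * h^-1)) N by T2s.
have F1 := Phi_iso HX hH geH gV.
have F2 := Phi_iso HX hH gH eH.
have F3 := Phi_iso HX hgeH gV hV.
have G1 : is_3iso (r h #o r (g*e) #o r g^-1 #o r h^-1) (r (h * g * e * g^-1) #o r h^-1)
   (B #1 C) (D #1 E) (Phi X h (g * e) g^-1 #R r h^-1) (PhiV X h (g * e) g^-1 #R r h^-1).
  apply: i3e; first apply: (i3r _ F1); t1; try (by ceq).
  - rewrite (rw2_comp1 HS (G := r h #o r (g*e*g^-1)) (F := r h #o r (g*e) #o r g^-1) (I := r (h * g * e * g^-1))) //; t1; T2s.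
  - rewrite (rw2_comp1 HS (G := r (h * g*e) #o r (g^-1)) (F := r h #o r (g*e) #o r g^-1) (I := r (h * g * e * g^-1))) //; t1; try T2s.
    rewrite /D /E -(rw2_comp0 HS (pT hH geH)) ?mulgA //; t1.
have G2 : is_3iso (r h #o r g #o r e #o r g^-1 #o r h^-1) (r (h * g * e) #o r g^-1 #o r h^-1)
   (A #1 D) (P #1 Q) (Phi X h g e #R (r g^-1 #o r h^-1)) (PhiV X h g e #R (r g^-1 #o r h^-1)).
  apply: i3e; first apply: (i3r _ F2); t1; try (by ceq).
  - rewrite (rw2_comp1 HS (G := r h #o r (g*e)) (F := r h #o r g #o r e) (I := r (h * g * e))) //; t1; T2s.
  - rewrite (rw2_comp1 HS (G := r (h*g) #o r e) (F := r h #o r g #o r e) (I := r (h * g * e))) //; t1; try T2s.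
    rewrite /P /Q -(rw2_comp0 HS (pT hH gH)) //; t1. by rewrite (comp0A HS); t1.
have G3 : is_3iso (r (h * g * e) #o r g^-1 #o r h^-1) (r (h * g * e * g^-1 * h^-1))
    (E #1 Z) (M #1 N) (PhiV X (h * g * e) g^-1 h^-1) (Phi X (h * g * e) g^-1 h^-1).
  by case: F3 => *; split.
have e1 : Lc X e h g = A #1 (B #1 C) #1 Z.
  by rewrite (comp1A HS TA TB TC).
have e2 : A #1 (D #1 E) #1 Z = (A #1 D) #1 E #1 Z by rewrite (comp1A HS TA TD TE).
have e3 : (P #1 Q) #1 (E #1 Z) = (P #1 Q) #1 E #1 Z.
  by rewrite (comp1A HS (T2_comp1 HS TP TQ) TE TZ).
have e4 : Rc X e h g = (P #1 Q) #1 (M #1 N).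
  by rewrite (comp1A HS (T2_comp1 HS TP TQ) TM TN).
rewrite e1 e4.
have K1 := i3h (i3h (i3id TA) G1) (i3id TZ).
have K2 := i3h (i3h G2 (i3id TE)) (i3id TZ).
have K3 := i3h (i3h (i3id TP) (i3id TQ)) G3.
rewrite e2 in K1. rewrite e3 in K3.
have := i3c (i3c K1 K2) K3.
case: (K1) (K2) (K3) => _ k1 _ _ [_ k2 _ _] [_ k3 _ _].
by rewrite /Lam /LamV (comp2A HS k3 k2 k1).
Qed.
End Inverses.

(** * Matrices over a one-object 3-dimensional structure

  [None] is the zero functor, transformation or modification. *)

Section Matrices.
Variables (S : sig3) (m : nat).

Definition mat (T : Type) := 'I_m -> 'I_m -> option T.

Definition omap2 (A B C : Type) (f : A -> B -> C)
    (a : option A) (b : option B) : option C :=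
  if a is Some x then if b is Some y then Some (f x y) else None else None.

(** [sum_l f a_jl b_lk]; for the matrices at hand at most one term is
    nonzero. *)
Definition matmul (A B C : Type) (f : A -> B -> C) (a : mat A) (b : mat B) :
    mat C :=
  fun j k =>
    if [pick l | isSome (omap2 f (a j l) (b l k))] is Some l
    then omap2 f (a j l) (b l k) else None.

Definition matmap (A B : Type) (f : A -> B) (a : mat A) : mat B :=
  fun j k => omap f (a j k).
Definition matmap2 (A B C : Type) (f : A -> B -> C) (a : mat A) (b : mat B) :
    mat C :=
  fun j k => omap2 f (a j k) (b j k).

Definition mat_T1 (a : mat (C1 S)) : Prop :=
  [/\ forall j k F, a j k = Some F -> T1 F,
      forall j k k', isSome (a j k) -> isSome (a j k') -> k = k' &
      forall j j' k, isSome (a j k) -> isSome (a j' k) -> j = j'].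

Definition entry_T2 (F G : option (C1 S)) (s : option (C2 S)) : Prop :=
  match F, G with
  | Some F, Some G => exists2 x, s = Some x & T2 F G x
  | _, _ => s = None
  end.

Definition mat_T2 (a b : mat (C1 S)) (s : mat (C2 S)) : Prop :=
  [/\ mat_T1 a, mat_T1 b & forall j k, entry_T2 (a j k) (b j k) (s j k)].

Definition entry_T3 (F G : option (C1 S)) (s t : option (C2 S))
    (u : option (C3 S)) : Prop :=
  match F, G with
  | Some F, Some G => exists x y z,
      [/\ s = Some x, t = Some y, u = Some z & T3 F G x y z]
  | _, _ => u = None
  end.

Definition mat_T3 (a b : mat (C1 S)) (s t : mat (C2 S)) (u : mat (C3 S)) :
    Prop :=
  [/\ mat_T2 a b s, mat_T2 a b t &
      forall j k, entry_T3 (a j k) (b j k) (s j k) (t j k) (u j k)].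

Definition mat_sig3 : sig3 := {|
  C1 := mat (C1 S); C2 := mat (C2 S); C3 := mat (C3 S);
  T1 := mat_T1; T2 := mat_T2; T3 := mat_T3;
  one1 := fun j k => if j == k then Some one1 else None;
  id2 := matmap (@id2 S); id3 := matmap (@id3 S);
  comp0 := matmul (@comp0 S);
  lw2 := matmul (@lw2 S); rw2 := matmul (@rw2 S);
  lw3 := matmul (@lw3 S); rw3 := matmul (@rw3 S);
  comp1 := matmap2 (@comp1 S);
  hcomp1 := matmap2 (@hcomp1 S);
  comp2 := matmap2 (@comp2 S) |}.

End Matrices.

(** * The induced 3-representation *)

Section Induced.
Variables (gT : finGroupType) (S : sig3) (H : {set gT}) (X : rep3 gT S).
Variables (m : nat) (r : 'I_m -> gT).

(** [g r_i = r_j h] means [h = cos j g i]. *)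
Definition cos (j : 'I_m) (g : gT) (i : 'I_m) : gT := (r j)^-1 * g * r i.

Definition ind_mat2 (T : Type) (q : gT -> gT -> T) (g2 g1 : gT) : mat m T :=
  fun k i =>
    if [pick j | (cos j g1 i \in H) && (cos k g2 j \in H)] is Some j
    then Some (q (cos k g2 j) (cos j g1 i)) else None.

Definition ind_mat3 (T : Type) (q : gT -> gT -> gT -> T) (g3 g2 g1 : gT) :
    mat m T :=
  fun l i =>
    if [pick jk : 'I_m * 'I_m | [&& cos jk.1 g1 i \in H,
          cos jk.2 g2 jk.1 \in H & cos l g3 jk.2 \in H]] is Some jk
    then Some (q (cos l g3 jk.2) (cos jk.2 g2 jk.1) (cos jk.1 g1 i))
    else None.

Definition ind_rep3 : rep3 gT (mat_sig3 S m) :=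
  @Rep3 gT (mat_sig3 S m)
    (fun g j i => if cos j g i \in H then Some (rho X (cos j g i)) else None)
    (ind_mat2 (phi X)) (ind_mat2 (phiV X))
    (ind_mat3 (Phi X)) (ind_mat3 (PhiV X)).

End Induced.

(* Main.v *)
(** A 2-arrow [1 => rho^ f] is a diagonal matrix, and its entry at the coset
    [c_j H] can be nonzero only if [f] fixes this coset.  So the trace of the
    induced representation is the product, over the fixed cosets, of the traces
    of [rho] at [c_j^-1 f c_j], and [C_G(f)] permutes the factors while acting
    through the functors [psi] and the isomorphisms [Gam].  The fixed cosets in
    the orbit belonging to [h_i] are [r_i b H] with [b] in
    [C_G(h_i) / C_H(h_i)], so the induced action on the trace at [h_i] has the
    same shape, and [psi_s] with [s] in [H] compares the conjugating elements on
    the two sides.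

    Everything then rests on the associativity of [Gam].  The 2-arrows into the
    [rho g] form a monoidal category with associator [Phi], where Mac Lane's
    coherence theorem holds; in it [Gam] is the comparison of one coherence
    isomorphism at the object [x : 1 => rho f] with the same isomorphism at the
    identity of [1], and associativity is an instance of coherence. *)

Require Import Defs.
From mathcomp Require Import all_boot all_algebra all_fingroup.
From Stdlib Require Import FunctionalExtensionality ClassicalEpsilon.

Set Implicit Arguments.
Unset Strict Implicit.
Unset Printing Implicit Defensive.

Local Open Scope group_scope.
Local Open Scope sig3_scope.
Local Notation idm := Defs.idm.

(** * A monoidal structure on 2-arrows into the representation, and its coherence *)

(** Coherence does not apply to the trace as it stands: [psi_g x] starts at the identity 1-arrow,
    while the tensor product [g (x) x (x) g^-1] starts at [rho g #o rho g^-1]. Objects therefore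
    have an arbitrary source, and precomposition with 2-arrows such as [phi g g^-1] commutes with
    tensor products and associators. [Gam] moreover contains inverses of 2-arrows and 3-arrows. They
    disappear from the equation that the coherence isomorphism at [x] is the one at the identity
    followed under #_1 by [Gam]; its left factor is invertible, so naturality and associativity of
    [Gam] follow by cancellation.

    As [rho 1] is the identity and [phi] is normalized, 1 acts strictly trivially on the traces, and
    the unit conditions follow from associativity. Both sides of the theorem are strictly isomorphic
    to families of traces over an index set with a [C_G(f)]-action and an [H]-valued cocycle. The
    two cocycles are cohomologous through elements [s_j] of [H]; the equivalence intertwines the
    actions by [Gam] followed by an inverse [Gam], and its compatibility amounts to three instances
    of associativity. *)

Section Monoidal.
Variables (gT : finGroupType) (S : sig3) (HS : is_strict3 S).
Variables (H : {group gT}) (X : rep3 gT S) (HX : is_rep3 H X).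
Local Notation r := (rho X).
Local Notation p := (phi X).

Lemma T1_rho h : h \in H -> T1 (r h).
Proof. by case/(rho_iso HX). Qed.

Lemma T2_eq (F G F' G' : C1 S) s :
  T2 F G s -> F = F' -> G = G' -> T2 F' G' s.
Proof. by move=> ? <- <-. Qed.

Lemma T3_eq (F G F' G' : C1 S) s t s' t' m : T3 F G s t m ->
  F = F' -> G = G' -> s = s' -> t = t' -> T3 F' G' s' t' m.
Proof. by move=> ? <- <- <- <-. Qed.

Lemma T2_cmp (F G G' I : C1 S) s t :
  T2 F G s -> T2 G' I t -> G = G' -> T2 F I (s #1 t).
Proof. by move=> a b e; rewrite -e in b; apply: T2_comp1 a b. Qed.

Lemma T3_hcmp (F G G' I : C1 S) s s' t t' m n :
  T3 F G s s' m -> T3 G' I t t' n -> G = G' ->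
  T3 F I (s #1 t) (s' #1 t') (m #I n).
Proof. by move=> a b e; rewrite -e in b; apply: T3_hcomp1 a b. Qed.

Lemma T3_cmp (F G F' G' : C1 S) s t t' u m n :
  T3 F G s t m -> T3 F' G' t' u n -> F = F' -> G = G' -> t = t' ->
  T3 F G s u (m #2 n).
Proof. by move=> a b ? ? ?; subst; apply: T3_comp2 a b. Qed.

Lemma T2_phi h g : h \in H -> g \in H -> T2 (r h #o r g) (r (h * g)) (p h g).
Proof. by move=> a b; case: (phi_iso HX a b). Qed.

Lemma T2_phiV h g : h \in H -> g \in H ->
  T2 (r (h * g)) (r h #o r g) (phiV X h g).
Proof. by move=> a b; case: (phi_iso HX a b). Qed.

Lemma T3_Phi a b c : a \in H -> b \in H -> c \in H ->
  T3 (r a #o r b #o r c) (r (a * b * c))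
     (r a #l p b c #1 p a (b * c)) (p a b #r r c #1 p (a * b) c) (Phi X a b c).
Proof. by move=> ha hb hc; case: (Phi_iso HX ha hb hc). Qed.

Lemma T3_PhiV a b c : a \in H -> b \in H -> c \in H ->
  T3 (r a #o r b #o r c) (r (a * b * c))
     (p a b #r r c #1 p (a * b) c) (r a #l p b c #1 p a (b * c)) (PhiV X a b c).
Proof. by move=> ha hb hc; case: (Phi_iso HX ha hb hc). Qed.

(* The operations are partial, so every law has typing premises.  [t1], [t2] and
   [t3] prove them by reading the boundaries off the syntax; these agree with
   the expected ones only up to associativity and group identities ([weq]).
   [rw] and [rwb] rewrite with a law and discharge its premises in this way;
   [nf2] and [nf3] push all whiskerings down to the generators, so that what
   remains to be done by hand is interchange. *)
Ltac inH := by rewrite ?(groupM, groupV, group1).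
Ltac t1 := lazymatch goal with
  | |- T1 (_ #o _) => apply: (T1_comp0 HS); t1
  | |- T1 one1 => exact: (T1_one HS)
  | |- T1 (rho _ _) => apply: T1_rho; inH
  | |- T1 _ => assumption
  end.
Ltac weq := try reflexivity;
  rewrite ?mulgA ?mulgK ?mulgKV ?mulgV ?mulVg ?mulg1 ?mul1g ?(rho_1 HX);
  repeat first [erewrite (comp0A HS); [|t1..]
    | erewrite (comp0idl HS); [|t1] | erewrite (comp0idr HS); [|t1]];
  try reflexivity.
Ltac inf2 := lazymatch goal with
  | |- T2 _ _ (_ #1 _) => eapply T2_cmp; [inf2 | inf2 | weq]
  | |- T2 _ _ (_ #l _) => eapply (T2_lw2 HS); [t1 | inf2]
  | |- T2 _ _ (_ #r _) => eapply (T2_rw2 HS); [inf2 | t1]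
  | |- T2 _ _ (id2 _) => eapply (T2_id2 HS); t1
  | |- T2 _ _ (phi _ _ _) => eapply T2_phi; inH
  | |- T2 _ _ (phiV _ _ _) => eapply T2_phiV; inH
  | |- _ => eassumption
  end.
Ltac t2 := eapply T2_eq; [inf2 | weq | weq].
Tactic Notation "rw2'" uconstr(l) :=
  erewrite l; [|lazymatch goal with |- T1 _ => t1 | |- T2 _ _ _ => t2 end..].
Tactic Notation "rwb2'" uconstr(l) :=
  erewrite <- l; [|lazymatch goal with |- T1 _ => t1 | |- T2 _ _ _ => t2 end..].
Ltac nf2 := repeat first
  [ rw2' (rw2_comp1 HS) | rw2' (lw2_comp1 HS) | rw2' (comp1A HS)
  | rw2' (lw2_id2 HS) | rw2' (rw2_id2 HS) | rw2' (comp1idl HS) | rw2' (comp1idr HS)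
  | rw2' (lw2_one HS) | rw2' (rw2_one HS)
  | rwb2' (lw2_comp0 HS) | rwb2' (rw2_comp0 HS) | rwb2' (lw2_rw2 HS) | rw2' (comp0A HS)
  | rw2' (comp0idl HS) | rw2' (comp0idr HS) ];
  rewrite ?mulgA.

Ltac weq2 := try reflexivity; nf2; try reflexivity.
Ltac inf3 := lazymatch goal with
  | |- T3 _ _ _ _ (_ #2 _) => eapply T3_cmp; [inf3 | inf3 | weq | weq | weq2]
  | |- T3 _ _ _ _ (_ #I _) => eapply T3_hcmp; [inf3 | inf3 | weq]
  | |- T3 _ _ _ _ (_ #L _) => eapply (T3_lw3 HS); [t1 | inf3]
  | |- T3 _ _ _ _ (_ #R _) => eapply (T3_rw3 HS); [inf3 | t1]
  | |- T3 _ _ _ _ (id3 _) => eapply (T3_id3 HS); t2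
  | |- T3 _ _ _ _ (Phi _ _ _ _) => eapply T3_Phi; inH
  | |- T3 _ _ _ _ (PhiV _ _ _ _) => eapply T3_PhiV; inH
  | |- _ => eassumption
  end.
Ltac t3 := eapply T3_eq; [inf3 | weq | weq | weq2 | weq2].
Ltac ty := lazymatch goal with
  | |- T1 _ => t1 | |- T2 _ _ _ => t2 | |- T3 _ _ _ _ _ => t3 end.
Tactic Notation "rw" uconstr(l) := erewrite l; [|ty..].
Tactic Notation "rwb" uconstr(l) := erewrite <- l; [|ty..].

(* An object is a 2-arrow [os : oF => rho og].  The 2-arrows [phi] turn these
   into the objects of a graded monoidal category with associator [Phi], whose
   morphisms are 3-arrows.  [pull] is precomposition with a 2-arrow [F => oF A]. *)
Record obj := Obj { oF : C1 S; og : gT; os : C2 S }.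
Definition wf_obj A := og A \in H /\ T2 (oF A) (r (og A)) (os A).
Definition tens A B := Obj (oF A #o oF B) (og A * og B)
  (os A #r oF B #1 r (og A) #l os B #1 p (og A) (og B)).
Definition pull F u A := Obj F (og A) (u #1 os A).

Lemma wf_tens A B : wf_obj A -> wf_obj B -> wf_obj (tens A B).
Proof.
case: A B => [F a s] [G b t] [/= aH Ts] [/= bH Tt]; split; first by inH.
have [? ?] := T2_T1 HS Ts. have [? ?] := T2_T1 HS Tt.
rewrite /=. t2.
Qed.

(** Normal forms are bracketed to the left, so the two factors to be interchanged stand next to each
    other only up to associativity with the preceding [z]. The variants for 3-arrows below also
    cover identity factors, whose whiskerings [nf3] has already evaluated. *)
Lemma interchange2_at (F G F' G' I : C1 S) z s t : T2 I (F #o F') z -> T2 F G s -> T2 F' G' t ->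
  z #1 s #r F' #1 G #l t = z #1 F #l t #1 s #r G'.
Proof.
move=> Tz Ts Tt; have [? ?] := T2_T1 HS Ts; have [? ?] := T2_T1 HS Tt.
rwb (comp1A HS). rw (interchange2 HS). rw (comp1A HS). by [].
Qed.

Lemma interchange3_at (F G F' G' I : C1 S) z z' k s s' t t' m n :
  T3 I (F #o F') z z' k -> T3 F G s s' m -> T3 F' G' t t' n ->
  k #I m #R F' #I G #L n = k #I F #L n #I m #R G'.
Proof.
move=> Tz Tm Tn; have [Ts _] := T3_T2 HS Tm; have [Tt _] := T3_T2 HS Tn.
have [? ?] := T2_T1 HS Ts; have [? ?] := T2_T1 HS Tt.
rwb (hcomp1A HS). rw (interchange3 HS). rw (hcomp1A HS). by [].
Qed.

(** One interchange moves [v] in front of [os A]. *)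
Lemma tens_pull F u A G v B : wf_obj A -> wf_obj B -> T2 F (oF A) u -> T2 G (oF B) v ->
  tens (pull F u A) (pull G v B) =
  pull (F #o G) (u #r G #1 oF A #l v) (tens A B).
Proof.
case: A B => [FA a s] [FB b t] [/= aH Ts] [/= bH Tt] Tu Tv.
have [? ?] := T2_T1 HS Ts; have [? ?] := T2_T1 HS Tt.
have [? _] := T2_T1 HS Tu; have [? _] := T2_T1 HS Tv.
rewrite /tens /pull /=. congr (Obj _ _ _).
nf2.
rw interchange2_at. by [].
Qed.

Lemma interchange3_atl (F G F' G' I : C1 S) z z' k s s' t m :
  T3 I (F #o F') z z' k -> T3 F G s s' m -> T2 F' G' t ->
  k #I m #R F' #I id3 (G #l t) = k #I id3 (F #l t) #I m #R G'.
Proof.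
move=> Tz Tm Tt; have [Ts _] := T3_T2 HS Tm.
have [? ?] := T2_T1 HS Ts; have [? ?] := T2_T1 HS Tt.
rwb (lw3_id3 HS). rw interchange3_at. rw (lw3_id3 HS). by [].
Qed.

Lemma interchange3_atr (F G F' G' I : C1 S) z z' k s t t' n :
  T3 I (F #o F') z z' k -> T2 F G s -> T3 F' G' t t' n ->
  k #I id3 (s #r F') #I G #L n = k #I F #L n #I id3 (s #r G').
Proof.
move=> Tz Ts Tn; have [Tt _] := T3_T2 HS Tn.
have [? ?] := T2_T1 HS Ts; have [? ?] := T2_T1 HS Tt.
rwb (rw3_id3 HS). rw interchange3_at. rw (rw3_id3 HS). by [].
Qed.

Lemma interchange3_ati (F G F' G' I : C1 S) z z' k s t :
  T3 I (F #o F') z z' k -> T2 F G s -> T2 F' G' t ->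
  k #I id3 (s #r F') #I id3 (G #l t) = k #I id3 (F #l t) #I id3 (s #r G').
Proof.
move=> Tz Ts Tt.
have [? ?] := T2_T1 HS Ts; have [? ?] := T2_T1 HS Tt.
rwb (rw3_id3 HS). rw interchange3_atl. rw (rw3_id3 HS). by [].
Qed.

Ltac nf3 := repeat first
  [ rw (rw3_hcomp1 HS) | rw (lw3_hcomp1 HS) | rw (hcomp1A HS)
  | rw (lw3_id3 HS) | rw (rw3_id3 HS) | rwb (hcomp1_id3 HS)
  | rw (hcomp1idl HS) | rw (hcomp1idr HS)
  | rw (lw3_one HS) | rw (rw3_one HS)
  | rwb (lw3_comp0 HS) | rwb (rw3_comp0 HS) | rwb (lw3_rw3 HS)
  | rw (rw2_comp1 HS) | rw (lw2_comp1 HS) | rw (comp1A HS)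
  | rw (lw2_id2 HS) | rw (rw2_id2 HS) | rw (comp1idl HS) | rw (comp1idr HS)
  | rw (lw2_one HS) | rw (rw2_one HS)
  | rwb (lw2_comp0 HS) | rwb (rw2_comp0 HS) | rwb (lw2_rw2 HS) | rw (comp0A HS)
  | rw (comp0idl HS) | rw (comp0idr HS) ];
  rewrite ?mulgA.

(** * Morphisms, their tensor product and the associator *)

Definition mor A B m := [/\ wf_obj A, wf_obj B, oF A = oF B, og A = og B &
  T3 (oF A) (r (og A)) (os A) (os B) m].
(* The tensor product of [m : A -> A'] and [n : B -> B'] depends on [A] and [B]
   only through components which they share with [A'] and [B']. *)
Definition tensm A B m n :=
  m #R oF B #I r (og A) #L n #I id3 (p (og A) (og B)).
(** The triple tensor product without its [phi] factors. Both bracketings begin with it ([os_tensr],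
    [os_tensl]), so the associator is [Phi] whiskered by it. *)
Definition legs3 A B C := os A #r (oF B #o oF C) #1 r (og A) #l os B #r oF C
  #1 (r (og A) #o r (og B)) #l os C.
Definition assoc A B C := id3 (legs3 A B C) #I Phi X (og A) (og B) (og C).
Definition assocV A B C := id3 (legs3 A B C) #I PhiV X (og A) (og B) (og C).

Lemma os_tensr A B C : wf_obj A -> wf_obj B -> wf_obj C ->
  os (tens A (tens B C)) =
  legs3 A B C #1 (r (og A) #l p (og B) (og C) #1 p (og A) (og B * og C)).
Proof.
case: A B C => [FA a s] [FB b t] [FC c u] [/= aH Ts] [/= bH Tt] [/= cH Tu].
have [? ?] := T2_T1 HS Ts; have [? ?] := T2_T1 HS Tt; have [? ?] := T2_T1 HS Tu.
rewrite /legs3 /=. nf2. by [].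
Qed.

Lemma os_tensl A B C : wf_obj A -> wf_obj B -> wf_obj C ->
  os (tens (tens A B) C) =
  legs3 A B C #1 (p (og A) (og B) #r r (og C) #1 p (og A * og B) (og C)).
Proof.
case: A B C => [FA a s] [FB b t] [FC c u] [/= aH Ts] [/= bH Tt] [/= cH Tu].
have [? ?] := T2_T1 HS Ts; have [? ?] := T2_T1 HS Tt; have [? ?] := T2_T1 HS Tu.
rewrite /legs3 /=. nf2. rw interchange2_at. by [].
Qed.

Lemma oF_tensA A B C : wf_obj A -> wf_obj B -> wf_obj C ->
  oF (tens A (tens B C)) = oF (tens (tens A B) C).
Proof.
case: A B C => [FA a s] [FB b t] [FC c u] [/= aH Ts] [/= bH Tt] [/= cH Tu].
have [? ?] := T2_T1 HS Ts; have [? ?] := T2_T1 HS Tt; have [? ?] := T2_T1 HS Tu.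
by rewrite (comp0A HS).
Qed.

Lemma T2_legs3 A B C : wf_obj A -> wf_obj B -> wf_obj C ->
  T2 (oF A #o oF B #o oF C) (r (og A) #o r (og B) #o r (og C)) (legs3 A B C).
Proof.
case: A B C => [FA a s] [FB b t] [FC c u] [/= aH Ts] [/= bH Tt] [/= cH Tu].
have [? ?] := T2_T1 HS Ts; have [? ?] := T2_T1 HS Tt; have [? ?] := T2_T1 HS Tu.
rewrite /legs3 /=. t2.
Qed.

Lemma mor_assoc A B C : wf_obj A -> wf_obj B -> wf_obj C ->
  mor (tens A (tens B C)) (tens (tens A B) C) (assoc A B C).
Proof.
move=> oA oB oC; split;
  do ?[exact: oF_tensA | exact: mulgA | by rewrite oF_tensA | by rewrite /= mulgA
      | by do ?apply: wf_tens].
rewrite [X in T3 _ _ X _ _]os_tensr // [X in T3 _ _ _ X _]os_tensl //.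
rewrite ?(oF_tensA oA oB oC) /= ?mulgA.
have TX := T2_legs3 oA oB oC.
case: oA oB oC => aH _ [bH _] [cH _].
rewrite /assoc. t3.
Qed.

Lemma mor_assocV A B C : wf_obj A -> wf_obj B -> wf_obj C ->
  mor (tens (tens A B) C) (tens A (tens B C)) (assocV A B C).
Proof.
move=> oA oB oC; split;
  do ?[exact: oF_tensA | exact: mulgA | by rewrite oF_tensA | by rewrite /= mulgA
      | by do ?apply: wf_tens].
rewrite [X in T3 _ _ X _ _]os_tensl // [X in T3 _ _ _ X _]os_tensr //.
rewrite ?(oF_tensA oA oB oC) /= ?mulgA.
have TX := T2_legs3 oA oB oC.
case: oA oB oC => aH _ [bH _] [cH _].
rewrite /assocV. t3.
Qed.

Lemma assoc_assocV A B C : wf_obj A -> wf_obj B -> wf_obj C ->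
  assoc A B C #2 assocV A B C = id3 (os (tens A (tens B C))).
Proof.
move=> oA oB oC; rewrite os_tensr //.
have TX := T2_legs3 oA oB oC.
case: oA oB oC => aH _ [bH _] [cH _].
have [a b ab _] := Phi_iso HX aH bH cH.
rewrite /assoc /assocV. rwb (hcomp1_comp2 HS). rewrite ab. rw (comp2idl HS).
rw (hcomp1_id3 HS). by [].
Qed.

Lemma assocV_assoc A B C : wf_obj A -> wf_obj B -> wf_obj C ->
  assocV A B C #2 assoc A B C = id3 (os (tens (tens A B) C)).
Proof.
move=> oA oB oC; rewrite os_tensl //.
have TX := T2_legs3 oA oB oC.
case: oA oB oC => aH _ [bH _] [cH _].
have [a b _ ba] := Phi_iso HX aH bH cH.
rewrite /assoc /assocV. rwb (hcomp1_comp2 HS). rewrite ba. rw (comp2idl HS).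
rw (hcomp1_id3 HS). by [].
Qed.

Ltac obs := repeat match goal with
  | h : mor ?A ?B _ |- _ => let a := fresh "ok" in let b := fresh "ok" in
     let e := fresh "eF" in let e' := fresh "eg" in let T := fresh "Tm" in
     case: h => a b e e' T end;
  repeat match goal with A : obj |- _ =>
     let F := fresh "F" in let g := fresh "g" in let s := fresh "s" in
     destruct A as [F g s] end; simpl in *; subst;
  repeat match goal with
  | h : wf_obj _ |- _ => let a := fresh "gH" in let b := fresh "Ts" in
       case: h => /= a b end;
  repeat match goal with
  | h : T2 _ _ _ |- _ => have [] := T2_T1 HS h;
       let a := fresh in let b := fresh in move=> a b; revert h end;
  intros.

Lemma mor_ten A A' m B B' n : mor A A' m -> mor B B' n ->
  mor (tens A B) (tens A' B') (tensm A B m n).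
Proof.
move=> hm hn. obs.
split; try reflexivity; try (split; rewrite /=; [inH | t2]). rewrite /tensm /=. t3.
Qed.

Lemma mor_id A : wf_obj A -> mor A A (id3 (os A)).
Proof. move=> ok; split=> //. by case: ok => gH /(T3_id3 HS). Qed.

Lemma mor_cmp A B C m n : mor A B m -> mor B C n -> mor A C (m #2 n).
Proof.
move=> [? ? eF eg Tm] [? ? eF' eg' Tn]; split=> //; try congruence.
rewrite -eF -eg in Tn; exact: T3_comp2 HS _ _ _ _ _ _ _ Tm Tn.
Qed.

Lemma tensm_id A B : wf_obj A -> wf_obj B ->
  tensm A B (id3 (os A)) (id3 (os B)) = id3 (os (tens A B)).
Proof. move=> *; obs. rewrite /tensm /=. nf3. by []. Qed.

Lemma tensm_cmp A A' A'' m m' B B' B'' n n' :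
  mor A A' m -> mor A' A'' m' -> mor B B' n -> mor B' B'' n' ->
  tensm A B (m #2 m') (n #2 n') = tensm A B m n #2 tensm A' B' m' n'.
Proof.
move=> *. obs. rewrite /tensm /=.
rw (rw3_comp2 HS). rw (lw3_comp2 HS). rwb (hcomp1_comp2 HS).
rwb (hcomp1_comp2 HS). rw (comp2idl HS). by [].
Qed.

Lemma tensm_pull F u A A' m G v B B' n : T2 F (oF A) u -> T2 G (oF B) v ->
  mor A A' m -> mor B B' n ->
  tensm (pull F u A) (pull G v B) (id3 u #I m) (id3 v #I n) =
  id3 (u #r G #1 oF A #l v) #I tensm A B m n.
Proof.
move=> *; obs. rewrite /tensm /=. nf3. rw interchange3_atl. by [].
Qed.

(** The tensor product of the three morphisms is [q], acting on the legs, next to an identity on the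
    [phi] factors; the associator is [Phi] next to an identity on the legs. The two commute by the
    interchange of #_1 and #_2. *)
Lemma assoc_nat A A' m B B' n C C' k : mor A A' m -> mor B B' n -> mor C C' k ->
  tensm A (tens B C) m (tensm B C n k) #2 assoc A' B' C' =
  assoc A B C #2 tensm (tens A B) C (tensm A B m n) k.
Proof.
move: A A' B B' C C' => [FA a sA] [FA' a' sA'] [FB b sB] [FB' b' sB'] [FC c sC] [FC' c' sC'].
move=> [oA oA' /= eA ea ?] [oB oB' /= eB eb ?] [oC oC' /= eC ec ?].
subst FA' a' FB' b' FC' c'; obs.
set q := m #R (FB #o FC) #I r a #L n #R FC #I (r a #o r b) #L k.
match goal with |- context [assoc ?A ?B ?C #2 _] => set XX := legs3 A B C end.
match goal with |- context [_ #2 assoc ?A ?B ?C] => set YY := legs3 A B C end.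
have Tq : T3 (FA #o FB #o FC) (r a #o r b #o r c) XX YY q.
  by rewrite /q /XX /YY /legs3 /=; t3.
have [TX TY] := T3_T2 HS Tq.
rewrite /assoc /= -/XX -/YY.
have -> : tensm (Obj FA a sA) (tens (Obj FB b sB) (Obj FC c sC)) m
    (tensm (Obj FB b sB) (Obj FC c sC) n k) =
    q #I id3 (r a #l p b c #1 p a (b * c)).
  rewrite /tensm /q /=; nf3. by [].
have -> : tensm (tens (Obj FA a sA) (Obj FB b sB)) (Obj FC c sC)
    (tensm (Obj FA a sA) (Obj FB b sB) m n) k =
    q #I id3 (p a b #r r c #1 p (a * b) c).
  rewrite /tensm /q /=; nf3. rw interchange3_atr. by [].
rwb (hcomp1_comp2 HS). rw (comp2idr HS). rw (comp2idl HS).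
rwb (hcomp1_comp2 HS). rw (comp2idr HS). rw (comp2idl HS).
by [].
Qed.

Lemma assoc_pull F u A G v B I w C : wf_obj A -> wf_obj B -> wf_obj C ->
  T2 F (oF A) u -> T2 G (oF B) v -> T2 I (oF C) w ->
  assoc (pull F u A) (pull G v B) (pull I w C) =
  id3 (u #r (G #o I) #1 oF A #l v #r I #1 (oF A #o oF B) #l w) #I assoc A B C.
Proof.
move: A B C => [FA a sA] [FB b sB] [FC c sC].
move=> *; obs. rewrite /assoc /pull /legs3 /=. nf3.
rw interchange3_ati. nf3.
(* The whiskerings are regrouped so that [v #r I], and then [w], appears as a single 2-arrow to be
   interchanged. *)
rw (lw2_rw2 HS (H := r a) (s := v)). rw (interchange3_ati (t := v #r I)). nf3.
rw (rw2_comp0 HS (s := sA) (H := FB)). rw (interchange3_ati (t := w)). nf3. by [].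
Qed.

(** Once the common prefix [X4] of the fourfold tensor products is split off, the five factors are
    the five terms of the 3-cocycle condition. *)
Lemma pentagon A B C D : wf_obj A -> wf_obj B -> wf_obj C -> wf_obj D ->
  tensm A (tens B (tens C D)) (id3 (os A)) (assoc B C D) #2 assoc A (tens B C) D
    #2 tensm (tens A (tens B C)) D (assoc A B C) (id3 (os D)) =
  assoc A B (tens C D) #2 assoc (tens A B) C D.
Proof.
move: A B C D => [FA a sA] [FB b sB] [FC c sC] [FD d sD].
move=> *; obs.
pose X4 := sA #r (FB #o FC #o FD) #1 r a #l sB #r (FC #o FD)
  #1 (r a #o r b) #l sC #r FD #1 (r a #o r b #o r c) #l sD.
have TX : T2 (FA #o FB #o FC #o FD) (r a #o r b #o r c #o r d) X4 by rewrite /X4; t2.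
have E1 : tensm (Obj FA a sA) (tens (Obj FB b sB) (tens (Obj FC c sC) (Obj FD d sD)))
    (id3 sA) (assoc (Obj FB b sB) (Obj FC c sC) (Obj FD d sD)) =
   id3 X4 #I (r a #L Phi X b c d #I id3 (p a (b * c * d))).
  rewrite /tensm /assoc /legs3 /X4 /=. nf3. by [].
have E2 : assoc (Obj FA a sA) (tens (Obj FB b sB) (Obj FC c sC)) (Obj FD d sD) =
   id3 X4 #I (id3 (r a #l p b c #r r d) #I Phi X a (b * c) d).
  rewrite /tensm /assoc /legs3 /X4 /=. nf3. rw interchange3_ati. by [].
have E3 : tensm (tens (Obj FA a sA) (tens (Obj FB b sB) (Obj FC c sC))) (Obj FD d sD)
    (assoc (Obj FA a sA) (Obj FB b sB) (Obj FC c sC)) (id3 sD) =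
   id3 X4 #I (Phi X a b c #R r d #I id3 (p (a * b * c) d)).
  rewrite /tensm /assoc /legs3 /X4 /=. nf3. rw interchange3_atl. by [].
have E4 : assoc (Obj FA a sA) (Obj FB b sB) (tens (Obj FC c sC) (Obj FD d sD)) =
   id3 X4 #I (id3 ((r a #o r b) #l p c d) #I Phi X a b (c * d)).
  rewrite /tensm /assoc /legs3 /X4 /=. nf3. by [].
have E5 : assoc (tens (Obj FA a sA) (Obj FB b sB)) (Obj FC c sC) (Obj FD d sD) =
   id3 X4 #I (id3 (p a b #r (r c #o r d)) #I Phi X (a * b) c d).
  rewrite /tensm /assoc /legs3 /X4 /=. nf3.
  rw (lw2_rw2 HS (H := r (a * b))). rw interchange3_ati. nf3.
  rw (rw2_comp0 HS (s := p a b) (H := r c)). rw interchange3_ati. nf3. by [].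
rewrite /= in E1 E2 E3 E4 E5 *.
rewrite E1 E2 E3 E4 E5.
do 2 (rwb (hcomp1_comp2 HS (m := id3 X4)); rw (comp2idl HS)).
(* The two associators on the right meet only up to the interchange of [p a b] and [p c d], which
   normalization does not find. *)
rwb (hcomp1_comp2 HS (m := id3 X4)); last by rw (interchange2 HS).
rw (comp2idl HS).
by rewrite (Phi_cocycle HX).
Qed.

(** * Composition and isomorphisms of objects *)

Lemma morT A B m : mor A B m -> T3 (oF A) (r (og A)) (os A) (os B) m.
Proof. by case. Qed.

Lemma mor_okl A B m : mor A B m -> wf_obj A. Proof. by case. Qed.
Lemma mor_okr A B m : mor A B m -> wf_obj B. Proof. by case. Qed.

Lemma mcmpA A B C D m n k : mor A B m -> mor B C n -> mor C D k ->
  m #2 (n #2 k) = m #2 n #2 k.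
Proof.
move=> [? ? eF eg Tm] [? ? eF' eg' Tn] [_ _ _ _ Tk].
rewrite -eF' -eg' -eF -eg in Tk; rewrite -eF -eg in Tn.
exact: comp2A HS _ _ _ _ _ _ _ _ _ Tm Tn Tk.
Qed.

Lemma mcmp_idl A B m : mor A B m -> id3 (os A) #2 m = m.
Proof. by move/morT=> Tm; apply: comp2idl Tm. Qed.

Lemma mcmp_idr A B m : mor A B m -> m #2 id3 (os B) = m.
Proof. by move/morT=> Tm; apply: comp2idr Tm. Qed.

Definition miso A B m := mor A B m /\
  exists n, [/\ mor B A n, m #2 n = id3 (os A) & n #2 m = id3 (os B)].

Lemma miso_id A : wf_obj A -> miso A A (id3 (os A)).
Proof.
by move=> ok; have h := mor_id ok; split=> //; exists (id3 (os A)); split; rewrite ?(mcmp_idl h).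
Qed.

Lemma miso_cmp A B C m n : miso A B m -> miso B C n -> miso A C (m #2 n).
Proof.
move=> [hm [m' [hm' e e']]] [hn [n' [hn' f f']]]; split; first exact: mor_cmp hm hn.
exists (n' #2 m'); split; first exact: mor_cmp hn' hm'.
  by rewrite (mcmpA (mor_cmp hm hn) hn' hm') -(mcmpA hm hn hn') f (mcmp_idr hm).
by rewrite (mcmpA (mor_cmp hn' hm') hm hn) -(mcmpA hn' hm' hm) e' (mcmp_idr hn').
Qed.

Lemma miso_ten A A' B B' m n : miso A A' m -> miso B B' n ->
  miso (tens A B) (tens A' B') (tensm A B m n).
Proof.
move=> [hm [m' [hm' e e']]] [hn [n' [hn' f f']]]; split; first exact: mor_ten.
exists (tensm A' B' m' n'); split; first exact: mor_ten.
  by rewrite -(tensm_cmp hm hm' hn hn') e f tensm_id //; [case: hm|case: hn].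
by rewrite -(tensm_cmp hm' hm hn' hn) e' f' tensm_id //; [case: hm'|case: hn'].
Qed.

Lemma miso_assoc A B C : wf_obj A -> wf_obj B -> wf_obj C ->
  miso (tens A (tens B C)) (tens (tens A B) C) (assoc A B C).
Proof.
move=> oA oB oC; split; first exact: mor_assoc.
by exists (assocV A B C); split; [exact: mor_assocV|exact: assoc_assocV|exact: assocV_assoc].
Qed.

Lemma miso_sym A B m n : mor A B m -> mor B A n -> m #2 n = id3 (os A) ->
  n #2 m = id3 (os B) -> miso B A n.
Proof. by move=> hm hn e e'; split=> //; exists m. Qed.

Lemma miso_assocV A B C : wf_obj A -> wf_obj B -> wf_obj C ->
  miso (tens (tens A B) C) (tens A (tens B C)) (assocV A B C).
Proof.
move=> oA oB oC; apply: (@miso_sym _ _ (assoc A B C));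
  [exact: mor_assoc|exact: mor_assocV|exact: assoc_assocV|exact: assocV_assoc].
Qed.

Lemma miso_cancelr A B C m m' n : mor A B m -> mor A B m' -> miso B C n ->
  m #2 n = m' #2 n -> m = m'.
Proof.
move=> hm hm' [hn [n' [hn' e _]]] E.
by rewrite -(mcmp_idr hm) -(mcmp_idr hm') -e (mcmpA hm hn hn') E (mcmpA hm' hn hn').
Qed.

(* Mac Lane's coherence: [nu A t] brackets [A (x) t] to the left, and every
   [move] composed with it gives [nu] again ([mv_nu]). *)
Inductive tree := Lf of obj | Nd of tree & tree.

Fixpoint tval t := match t with Lf A => A | Nd s t => tens (tval s) (tval t) end.
Fixpoint wf_tree t := match t with Lf A => wf_obj A | Nd s t => wf_tree s /\ wf_tree t end.

Lemma wf_tval t : wf_tree t -> wf_obj (tval t).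
Proof. by elim: t => //= s IHs t IHt [/IHs ? /IHt ?]; apply: wf_tens. Qed.

Fixpoint graft A t :=
  match t with Lf B => Nd A (Lf B) | Nd s t => graft (graft A s) t end.

Fixpoint nu A t : C3 S :=
  match t with
  | Lf B => id3 (os (tens (tval A) B))
  | Nd s t => assoc (tval A) (tval s) (tval t)
      #2 (tensm (tens (tval A) (tval s)) (tval t) (nu A s) (id3 (os (tval t)))
      #2 nu (graft A s) t)
  end.

Lemma wf_graft A t : wf_tree A -> wf_tree t -> wf_tree (graft A t).
Proof. by elim: t A => //= s IHs t IHt A oA [os ot]; apply: (IHt) => //; apply: IHs. Qed.

Lemma miso_nu A t : wf_tree A -> wf_tree t ->
  miso (tens (tval A) (tval t)) (tval (graft A t)) (nu A t).
Proof.
elim: t A => [B|s IHs t IHt] A oA /=.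
  move=> oB; apply: (miso_id (A := tens (tval A) B)); apply: wf_tens => //.
  exact: wf_tval.
case=> oks okt; have ? := wf_tval oA; have ? := wf_tval oks; have ? := wf_tval okt.
apply: miso_cmp; first exact: miso_assoc.
apply: (miso_cmp (B := tens (tval (graft A s)) (tval t))).
  by apply: miso_ten; [exact: IHs | exact: miso_id].
by apply: IHt => //; apply: wf_graft.
Qed.

(** Moves are indexed by trees and not by their values: different trees may have the same value, and
    coherence concerns only composites formed along the trees. *)
Inductive move : tree -> tree -> C3 S -> Prop :=
| mv_id t : wf_tree t -> move t t (id3 (os (tval t)))
| mv_cmp s t u m n : move s t m -> move t u n -> move s u (m #2 n)
| mv_assoc s t u : wf_tree s -> wf_tree t -> wf_tree u ->
    move (Nd s (Nd t u)) (Nd (Nd s t) u) (assoc (tval s) (tval t) (tval u))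
| mv_assocV s t u : wf_tree s -> wf_tree t -> wf_tree u ->
    move (Nd (Nd s t) u) (Nd s (Nd t u)) (assocV (tval s) (tval t) (tval u))
| mv_ten s s' t t' m n : move s s' m -> move t t' n ->
    move (Nd s t) (Nd s' t') (tensm (tval s) (tval t) m n).

Lemma mv_hom s t m : move s t m ->
  [/\ wf_tree s, wf_tree t & miso (tval s) (tval t) m].
Proof.
elim=> {s t m} [t okt|s t u m n _ [? _ hm] _ [_ ? hn]|s t u ? ? ?|s t u ? ? ?
  |s s' t t' m n _ [? ? ?] _ [? ? ?]] //=; split=> //.
- exact/miso_id/wf_tval.
- exact: miso_cmp hm hn.
- by apply: miso_assoc; apply: wf_tval.
- by apply: miso_assocV; apply: wf_tval.
- exact: miso_ten.
Qed.

(** [graft] depends on [t] only through its sequence of leaves, which no move changes. *)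
Lemma mv_graft s t m A : move s t m -> graft A s = graft A t.
Proof.
move=> h; elim: h A => {s t m} //= [s t u m n _ IH _ IH' A|s s' t t' m n _ IH _ IH' A].
  by rewrite IH.
by rewrite IH IH'.
Qed.

Lemma mv_nu s t m A : wf_tree A -> move s t m ->
  tensm (tval A) (tval s) (id3 (os (tval A))) m #2 nu A t = nu A s.
Proof.
(* The case of an associator, which is the only one to use the pentagon; naturality of [assoc] then
   moves [nu B s'] past it. *)
have nu_al B s' t' u : wf_tree B -> wf_tree s' -> wf_tree t' -> wf_tree u ->
  tensm (tval B) (tens (tval s') (tens (tval t') (tval u))) (id3 (os (tval B)))
    (assoc (tval s') (tval t') (tval u)) #2 nu B (Nd (Nd s' t') u) =
  nu B (Nd s' (Nd t' u)).
  move=> oB oks okt oku.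
  have ob := wf_tval oB; have os' := wf_tval oks; have ot := wf_tval okt.
  have ou := wf_tval oku.
  have hB := mor_id ob; have hs := mor_id os'; have ht := mor_id ot.
  have hu := mor_id ou.
  have [hns _] := miso_nu oB oks.
  have obs := wf_graft oB oks.
  have [hnt _] := miso_nu obs okt.
  have obst := wf_graft obs okt.
  have [hnu _] := miso_nu obst oku.
  have okbs := wf_tens ob os'. have okst := wf_tens os' ot.
  have oktu := wf_tens ot ou.
  rewrite /=.
  have h1 := mor_ten hB (mor_assoc os' ot ou).
  have h2 := mor_assoc ob okst ou.
  have h3 := mor_ten (mor_assoc ob os' ot) hu.
  have h4 := mor_ten (mor_ten hns ht) hu.
  have h5 := mor_ten hnt hu.
  have h345 := mor_cmp h3 (mor_cmp h4 h5).
  have h6 := mor_assoc ob os' oktu.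
  have h7 := mor_assoc okbs ot ou.
  have h8 := mor_ten hns (mor_id oktu).
  have ov := wf_tval obs.
  have h9 := mor_assoc ov ot ou.
  have -> : tensm (tens (tval B) (tens (tval s') (tval t'))) (tval u)
     (assoc (tval B) (tval s') (tval t') #2
      (tensm (tens (tval B) (tval s')) (tval t') (nu B s') (id3 (os (tval t'))) #2
       nu (graft B s') t')) (id3 (os (tval u))) =
     tensm (tens (tval B) (tens (tval s') (tval t'))) (tval u)
        (assoc (tval B) (tval s') (tval t')) (id3 (os (tval u)))
     #2 (tensm (tens (tens (tval B) (tval s')) (tval t')) (tval u)
       (tensm (tens (tval B) (tval s')) (tval t') (nu B s') (id3 (os (tval t'))))
       (id3 (os (tval u)))
     #2 tensm (tens (tval (graft B s')) (tval t')) (tval u) (nu (graft B s') t')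
        (id3 (os (tval u)))).
    have a1 := mor_assoc ob os' ot. have a2 := mor_ten hns ht.
    rewrite -(tensm_cmp a2 hnt hu hu) (mcmp_idl hu).
    by rewrite -(tensm_cmp a1 (mor_cmp a2 hnt) hu hu) (mcmp_idl hu).
  rewrite -(mcmpA h3 (mor_cmp h4 h5) hnu) (mcmpA h2 h3 (mor_cmp (mor_cmp h4 h5) hnu)).
  rewrite (mcmpA h1 (mor_cmp h2 h3) (mor_cmp (mor_cmp h4 h5) hnu)).
  rewrite (mcmpA h1 h2 h3) pentagon //.
  rewrite -(mcmpA h4 h5 hnu) -(mcmpA h6 h7 (mor_cmp h4 (mor_cmp h5 hnu))).
  rewrite (mcmpA h7 h4 (mor_cmp h5 hnu)).
  rewrite -(assoc_nat hns ht hu) tensm_id //.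
  by rewrite -(mcmpA h8 h9 (mor_cmp h5 hnu)).
move=> oA h; elim: h A oA => {s t m}
  [t okt|s t u m n hm IHm hn IHn|s t u oks okt oku|s t u oks okt oku
  |s s' t t' m n hm IHm hn IHn] A oA.
- rewrite tensm_id; try exact: wf_tval.
  by case: (miso_nu oA okt) => /mcmp_idl.
- have [_ _ [hm' _]] := mv_hom hm; have [_ oku [hn' _]] := mv_hom hn.
  have hA := mor_id (wf_tval oA).
  rewrite -{1}(mcmp_idl hA) (tensm_cmp hA hA hm' hn').
  have [hu _] := miso_nu oA oku.
  rewrite -(mcmpA (mor_ten hA hm') (mor_ten hA hn') hu).
  by rewrite IHn // IHm.
- exact: nu_al.
(* The inverse associator reduces to [nu_al], whose associator it cancels. *)
- rewrite -(nu_al A s t u) //.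
  have hA := mor_id (wf_tval oA).
  have ? := wf_tval oks; have ? := wf_tval okt; have ? := wf_tval oku.
  have a := mor_assoc (wf_tval oks) (wf_tval okt) (wf_tval oku).
  have aV := mor_assocV (wf_tval oks) (wf_tval okt) (wf_tval oku).
  have [hn _] := miso_nu oA (conj (conj oks okt) oku : wf_tree (Nd (Nd s t) u)).
  rewrite (mcmpA (mor_ten hA aV) (mor_ten hA a) hn) -(tensm_cmp hA hA aV a).
  rewrite assocV_assoc // (mcmp_idl hA) tensm_id; first exact: mcmp_idl hn.
    exact: wf_tval.
  by do ?apply: wf_tens.
- have [oks oks' [hm' _]] := mv_hom hm; have [okt okt' [hn' _]] := mv_hom hn.
  have oA' := wf_tval oA; have hA := mor_id oA'.
  have ? := wf_tval oks; have ? := wf_tval okt; have ? := wf_tval oks'.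
  have ? := wf_tval okt'.
  have [hs _] := miso_nu oA oks; have [hs' _] := miso_nu oA oks'.
  have [ht _] := miso_nu (wf_graft oA oks) okt.
  have [ht' _] := miso_nu (wf_graft oA oks) okt'.
  have it := mor_id (wf_tval okt); have it' := mor_id (wf_tval okt').
  have ig := mor_id (wf_tval (wf_graft oA oks)).
  have h1 := mor_ten hA (mor_ten hm' hn').
  have h2 : mor (tens (tval A) (tens (tval s') (tval t')))
    (tens (tens (tval A) (tval s')) (tval t')) (assoc (tval A) (tval s') (tval t')).
    exact: mor_assoc.
  have h3 : mor (tens (tval A) (tens (tval s) (tval t)))
    (tens (tens (tval A) (tval s)) (tval t)) (assoc (tval A) (tval s) (tval t)).
    exact: mor_assoc.
  have e := mv_graft A hm.
  rewrite /= -e in hs' *.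
  have h4 := mor_ten hs' it'. have h5 := mor_ten hs it.
  have h6 := mor_ten (mor_ten hA hm') hn'.
  have h7 := mor_ten ig hn'.
  rewrite (mcmpA h1 h2 (mor_cmp h4 ht')) (assoc_nat hA hm' hn').
  rewrite -(mcmpA h3 h6 (mor_cmp h4 ht')) (mcmpA h6 h4 ht').
  rewrite -(tensm_cmp (mor_ten hA hm') hs' hn' it') IHm // (mcmp_idr hn').
  rewrite -{1}(mcmp_idr hs) -{1}(mcmp_idl hn') (tensm_cmp hs ig it hn').
  by rewrite -(mcmpA h5 h7 ht') IHn //; apply: wf_graft.
Qed.

(** * Unit objects and the coherence theorem *)

Definition unit_obj g := Obj (r g) g (id2 (r g)).

Lemma wf_unit g : g \in H -> wf_obj (unit_obj g).
Proof. by move=> gH; split=> //=; apply: (T2_id2 HS); apply: T1_rho. Qed.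

Lemma tensm_unit A B m : mor A B m ->
  tensm (unit_obj 1) A (id3 (os (unit_obj 1))) m = m.
Proof.
move=> [[gH _] _ _ _ Tm]; have [Ts _] := T3_T2 HS Tm; have [? ?] := T2_T1 HS Ts.
rewrite /tensm /= (rho_1 HX) (phi_1l HX) //. nf3. by [].
Qed.

(** With the unit object as [A], [mv_nu] shows that [m] and [m'] agree after composition with the
    invertible [nu]. Tensoring a morphism with this object on the left is strictly trivial, by
    normalization of [rho] and [phi]. *)
Lemma coherence s t m m' : move s t m -> move s t m' -> m = m'.
Proof.
move=> h h'; have [oks okt [hm _]] := mv_hom h; have [_ _ [hm' _]] := mv_hom h'.
have o1 : wf_tree (Lf (unit_obj 1)) by apply: wf_unit; exact: group1.
have i1 := mor_id (o1 : wf_obj (unit_obj 1)).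
have := mv_nu o1 h; rewrite -(mv_nu o1 h') /=.
move/(miso_cancelr (mor_ten i1 hm) (mor_ten i1 hm') (miso_nu o1 okt)).
by rewrite (tensm_unit hm) (tensm_unit hm').
Qed.

Lemma assocV_pull F u A G v B I w C : wf_obj A -> wf_obj B -> wf_obj C ->
  T2 F (oF A) u -> T2 G (oF B) v -> T2 I (oF C) w ->
  assocV (pull F u A) (pull G v B) (pull I w C) =
  id3 (u #r (G #o I) #1 oF A #l v #r I #1 (oF A #o oF B) #l w) #I assocV A B C.
Proof.
move: A B C => [FA a sA] [FB b sB] [FC c sC].
move=> *; obs. rewrite /assocV /pull /legs3 /=. nf3.
rw interchange3_ati. nf3.
rw (lw2_rw2 HS (H := r a) (s := v)). rw (interchange3_ati (t := v #r I)). nf3.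
rw (rw2_comp0 HS (s := sA) (H := FB)). rw (interchange3_ati (t := w)). nf3. by [].
Qed.

(* On unit objects this is [Lam] ([lam_unit]). *)
Definition lam A B E B' A' :=
  tensm (tens A (tens (tens B E) B')) A' (assoc A (tens B E) B') (id3 (os A'))
  #2 tensm (tens (tens A (tens B E)) B') A'
       (tensm (tens A (tens B E)) B' (assoc A B E) (id3 (os B'))) (id3 (os A'))
  #2 assocV (tens (tens A B) E) B' A'.

Lemma mor_lam A B E B' A' : wf_obj A -> wf_obj B -> wf_obj E -> wf_obj B' -> wf_obj A' ->
  mor (tens (tens A (tens (tens B E) B')) A')
      (tens (tens (tens A B) E) (tens B' A')) (lam A B E B' A').
Proof.
move=> oA oB oE oB' oA'.
have oBE := wf_tens oB oE. have oAB := wf_tens oA oB.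
have oABE := wf_tens oAB oE.
apply: mor_cmp (mor_assocV oABE oB' oA').
apply: mor_cmp; apply: mor_ten (mor_id oA'); first exact: mor_assoc.
by apply: mor_ten (mor_id oB'); apply: mor_assoc.
Qed.

Lemma mv_lam a b e b' a' : wf_tree a -> wf_tree b -> wf_tree e -> wf_tree b' -> wf_tree a' ->
  move (Nd (Nd a (Nd (Nd b e) b')) a') (Nd (Nd (Nd a b) e) (Nd b' a'))
    (lam (tval a) (tval b) (tval e) (tval b') (tval a')).
Proof.
move=> *.
apply: (mv_cmp (t := Nd (Nd (Nd (Nd a b) e) b') a')); last first.
  exact: (mv_assocV (s := Nd (Nd a b) e)).
apply: (mv_cmp (t := Nd (Nd (Nd a (Nd b e)) b') a')).
  by apply: (mv_ten (s := Nd a (Nd (Nd b e) b')) (t := a'));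
    [apply: (mv_assoc (t := Nd b e))|apply: mv_id].
apply: (mv_ten (s := Nd (Nd a (Nd b e)) b') (t := a')); last exact: mv_id.
apply: (mv_ten (s := Nd a (Nd b e)) (t := b')); last exact: mv_id.
exact: (mv_assoc (s := a) (t := b)).
Qed.

Lemma lam_unit h g e : h \in H -> g \in H -> e \in H ->
  lam (unit_obj h) (unit_obj g) (unit_obj e) (unit_obj g^-1) (unit_obj h^-1) =
  Lam X e h g.
Proof.
move=> hH gH eH.
rewrite /lam /Lam /tensm /assoc /assocV /legs3 /=. congr (_ #2 _ #2 _); nf3; by [].
Qed.

Lemma pull_unit g : g \in H -> pull (r g) (id2 (r g)) (unit_obj g) = unit_obj g.
Proof. by move=> gH; rewrite /pull /=; rw (comp1idl HS). Qed.

Definition prefix5 A B E B' FB FE FB' FA' uA uB uE uB' uA' :=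
  uA #r (FB #o FE #o FB' #o FA')
  #1 oF A #l uB #r (FE #o FB' #o FA')
  #1 (oF A #o oF B) #l uE #r (FB' #o FA')
  #1 (oF A #o oF B #o oF E) #l uB' #r FA'
  #1 (oF A #o oF B #o oF E #o oF B') #l uA'.

Lemma pre_cmp F u A B C m n : T2 F (oF A) u -> mor A B m -> mor B C n ->
  (id3 u #I m) #2 (id3 u #I n) = id3 u #I (m #2 n).
Proof.
move=> Tu [_ _ eF eg Tm] [_ _ _ _ Tn]; rewrite -eF -eg in Tn; rwb (hcomp1_comp2 HS).
by rw (comp2idl HS).
Qed.

(** Each of the three associators in [lam] commutes with precomposition; the point is that the three
    resulting prefixes are the same 2-arrow [P]. *)
Lemma lam_pull A B E B' A' FA FB FE FB' FA' uA uB uE uB' uA' :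
  wf_obj A -> wf_obj B -> wf_obj E -> wf_obj B' -> wf_obj A' ->
  T2 FA (oF A) uA -> T2 FB (oF B) uB -> T2 FE (oF E) uE ->
  T2 FB' (oF B') uB' -> T2 FA' (oF A') uA' ->
  lam (pull FA uA A) (pull FB uB B) (pull FE uE E) (pull FB' uB' B')
    (pull FA' uA' A') =
  id3 (prefix5 A B E B' FB FE FB' FA' uA uB uE uB' uA') #I lam A B E B' A'.
Proof.
move=> oA oB oE oB' oA' TA TB TE TB' TA'.
have oBE := wf_tens oB oE; have oAB := wf_tens oA oB.
have oABE := wf_tens oAB oE; have oABEr := wf_tens oA oBE.
have oBEB := wf_tens oBE oB'.
have ? := T2_T1 HS TA; have ? := T2_T1 HS TB; have ? := T2_T1 HS TE.
have ? := T2_T1 HS TB'; have ? := T2_T1 HS TA'.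
have [[? ?] [? ?] [? ?]] : [/\ T1 FA /\ T1 (oF A), T1 FB /\ T1 (oF B) & T1 FE /\ T1 (oF E)] by [].
have [[? ?] [? ?]] : (T1 FB' /\ T1 (oF B')) /\ (T1 FA' /\ T1 (oF A')) by [].
have id_pull F u C : wf_obj C -> T2 F (oF C) u -> id3 (os (pull F u C)) = id3 u #I id3 (os C).
  by move=> [? TC] Tu; rw (hcomp1_id3 HS).
have TBE : T2 (FB #o FE) (oF (tens B E)) (uB #r FE #1 oF B #l uE) by rewrite /=; t2.
have TAB : T2 (FA #o FB) (oF (tens A B)) (uA #r FB #1 oF A #l uB) by rewrite /=; t2.
pose w1 := uA #r ((FB #o FE) #o FB') #1 oF A #l (uB #r FE #1 oF B #l uE) #r FB'
  #1 (oF A #o oF (tens B E)) #l uB'.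
have T1w : T2 (FA #o (FB #o FE #o FB')) (oF (tens A (tens (tens B E) B'))) w1.
  by rewrite /w1 /=; t2.
pose w2 := uA #r (FB #o FE) #1 oF A #l uB #r FE #1 (oF A #o oF B) #l uE.
have T2w : T2 (FA #o (FB #o FE)) (oF (tens A (tens B E))) w2 by rewrite /w2 /=; t2.
pose w3 := uA #r FB #r FE #1 oF A #l uB #r FE #1 (oF A #o oF B) #l uE.
have T3w : T2 (FA #o FB #o FE) (oF (tens (tens A B) E)) w3 by rewrite /w3 /=; t2.
set P := prefix5 _ _ _ _ _ _ _ _ _ _ _ _ _.
have TP : T2 (FA #o FB #o FE #o FB' #o FA')
   (oF (tens (tens A (tens (tens B E) B')) A')) P by rewrite /P /prefix5 /=; t2.
have E1 : tensm (tens (pull FA uA A)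
     (tens (tens (pull FB uB B) (pull FE uE E)) (pull FB' uB' B')))
   (pull FA' uA' A') (assoc (pull FA uA A) (tens (pull FB uB B) (pull FE uE E)) (pull FB' uB' B'))
   (id3 (os (pull FA' uA' A'))) = id3 P #I
   tensm (tens A (tens (tens B E) B')) A' (assoc A (tens B E) B') (id3 (os A')).
  rewrite id_pull // [tens (pull FB _ _) _]tens_pull // assoc_pull //.
  (* The same term with other objects in it: [tensm] uses only their sources and degrees, and
     [tensm_pull] needs both objects in the form [pull]. *)
  transitivity (tensm (pull (FA #o (FB #o FE #o FB')) w1 (tens A (tens (tens B E) B')))
    (pull FA' uA' A') (id3 w1 #I assoc A (tens B E) B') (id3 uA' #I id3 (os A'))); first by [].
  rewrite (tensm_pull T1w TA' (mor_assoc oA oBE oB') (mor_id oA')).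
  congr (id3 _ #I _). rewrite /P /prefix5 /w1 /=. nf2. by [].
have E2 : tensm (tens (tens (pull FA uA A) (tens (pull FB uB B) (pull FE uE E)))
     (pull FB' uB' B')) (pull FA' uA' A')
       (tensm (tens (pull FA uA A) (tens (pull FB uB B) (pull FE uE E))) (pull FB' uB' B')
       (assoc (pull FA uA A) (pull FB uB B) (pull FE uE E))
       (id3 (os (pull FB' uB' B')))) (id3 (os (pull FA' uA' A')))
   = id3 P #I tensm (tens (tens A (tens B E)) B') A'
       (tensm (tens A (tens B E)) B' (assoc A B E) (id3 (os B'))) (id3 (os A')).
  rewrite !id_pull // assoc_pull //.
  transitivity (tensm (tens (pull (FA #o (FB #o FE)) w2 (tens A (tens B E))) (pull FB' uB' B'))
     (pull FA' uA' A')
     (tensm (pull (FA #o (FB #o FE)) w2 (tens A (tens B E))) (pull FB' uB' B')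
        (id3 w2 #I assoc A B E) (id3 uB' #I id3 (os B'))) (id3 uA' #I id3 (os A'))); first by [].
  rewrite tens_pull // (tensm_pull T2w TB' (mor_assoc oA oB oE) (mor_id oB')).
  rewrite (tensm_pull _ TA' (mor_ten (mor_assoc oA oB oE) (mor_id oB')) (mor_id oA'));
    last by rewrite /=; t2.
  congr (id3 _ #I _). rewrite /P /prefix5 /w2 /=. nf2. by [].
have E3 : assocV (tens (tens (pull FA uA A) (pull FB uB B)) (pull FE uE E))
     (pull FB' uB' B') (pull FA' uA' A')
   = id3 P #I assocV (tens (tens A B) E) B' A'.
  rewrite tens_pull // tens_pull // assocV_pull //; last by rewrite /=; t2.
  congr (id3 _ #I _). rewrite /P /prefix5 /=. nf2. by [].
rewrite {1}/lam E1 E2 E3.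
have h1 := mor_ten (mor_assoc oA oBE oB') (mor_id oA').
have h2 := mor_ten (mor_ten (mor_assoc oA oB oE) (mor_id oB')) (mor_id oA').
have h3 := mor_assocV oABE oB' oA'.
by rewrite (pre_cmp TP h1 h2) (pre_cmp TP (mor_cmp h1 h2) h3).
Qed.

(** * Objects of the trace and the functors [psi] *)

Definition tobj f x := Obj one1 f x.

Lemma wf_tobj f x : f \in H -> T2 one1 (r f) x -> wf_obj (tobj f x).
Proof. by []. Qed.

Lemma tobj1 : tobj 1 (id2 one1) = unit_obj 1.
Proof. by rewrite /unit_obj (rho_1 HX). Qed.

(** Makes results on precomposition, such as [lam_pull], applicable to objects of the trace. *)
Lemma tobj_pull f x : f \in H -> T2 one1 (r f) x -> tobj f x = pull one1 x (unit_obj f).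
Proof. by move=> fH Tx; rewrite /pull /=; rw (comp1idr HS). Qed.

Lemma T2_psi f g x : f \in H -> g \in H -> T2 one1 (r f) x ->
  T2 one1 (r (g * f * g^-1)) (psi2 X f g x).
Proof.
move=> fH gH Tx; rewrite /psi2.
have := @T2_phiV g g^-1 gH; rewrite groupV gH mulgV (rho_1 HX) => /(_ isT) Tv.
t2.
Qed.

(** The prefix [p g g^-1] cancels the factor [phiV] with which [psi2] begins. *)
Lemma psi_pull f g x : f \in H -> g \in H -> T2 one1 (r f) x ->
  tens (tens (unit_obj g) (tobj f x)) (unit_obj g^-1) =
  pull (r g #o r g^-1) (p g g^-1) (tobj (g * f * g^-1) (psi2 X f g x)).
Proof.
move=> fH gH Tx; have gV : g^-1 \in H by inH.
have [Tp Tv e _] := phi_iso HX gH gV; rewrite mulgV (rho_1 HX) in Tp Tv.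
rewrite /tens /pull /psi2 /=. congr Obj; first by weq.
nf2. rewrite e. nf2. by [].
Qed.

Lemma tens_unit h g : h \in H -> g \in H ->
  tens (unit_obj h) (unit_obj g) = pull (r h #o r g) (p h g) (unit_obj (h * g)).
Proof.
move=> hH gH; rewrite /tens /pull /=. congr Obj. nf2. by [].
Qed.

Lemma Lc1 h g : h \in H -> g \in H ->
  Lc X 1 h g = r h #l p g g^-1 #r r h^-1 #1 p h h^-1.
Proof.
move=> hH gH; rewrite /Lc !mulg1 mulgK mulgV !(phi_1r HX) //. nf2. by [].
Qed.

(* The source of [lam] at [tobj f x] is [psi_h (psi_g x)] up to the
   invertible prefix [Lc X 1 h g]; the target is treated in [tgt_pull]. *)
Lemma src_pull f h g x : f \in H -> h \in H -> g \in H -> T2 one1 (r f) x ->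
  tens (tens (unit_obj h) (tens (tens (unit_obj g) (tobj f x)) (unit_obj g^-1)))
    (unit_obj h^-1) =
  pull (r h #o r g #o r g^-1 #o r h^-1) (Lc X 1 h g)
    (tobj (h * (g * f * g^-1) * h^-1) (psi2 X (g * f * g^-1) h (psi2 X f g x))).
Proof.
move=> fH hH gH Tx.
have gV : g^-1 \in H by inH. have hV : h^-1 \in H by inH.
have cH : g * f * g^-1 \in H by inH.
have Ty := T2_psi fH gH Tx. have Tz := T2_psi cH hH Ty.
have Tp := T2_phi gH gV; rewrite mulgV (rho_1 HX) in Tp.
have Tq := T2_phi hH hV; rewrite mulgV (rho_1 HX) in Tq.
have oh := wf_unit hH; have ohV := wf_unit hV.
have oy := wf_tobj cH Ty.
have Thh : T2 (r h) (oF (unit_obj h)) (id2 (r h)) by apply: (T2_id2 HS); t1.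
have ThV : T2 (r h^-1) (oF (unit_obj h^-1)) (id2 (r h^-1)) by apply: (T2_id2 HS); t1.
rewrite psi_pull // -{1}(pull_unit hH) -{1}(pull_unit hV).
rewrite tens_pull // tens_pull //; [|exact: wf_tens|by rewrite /=; t2].
rewrite psi_pull // Lc1 // /pull /=. congr Obj; first by weq.
nf2. by [].
Qed.

Lemma tgt_pull f h g x : f \in H -> h \in H -> g \in H -> T2 one1 (r f) x ->
  tens (tens (tens (unit_obj h) (unit_obj g)) (tobj f x))
    (tens (unit_obj g^-1) (unit_obj h^-1)) =
  pull (r h #o r g #o r g^-1 #o r h^-1) (Rc X 1 h g)
    (tobj (h * g * f * (h * g)^-1) (psi2 X f (h * g) x)).
Proof.
move=> fH hH gH Tx.
have gV : g^-1 \in H by inH. have hV : h^-1 \in H by inH.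
have kH : h * g \in H by inH. have kV : (h * g)^-1 \in H by inH.
have Ty := T2_psi fH kH Tx.
have Tp := T2_phi kH kV; rewrite mulgV (rho_1 HX) in Tp.
have Tq := T2_phi hH gH. have Tq' := T2_phi gV hV. rewrite -invMg in Tq'.
have ok := wf_unit kH; have okV := wf_unit kV.
have ox := wf_tobj fH Tx.
have E : tobj f x = pull one1 (id2 one1) (tobj f x).
  by rewrite /pull /=; rw (comp1idl HS).
have Ti := T2_id2 HS (T1_one HS).
rewrite !tens_unit // -invMg E tens_pull // tens_pull //; [|exact: wf_tens|by rewrite /=; t2].
rewrite psi_pull // /Rc invMg !mulg1 !(phi_1r HX) // (rho_1 HX) /pull /=. congr Obj; first by weq.
rewrite invMg in Tp Tq'.
nf2. by [].
Qed.

Lemma T3_psi3 f g x x' a : f \in H -> g \in H -> T3 one1 (r f) x x' a ->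
  T3 one1 (r (g * f * g^-1)) (psi2 X f g x) (psi2 X f g x') (psi3 X f g a).
Proof.
move=> fH gH Ta; rewrite /psi2 /psi3. have [Tx Tx'] := T3_T2 HS Ta.
have := @T2_phiV g g^-1 gH; rewrite groupV gH mulgV (rho_1 HX) => /(_ isT) Tv.
t3.
Qed.

Lemma mor_tobj f x x' a : f \in H -> T3 one1 (r f) x x' a -> mor (tobj f x) (tobj f x') a.
Proof. by move=> fH Ta; have [? ?] := T3_T2 HS Ta. Qed.

Lemma hcomp1_2isoK (F G I : C1 S) z z' k s t : is_2iso F G s t -> T3 I F z z' k ->
  k #I id3 s #I id3 t = k.
Proof.
move=> [Ts Tt e _] Tk; have [? ?] := T2_T1 HS Ts.
rwb (hcomp1A HS). rw (hcomp1_id3 HS). rewrite e. by rw (hcomp1idr HS).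
Qed.

Lemma conj_phi k : k \in H -> is_2iso (r k #o r k^-1) one1 (p k k^-1) (phiV X k k^-1).
Proof. 
by move=> kH; have := @phi_iso _ _ _ _ HX k k^-1 kH; rewrite groupV mulgV (rho_1 HX); apply.
Qed.

(** As [A] has degree 1, [phi k 1] is an identity, and the closing factor [phi k k^-1] of the first
    half cancels the [phiV] at the head of [psi3]. Applied to the inner [lam] of [path1], this turns
    its factor [Gam] into [psi_k] of [Gam]. *)
Lemma psi3_hcomp A A' n Y f x x' a k : f \in H -> k \in H ->
  og A = 1 -> mor A A' n -> oF Y = oF A -> og Y = f -> T3 one1 (r f) x x' a ->
  tensm (tens (unit_obj k) Y) (unit_obj k^-1)
    (tensm (unit_obj k) Y (id3 (os (unit_obj k))) (n #I a))
    (id3 (os (unit_obj k^-1))) =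
  tensm (tens (unit_obj k) A) (unit_obj k^-1)
    (tensm (unit_obj k) A (id3 (os (unit_obj k))) n) (id3 (os (unit_obj k^-1)))
  #I psi3 X f k a.
Proof.
move=> fH kH g1 hn; move: Y => [FY y sY] /= -> -> Ta; have [Tx Tx'] := T3_T2 HS Ta.
have kV : k^-1 \in H by inH.
move: A A' g1 hn => [FA g s] [FA' g' s'] /= g1 [oA oA' /= e1 e2 Tn]; subst g g' FA'.
obs. rewrite (rho_1 HX) in Ts Ts0 Tn.
have [Tp Tv e _] := conj_phi kH.
rewrite /tensm /psi3 /= (phi_1r HX) // mulg1.
nf3. by rw (hcomp1_2isoK (conj_phi kH)).
Qed.

(** Interchange moves [c] behind [n], so the outer morphisms act as they do at the identity. This
    evaluates the last factor of [path1] and the target side in the naturality of [Gam]. *)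
Lemma conj_hcomp A A' m B B' n f x x' c : mor A A' m -> mor B B' n -> f \in H ->
  og B = (og A)^-1 -> T3 one1 (r f) x x' c ->
  tensm (tens A (tobj f x)) B (tensm A (tobj f x) m c) n =
  tensm (tens A (unit_obj 1)) B
    (tensm A (unit_obj 1) m (id3 (os (unit_obj 1)))) n #I psi3 X f (og A) c.
Proof.
move: A A' B B' => [FA a sA] [FA' a' sA'] [FB b sB] [FB' b' sB'].
move=> [oA oA' /= eA ea ?] [oB oB' /= eB eb ?] fH eab Tc.
have [Tx Tx'] := T3_T2 HS Tc.
subst FA' a' FB' b' b; obs.
have [Tp Tv e _] := phi_iso HX gH1 gH; rewrite mulgV (rho_1 HX) in Tp Tv.
have T11 : T1 (r 1) by t1.
rewrite /tensm /psi3 /= (phi_1r HX) // mulg1 (rho_1 HX).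
nf3. rw (hcomp1_2isoK (conj_phi gH1)). rw interchange3_atr. rw interchange3_at. by [].
Qed.

Lemma psi3_id f g x : f \in H -> g \in H -> T2 one1 (r f) x ->
  psi3 X f g (id3 x) = id3 (psi2 X f g x).
Proof.
move=> fH gH Tx; have [Tp Tv _ _] := conj_phi gH; have gV : g^-1 \in H by inH.
rewrite /psi3 /psi2. nf3. by [].
Qed.

Lemma psi3_cmp f g x y z a b : f \in H -> g \in H ->
  T3 one1 (r f) x y a -> T3 one1 (r f) y z b ->
  psi3 X f g (a #2 b) = psi3 X f g a #2 psi3 X f g b.
Proof.
move=> fH gH Ta Tb; have [Tp Tv _ _] := conj_phi gH; have gV : g^-1 \in H by inH.
have [Tx Ty] := T3_T2 HS Ta; have [_ Tz] := T3_T2 HS Tb.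
rewrite /psi3. rw (lw3_comp2 HS). rw (rw3_comp2 HS).
do 3 rwb (hcomp1_comp2 HS). do 3 rw (comp2idl HS). by [].
Qed.

Lemma is_3iso_sym (F G : C1 S) s t m n : is_3iso F G s t m n -> is_3iso F G t s n m.
Proof. by case. Qed.

(** * [Gam] as the quotient of two coherence isomorphisms *)

Section GamTheory.
Variables (h g : gT).
Hypotheses (hH : h \in H) (gH : g \in H).
Local Notation A := (r h #o r g #o r g^-1 #o r h^-1).
Local Notation L := (Lc X 1 h g).
Local Notation LV := (LV X 1 h g).
Local Notation Rt := (Rc X 1 h g).
Local Notation RV := (RV X 1 h g).
Local Notation Lm := (Lam X 1 h g).
Local Notation LmV := (LamV X 1 h g).

Lemma gV_in : g^-1 \in H. Proof. inH. Qed.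
Lemma hV_in : h^-1 \in H. Proof. inH. Qed.

Lemma A_eq : r h #o r g #o r 1 #o r g^-1 #o r h^-1 = A.
Proof. have ? := gV_in; have ? := hV_in. rewrite (rho_1 HX). by rw (comp0idr HS). Qed.

Lemma rho_conj1 : r (h * g * 1 * g^-1 * h^-1) = one1.
Proof. by rewrite mulg1 mulgK mulgV (rho_1 HX). Qed.

Lemma L_iso : is_2iso A one1 L LV.
Proof. by have := Lc_iso HS HX (group1 H) hH gH; rewrite A_eq rho_conj1. Qed.

Lemma R_iso : is_2iso A one1 Rt RV.
Proof. by have := Rc_iso HS HX (group1 H) hH gH; rewrite A_eq rho_conj1. Qed.

Lemma Lm_iso : is_3iso A one1 L Rt Lm LmV.
Proof. by have := Lam_iso HS HX (group1 H) hH gH; rewrite A_eq rho_conj1. Qed.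

(** Between invertible 2-arrows, a 3-arrow invertible under #_2 is invertible under #_1 as well; the
    first factor in the definition of [Gam] is this #_1-inverse of [Lam X 1 h g]. *)
Lemma Lm_cancel : Lm #I (id3 LV #I LmV #I id3 RV) = id3 (id2 A).
Proof.
have [TL TLV e1 e2] := L_iso; have [TR TRV e3 _] := R_iso.
have [TM TMV _ e6] := Lm_iso.
have ? := T1_one HS. have [? ?] := T2_T1 HS TL.
have -> : Lm #I (id3 LV #I LmV #I id3 RV) = (Lm #I id3 LV #I LmV) #I id3 RV.
  nf3. by [].
have -> : Lm #I id3 LV #I LmV = id3 Rt.
  (* An Eckmann-Hilton argument: the two 3-arrows act on different sides of [LV] and can be
     performed one after the other, and [L #1 LV] and [LV #1 L] are identities. *)
  transitivity ((id3 (L #1 LV) #I LmV) #2 (Lm #I id3 (LV #1 L))); last first.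
    by rewrite e1 e2; rw (hcomp1idl HS); rw (hcomp1idr HS); rewrite e6.
  rwb (hcomp1_id3 HS (s := L)). rwb (hcomp1A HS). rwb (hcomp1A HS).
  rwb (hcomp1_comp2 HS). rw (comp2idl HS). rw (comp2idr HS). by [].
rw (hcomp1_id3 HS). by rewrite e3.
Qed.

Lemma prefix_tobj f x : f \in H -> T2 one1 (r f) x ->
  T2 A (r h #o r g #o r f #o r g^-1 #o r h^-1)
    ((r h #o r g) #l x #r (r g^-1 #o r h^-1)).
Proof. have ? := gV_in; have ? := hV_in. move=> *; t2. Qed.

Local Notation ltobj f x := (lam (unit_obj h) (unit_obj g) (tobj f x)
  (unit_obj g^-1) (unit_obj h^-1)).

Lemma lam_tobj f x : f \in H -> T2 one1 (r f) x ->
  ltobj f x = id3 ((r h #o r g) #l x #r (r g^-1 #o r h^-1)) #I Lam X f h g.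
Proof.
have gV := gV_in; have hV := hV_in.
move=> fH Tx; rewrite -lam_unit // tobj_pull //.
have oh := wf_unit hH; have og := wf_unit gH.
have ohV := wf_unit hV; have ogV := wf_unit gV.
have T k : k \in H -> T2 (r k) (oF (unit_obj k)) (id2 (r k)).
  by move=> kH; apply: (T2_id2 HS); t1.
rewrite -{1}(pull_unit hH) -{1}(pull_unit gH) -{1}(pull_unit hV) -{1}(pull_unit gV).
rewrite lam_pull; try exact: wf_unit; try exact: T; try exact: Tx.
congr (id3 _ #I _). rewrite /prefix5 /=. nf2. by [].
Qed.

(* [Gam] is determined by this identity ([Gam_inj]), which does not mention the
   inverse 2-arrows and 3-arrows in its definition. *)
Lemma lam_Gam f x : f \in H -> T2 one1 (r f) x ->
  ltobj f x = Lm #I Gam X f h g x.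
Proof.
move=> fH Tx; have gV := gV_in; have hV := hV_in.
have TL := Lam_iso HS HX fH hH gH; have [TLf _ _ _] := TL.
have Tp := prefix_tobj fH Tx.
have [TL1 TLV e1 e2] := L_iso; have [TR TRV e3 _] := R_iso.
have [TM TMV _ e6] := Lm_iso.
have ? := T1_one HS. have [? ?] := T2_T1 HS TL1.
rewrite lam_tobj // /Gam.
rw (hcomp1A HS). rw (hcomp1A HS). rewrite Lm_cancel. by rw (hcomp1idl HS).
Qed.

Lemma src_tobj f x : f \in H -> T2 one1 (r f) x ->
  (r h #o r g) #l x #r (r g^-1 #o r h^-1) #1 Lc X f h g =
  L #1 psi2 X (g * f * g^-1) h (psi2 X f g x).
Proof.
move=> fH Tx; have gV := gV_in; have hV := hV_in.
transitivity (os (tens (tens (unit_obj h)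
  (tens (tens (unit_obj g) (tobj f x)) (unit_obj g^-1))) (unit_obj h^-1))).
  rewrite /Lc /=. nf2. by [].
by rewrite src_pull.
Qed.

Lemma tgt_tobj f x : f \in H -> T2 one1 (r f) x ->
  (r h #o r g) #l x #r (r g^-1 #o r h^-1) #1 Rc X f h g =
  Rt #1 psi2 X f (h * g) x.
Proof.
move=> fH Tx; have gV := gV_in; have hV := hV_in.
transitivity (os (tens (tens (tens (unit_obj h) (unit_obj g)) (tobj f x))
    (tens (unit_obj g^-1) (unit_obj h^-1)))).
  rewrite /Rc /=. nf2. rw (lw2_rw2 HS (s := x) (H := r (h * g))).
  rw (interchange2 HS). nf2. by [].
by rewrite tgt_pull.
Qed.

(** All #_1-factors of [Gam] are invertible under #_2. [src_tobj] and [tgt_tobj] identify the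
    boundaries once [Lc X 1 h g] and [Rc X 1 h g] are cancelled. *)
Lemma T3_Gam f x : f \in H -> T2 one1 (r f) x ->
  exists GV, is_3iso one1 (r (h * g * f * (h * g)^-1))
   (psi2 X (g * f * g^-1) h (psi2 X f g x)) (psi2 X f (h * g) x)
   (Gam X f h g x) GV.
Proof.
move=> fH Tx; have gV := gV_in; have hV := hV_in.
have TL := Lam_iso HS HX fH hH gH; have [TLf _ _ _] := TL.
have Tp := prefix_tobj fH Tx.
have [TL1 TLV e1 e2] := L_iso; have [TR TRV e3 e4] := R_iso.
have LI := Lm_iso.
have ? := T1_one HS. have [? ?] := T2_T1 HS TL1.
pose GV := id3 LV #I Lm #I id3 RV #I id3 ((r h #o r g) #l x #r (r g^-1 #o r h^-1))
  #I LamV X f h g.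
exists GV.
have Ep : is_3iso A (r h #o r g #o r f #o r g^-1 #o r h^-1) _ _ _ _ := Defs.i3id HS Tp.
have I1 := Defs.i3h HS (Defs.i3h HS (Defs.i3h HS (Defs.i3h HS (Defs.i3id HS TLV)
  (is_3iso_sym LI)) (Defs.i3id HS TRV)) Ep) TL.
have e := src_tobj fH Tx; have e' := tgt_tobj fH Tx.
have TC : h * g * f * (h * g)^-1 = h * g * f * g^-1 * h^-1 by rewrite invMg !mulgA.
have [T1' _ _ _] := TL; have [TLf' TRf'] := T3_T2 HS T1'.
have Tps := T2_psi fH gH Tx.
have Tpps := @T2_psi (g * f * g^-1) h _ ltac:(inH) hH Tps.
have Tps' := @T2_psi f (h * g) _ fH ltac:(inH) Tx.
rewrite !mulgA in Tpps. rewrite TC in Tps' *.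
apply: Defs.i3e I1 _ _ _ _ => //.
- rwb (comp1A HS (s := LV)). rewrite e3. rw (comp1idr HS).
  rwb (comp1A HS (s := LV)). rewrite e. rw (comp1A HS). rewrite e2.
  by rw (comp1idl HS).
- rewrite e2. rw (comp1idl HS). rwb (comp1A HS (s := RV)). rewrite e'.
  rw (comp1A HS). rewrite e4. by rw (comp1idl HS).
Qed.

(** Composing with [mV] under #_2 turns [m #I c] into [id3 l #I c], and composing with [lV] under
    #_1 removes [l]. *)
Lemma hcomp1_inj (F G I : C1 S) l lV l' m mV w w' c c' :
  is_2iso F G l lV -> is_3iso F G l l' m mV ->
  T3 G I w w' c -> T3 G I w w' c' -> m #I c = m #I c' -> c = c'.
Proof.
move=> [Tl TlV _ e] [Tm TmV e' _] Tc Tc' E.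
have [Tw Tw'] := T3_T2 HS Tc; have [? ?] := T2_T1 HS Tw; have [? ?] := T2_T1 HS Tl.
have E' b : T3 G I w w' b -> id3 l #I b = (m #I b) #2 (mV #I id3 w').
  move=> Tb; rwb (hcomp1_comp2 HS). rewrite e'. by rw (comp2idr HS).
have E2 b : T3 G I w w' b -> b = id3 lV #I (id3 l #I b).
  move=> Tb; rw (hcomp1A HS). rw (hcomp1_id3 HS). rewrite e. by rw (hcomp1idl HS).
by rewrite (E2 c) // (E2 c') // (E' c) // (E' c') // E.
Qed.

Lemma Gam_inj f w w' c c' : T3 one1 (r f) w w' c -> T3 one1 (r f) w w' c' ->
  Lm #I c = Lm #I c' -> c = c'.
Proof. exact: hcomp1_inj L_iso Lm_iso. Qed.
End GamTheory.

Lemma psi3_pull f g x x' a : f \in H -> g \in H -> T3 one1 (r f) x x' a ->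
  tensm (tens (unit_obj g) (tobj f x)) (unit_obj g^-1)
    (tensm (unit_obj g) (tobj f x) (id3 (os (unit_obj g))) a) (id3 (os (unit_obj g^-1))) =
  id3 (p g g^-1) #I psi3 X f g a.
Proof.
move=> fH gH Ta; have [Tx Tx'] := T3_T2 HS Ta; have gV : g^-1 \in H by inH.
have [Tp Tv e _] := conj_phi gH.
rewrite /tensm /psi3 /=. nf3.
have -> : id3 (p g g^-1) #I id3 (phiV X g g^-1) = id3 (id2 (r g #o r g^-1)).
  by rw (hcomp1_id3 HS); rewrite e.
nf3. by [].
Qed.

Lemma assocV_nat A A' m B B' n C C' k : mor A A' m -> mor B B' n -> mor C C' k ->
  tensm (tens A B) C (tensm A B m n) k #2 assocV A' B' C' =
  assocV A B C #2 tensm A (tens B C) m (tensm B C n k).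
Proof.
move=> hm hn hk.
have oA := mor_okl hm; have oB := mor_okl hn; have oC := mor_okl hk.
have oA' := mor_okr hm; have oB' := mor_okr hn; have oC' := mor_okr hk.
have h1 := mor_ten (mor_ten hm hn) hk; have h2 := mor_ten hm (mor_ten hn hk).
have a := mor_assoc oA oB oC; have aV := mor_assocV oA oB oC.
have b := mor_assoc oA' oB' oC'; have bV := mor_assocV oA' oB' oC'.
rewrite -(mcmp_idl h1) -assocV_assoc // -(mcmpA aV a h1) -(assoc_nat hm hn hk).
rewrite (mcmpA aV h2 b) -(mcmpA (mor_cmp aV h2) b bV) assoc_assocV //.
exact: mcmp_idr (mor_cmp aV h2).
Qed.

Lemma lam_nat A B E E' B' A' a : wf_obj A -> wf_obj B -> wf_obj B' -> wf_obj A' -> mor E E' a ->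
  tensm (tens A (tens (tens B E) B')) A'
    (tensm A (tens (tens B E) B') (id3 (os A))
       (tensm (tens B E) B' (tensm B E (id3 (os B)) a) (id3 (os B')))) (id3 (os A'))
  #2 lam A B E' B' A' =
  lam A B E B' A' #2
  tensm (tens (tens A B) E) (tens B' A')
    (tensm (tens A B) E (id3 (os (tens A B))) a) (id3 (os (tens B' A'))).
Proof.
move=> oA oB oB' oA' ha.
have hA := mor_id oA; have hB := mor_id oB; have hB' := mor_id oB'.
have hA' := mor_id oA'. have oE := mor_okl ha. have oE' := mor_okr ha.
have hBE := mor_ten hB ha. have oBE := mor_okl hBE. have oBE' := mor_okr hBE.
have hABE := mor_ten hA hBE. have hABE' := mor_ten (mor_ten hA hB) ha.
have hsrc := mor_ten (mor_ten hA (mor_ten hBE hB')) hA'.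
have f1 := mor_ten (mor_assoc oA oBE' oB') hA'.
have f2 := mor_ten (mor_ten (mor_assoc oA oB oE') hB') hA'.
have f3 := mor_assocV (wf_tens (wf_tens oA oB) oE') oB' oA'.
have g1 := mor_ten (mor_assoc oA oBE oB') hA'.
have g2 := mor_ten (mor_ten (mor_assoc oA oB oE) hB') hA'.
have g3 := mor_assocV (wf_tens (wf_tens oA oB) oE) oB' oA'.
have k1 := mor_ten (mor_ten hABE hB') hA'.
have k2 := mor_ten (mor_ten hABE' hB') hA'.
have k3 := mor_ten hABE' (mor_ten hB' hA').
rewrite /lam (mcmpA hsrc (mor_cmp f1 f2) f3) (mcmpA hsrc f1 f2).
rewrite -(tensm_cmp (mor_ten hA (mor_ten hBE hB')) (mor_assoc oA oBE' oB') hA' hA').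
rewrite (assoc_nat hA hBE hB') (mcmp_idl hA') -{1}(mcmp_idl hA').
rewrite (tensm_cmp (mor_assoc oA oBE oB') (mor_ten hABE hB') hA' hA').
rewrite -(mcmpA g1 k1 f2).
rewrite -(tensm_cmp (mor_ten hABE hB') (mor_ten (mor_assoc oA oB oE') hB') hA' hA').
rewrite -(tensm_cmp hABE (mor_assoc oA oB oE') hB' hB') (assoc_nat hA hB ha) (mcmp_idl hB').
rewrite -{1}(mcmp_idl hB') (tensm_cmp (mor_assoc oA oB oE) hABE' hB' hB') (mcmp_idl hA').
rewrite -{2}(mcmp_idl hA').
rewrite (tensm_cmp (mor_ten (mor_assoc oA oB oE) hB') (mor_ten hABE' hB') hA' hA').
rewrite (tensm_id oA oB) in k2 k3 *; rewrite (tensm_id oB' oA') in k3.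
rewrite (mcmpA g1 g2 k2) -(mcmpA (mor_cmp g1 g2) k2 f3).
rewrite (assocV_nat (mor_ten (mor_id (wf_tens oA oB)) ha) hB' hA') tensm_id //.
by rewrite (mcmpA (mor_cmp g1 g2) g3 k3).
Qed.

Section GamTheory2.
Variables (h g : gT).
Hypotheses (hH : h \in H) (gH : g \in H).

Lemma src_psi3 f x x' a : f \in H -> T3 one1 (r f) x x' a ->
  tensm (tens (unit_obj h) (tens (tens (unit_obj g) (tobj f x)) (unit_obj g^-1)))
    (unit_obj h^-1)
    (tensm (unit_obj h) (tens (tens (unit_obj g) (tobj f x)) (unit_obj g^-1))
       (id3 (os (unit_obj h)))
       (tensm (tens (unit_obj g) (tobj f x)) (unit_obj g^-1)
          (tensm (unit_obj g) (tobj f x) (id3 (os (unit_obj g))) a)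
          (id3 (os (unit_obj g^-1))))) (id3 (os (unit_obj h^-1))) =
  id3 (Lc X 1 h g) #I psi3 X (g * f * g^-1) h (psi3 X f g a).
Proof.
move=> fH Ta; have gV := gV_in gH; have hV := gV_in hH.
have Tb := T3_psi3 fH gH Ta; have [Tp Tv e _] := conj_phi hH.
have [Tq _ _ _] := conj_phi gH.
rewrite (psi3_pull fH gH Ta) Lc1 //.
move: (psi3 X f g a) Tb => b Tb.
have [Ty Ty'] := T3_T2 HS Tb.
rewrite /tensm /psi3 /=. nf3. rw (hcomp1_2isoK (conj_phi hH)). by [].
Qed.

Lemma tgt_psi3 f x x' a : f \in H -> T3 one1 (r f) x x' a ->
  tensm (tens (tens (unit_obj h) (unit_obj g)) (tobj f x))
    (tens (unit_obj g^-1) (unit_obj h^-1))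
    (tensm (tens (unit_obj h) (unit_obj g)) (tobj f x)
      (id3 (os (tens (unit_obj h) (unit_obj g)))) a)
      (id3 (os (tens (unit_obj g^-1) (unit_obj h^-1)))) =
  id3 (Rc X 1 h g) #I psi3 X f (h * g) a.
Proof.
move=> fH Ta; have gV := gV_in gH; have hV := gV_in hH.
have o1 := wf_unit hH; have o2 := wf_unit gH; have o3 := wf_unit gV.
have o4 := wf_unit hV; have o5 := wf_unit (group1 H).
rewrite (conj_hcomp (mor_id (wf_tens o1 o2)) (mor_id (wf_tens o3 o4)) fH _ Ta);
  last by rewrite /= invMg.
rewrite tensm_id //; last exact: wf_tens.
rewrite tensm_id //; try by do ?apply: wf_tens.
rewrite -tobj1 tgt_pull //; last by have := T2_id2 HS (T1_one HS); rewrite (rho_1 HX).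
congr (id3 _ #I _).
have Ti := T2_id2 HS (T1_one HS). have kH : h * g \in H by inH.
have -> : psi2 X 1 (h * g) (id2 one1) = id2 one1.
  have [Tp Tv _ e] := conj_phi kH; have ? : (h * g)^-1 \in H by inH.
  rewrite /psi2 mulg1 (phi_1r HX) //. nf2. by rewrite e.
have [TR _ _ _] := R_iso hH gH.
by rewrite /=; rw (comp1idr HS).
Qed.

(** After #_1-composition with [Lam X 1 h g], which [Gam_inj] cancels, this is the naturality of
    [lam] in its middle object. *)
Lemma Gam_nat f x x' a : f \in H -> T3 one1 (r f) x x' a ->
  psi3 X (g * f * g^-1) h (psi3 X f g a) #2 Gam X f h g x' =
  Gam X f h g x #2 psi3 X f (h * g) a.
Proof.
move=> fH Ta; have [Tx Tx'] := T3_T2 HS Ta.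
have gV := gV_in gH; have hV := gV_in hH. have kH : h * g \in H by inH.
have cH : g * f * g^-1 \in H by inH.
have Tb := T3_psi3 cH hH (T3_psi3 fH gH Ta).
have Tk := T3_psi3 fH kH Ta.
have [G' [TG _ _ _]] := T3_Gam hH gH fH Tx.
have [G'' [TG' _ _ _]] := T3_Gam hH gH fH Tx'.
have eq : h * (g * f * g^-1) * h^-1 = h * g * f * (h * g)^-1 by rewrite invMg !mulgA.
rewrite eq in Tb.
apply: (Gam_inj hH gH (f := h * g * f * (h * g)^-1)).
- exact: T3_comp2 HS _ _ _ _ _ _ _ Tb TG'.
- exact: T3_comp2 HS _ _ _ _ _ _ _ TG Tk.
have [TL _ _ _] := L_iso hH gH; have [TR _ _ _] := R_iso hH gH.
have [TM _ _ _] := Lm_iso hH gH.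
transitivity ((id3 (Lc X 1 h g) #I psi3 X (g * f * g^-1) h (psi3 X f g a)) #2
  (Lam X 1 h g #I Gam X f h g x')).
  rwb (hcomp1_comp2 HS). by rw (comp2idl HS).
transitivity ((Lam X 1 h g #I Gam X f h g x) #2
  (id3 (Rc X 1 h g) #I psi3 X f (h * g) a)); last first.
  rwb (hcomp1_comp2 HS). by rw (comp2idr HS).
rewrite -!lam_Gam // -(src_psi3 fH Ta) -(tgt_psi3 fH Ta).
apply: lam_nat; try exact: wf_unit. exact: mor_tobj.
Qed.
End GamTheory2.

Lemma psi2_one g : g \in H -> psi2 X 1 g (id2 one1) = id2 one1.
Proof.
move=> gH; have [Tp Tv _ e] := conj_phi gH; have gV := gV_in gH.
have Ti := T2_id2 HS (T1_one HS).
rewrite /psi2 mulg1 (phi_1r HX) //. nf2. by rewrite e.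
Qed.

(** [tobj f x] and [unit_obj 1] have the same source, so precomposition puts the same prefix in
    front of both occurrences of [lam]. This carries [lam_Gam] over to tensor products of unit
    objects, as they occur in [path1] and [path2]. *)
Lemma lam_pull_Gam f h g x FA uA FB uB FE uE FB' uB' FA' uA' :
  f \in H -> h \in H -> g \in H -> T2 one1 (r f) x ->
  T2 FA (r h) uA -> T2 FB (r g) uB -> T2 FE one1 uE ->
  T2 FB' (r g^-1) uB' -> T2 FA' (r h^-1) uA' ->
  lam (pull FA uA (unit_obj h)) (pull FB uB (unit_obj g)) (pull FE uE (tobj f x))
    (pull FB' uB' (unit_obj g^-1)) (pull FA' uA' (unit_obj h^-1)) =
  lam (pull FA uA (unit_obj h)) (pull FB uB (unit_obj g)) (pull FE uE (unit_obj 1))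
    (pull FB' uB' (unit_obj g^-1)) (pull FA' uA' (unit_obj h^-1))
  #I Gam X f h g x.
Proof.
move=> fH hH gH Tx TA TB TE TB' TA'; have gV := gV_in gH; have hV := hV_in hH.
have Ti := T2_id2 HS (T1_one HS).
have [GV [TG _ _ _]] := T3_Gam hH gH fH Tx.
have [TM _ _ _] := Lm_iso hH gH.
have [? ?] := T2_T1 HS TA; have [? ?] := T2_T1 HS TB; have [? ?] := T2_T1 HS TE.
have [? ?] := T2_T1 HS TB'; have [? ?] := T2_T1 HS TA'.
rewrite !lam_pull; rewrite -?tobj1; do ?[exact: wf_unit | exact: wf_tobj | by [] ].
all: try by apply: wf_tobj; rewrite ?(rho_1 HX) //; exact: group1.
rewrite lam_Gam // tobj1 lam_unit //.
set P := prefix5 _ _ (tobj f x) _ _ _ _ _ _ _ _ _ _.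
have -> : prefix5 (unit_obj h) (unit_obj g) (unit_obj 1) (unit_obj g^-1)
  FB FE FB' FA' uA uB uE uB' uA' = P by rewrite /P /prefix5 /= (rho_1 HX).
have TP : T2 (FA #o FB #o FE #o FB' #o FA') (r h #o r g #o r g^-1 #o r h^-1) P.
  rewrite /P /prefix5 /=. t2.
rw (hcomp1A HS). by [].
Qed.

Lemma phiV11 : phiV X 1 1 = id2 one1.
Proof.
have [Tp Tv e _] := phi_iso HX (group1 H) (group1 H).
rewrite mulg1 (phi_1l HX) ?group1 // (rho_1 HX) (comp0idl HS (T1_one HS)) in Tp Tv e.
by rewrite -e; rw (comp1idl HS).
Qed.

Lemma psi2_1 f x : f \in H -> T2 one1 (r f) x -> psi2 X f 1 x = x.
Proof.
move=> fH Tx; have o := T1_one HS.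
rewrite /psi2 invg1 mul1g phiV11 (phi_1l HX) // (phi_1r HX) // (rho_1 HX).
nf2. by [].
Qed.

Lemma psi3_1 f x y a : f \in H -> T3 one1 (r f) x y a -> psi3 X f 1 a = a.
Proof.
move=> fH Ta; have [Tx Ty] := T3_T2 HS Ta; have o := T1_one HS.
rewrite /psi3 invg1 mul1g phiV11 (phi_1l HX) // (phi_1r HX) // (rho_1 HX).
nf3. by [].
Qed.

(** * Associativity of [Gam] *)

Section GamAssoc.
Variables (k h g : gT).
Hypotheses (kH : k \in H) (hH : h \in H) (gH : g \in H).
Local Notation U := unit_obj.
Local Notation cnj a b E b' a' := (tens (tens a (tens (tens b E) b')) a').

(* The two ways from [(k ((h ((g E) g')) h')) k'] to [(((k h) g) E) (g' (h' k'))],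
   where the prime denotes the inverse, that correspond to the two sides of the
   associativity of [Gam]; the last factor of [path1] aligns the ends. *)
Definition path1 E :=
  tensm (tens (U k) (cnj (U h) (U g) E (U g^-1) (U h^-1))) (U k^-1)
    (tensm (U k) (cnj (U h) (U g) E (U g^-1) (U h^-1)) (id3 (os (U k)))
      (lam (U h) (U g) E (U g^-1) (U h^-1))) (id3 (os (U k^-1)))
  #2 lam (U k) (tens (U h) (U g)) E (tens (U g^-1) (U h^-1)) (U k^-1)
  #2 tensm (tens (tens (U k) (tens (U h) (U g))) E)
       (tens (tens (U g^-1) (U h^-1)) (U k^-1))
       (tensm (tens (U k) (tens (U h) (U g))) E (assoc (U k) (U h) (U g)) (id3 (os E)))
       (assocV (U g^-1) (U h^-1) (U k^-1)).

Definition path2 E :=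
  lam (U k) (U h) (tens (tens (U g) E) (U g^-1)) (U h^-1) (U k^-1)
  #2 lam (tens (U k) (U h)) (U g) E (U g^-1) (tens (U h^-1) (U k^-1)).

Lemma mv_path1 E : wf_obj E ->
  let K := Lf (U k) in let Hh := Lf (U h) in let G := Lf (U g) in
  let K' := Lf (U k^-1) in let Hh' := Lf (U h^-1) in let G' := Lf (U g^-1) in
  move (Nd (Nd K (Nd (Nd Hh (Nd (Nd G (Lf E)) G')) Hh')) K')
       (Nd (Nd (Nd (Nd K Hh) G) (Lf E)) (Nd G' (Nd Hh' K'))) (path1 E).
Proof.
move=> oE K Hh G K' Hh' G'.
have gV := gV_in gH; have hV := hV_in hH; have kV := hV_in kH.
have oK : wf_tree K by exact: wf_unit. have oK' : wf_tree K' by exact: wf_unit.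
have oH : wf_tree Hh by exact: wf_unit. have oH' : wf_tree Hh' by exact: wf_unit.
have oG : wf_tree G by exact: wf_unit. have oG' : wf_tree G' by exact: wf_unit.
apply: mv_cmp.
  apply: mv_cmp; last first.
    by apply: (@mv_lam K (Nd Hh G) (Lf E) (Nd G' Hh') K').
  apply: (@mv_ten (Nd K (Nd (Nd Hh (Nd (Nd G (Lf E)) G')) Hh')) _ K'); last exact: mv_id.
  apply: (@mv_ten K _ (Nd (Nd Hh (Nd (Nd G (Lf E)) G')) Hh')); first exact: mv_id.
  exact: (@mv_lam Hh G (Lf E) G' Hh').
apply: (@mv_ten (Nd (Nd K (Nd Hh G)) (Lf E)) _ (Nd (Nd G' Hh') K')).
  apply: (@mv_ten (Nd K (Nd Hh G)) _ (Lf E)); last exact: mv_id.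
  exact: (@mv_assoc K Hh G).
exact: (@mv_assocV G' Hh' K').
Qed.

Lemma path12 E : wf_obj E -> path1 E = path2 E.
Proof.
move=> oE; apply: coherence (mv_path1 oE) _.
have gV := gV_in gH; have hV := hV_in hH; have kV := hV_in kH.
have ? := wf_unit kH; have ? := wf_unit hH; have ? := wf_unit gH.
have ? := wf_unit kV; have ? := wf_unit hV; have ? := wf_unit gV.
apply: mv_cmp.
  exact: (@mv_lam (Lf (U k)) (Lf (U h)) (Nd (Nd (Lf (U g)) (Lf E)) (Lf (U g^-1)))
    (Lf (U h^-1)) (Lf (U k^-1))).
exact: (@mv_lam (Nd (Lf (U k)) (Lf (U h))) (Lf (U g)) (Lf E) (Lf (U g^-1))
  (Nd (Lf (U h^-1)) (Lf (U k^-1)))).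
Qed.

Lemma hcomp1_cmp A B C m n f w w' w'' a b : mor A B m -> mor B C n -> og A = 1 ->
  T3 one1 (r f) w w' a -> T3 one1 (r f) w' w'' b ->
  (m #I a) #2 (n #I b) = (m #2 n) #I (a #2 b).
Proof.
move=> [_ _ eF eg Tm] [_ _ _ _ Tn] g1 Ta Tb.
rewrite -eF -eg g1 in Tn; rewrite g1 (rho_1 HX) in Tm Tn.
by rwb (hcomp1_comp2 HS).
Qed.

Lemma T2_idr e : e \in H -> T2 (r e) (r e) (id2 (r e)).
Proof. by move=> ?; t2. Qed.

(** [tens (U h) (U g)] is the unit object of [h * g] precomposed with [phi h g], so [lam_pull_Gam]
    applies. In [lam_Gam3] below the middle object is likewise [psi_g x] precomposed with
    [phi g g^-1]. *)
Lemma lam_Gam1 f x : f \in H -> T2 one1 (r f) x ->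
  lam (U k) (tens (U h) (U g)) (tobj f x) (tens (U g^-1) (U h^-1)) (U k^-1) =
  lam (U k) (tens (U h) (U g)) (U 1) (tens (U g^-1) (U h^-1)) (U k^-1)
  #I Gam X f k (h * g) x.
Proof.
move=> fH Tx.
have gV := gV_in gH; have hV := hV_in hH; have kV := hV_in kH.
have Tp := T2_phi gV hV; rewrite -invMg in Tp.
have Ti := T2_id2 HS (T1_one HS).
have := lam_pull_Gam fH kH (groupM hH gH) Tx (T2_idr kH) (T2_phi hH gH) Ti Tp (T2_idr kV).
rewrite invMg -!tens_unit // !pull_unit //.
have -> : pull one1 (id2 one1) (tobj f x) = tobj f x.
  by rewrite /pull /=; rw (comp1idl HS).
by rewrite -(rho_1 HX) pull_unit // group1.
Qed.

Lemma lam_Gam2 f x : f \in H -> T2 one1 (r f) x ->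
  lam (tens (U k) (U h)) (U g) (tobj f x) (U g^-1) (tens (U h^-1) (U k^-1)) =
  lam (tens (U k) (U h)) (U g) (U 1) (U g^-1) (tens (U h^-1) (U k^-1))
  #I Gam X f (k * h) g x.
Proof.
move=> fH Tx.
have gV := gV_in gH; have hV := hV_in hH; have kV := hV_in kH.
have Tp := T2_phi hV kV; rewrite -invMg in Tp.
have Ti := T2_id2 HS (T1_one HS).
have := lam_pull_Gam fH (groupM kH hH) gH Tx (T2_phi kH hH) (T2_idr gH) Ti (T2_idr gV) Tp.
rewrite invMg -!tens_unit // !pull_unit //.
have -> : pull one1 (id2 one1) (tobj f x) = tobj f x.
  by rewrite /pull /=; rw (comp1idl HS).
by rewrite -(rho_1 HX) pull_unit // group1.
Qed.

Lemma lam_Gam3 f x : f \in H -> T2 one1 (r f) x ->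
  lam (U k) (U h) (tens (tens (U g) (tobj f x)) (U g^-1)) (U h^-1) (U k^-1) =
  lam (U k) (U h) (tens (tens (U g) (U 1)) (U g^-1)) (U h^-1) (U k^-1)
  #I Gam X (g * f * g^-1) k h (psi2 X f g x).
Proof.
move=> fH Tx.
have gV := gV_in gH; have hV := hV_in hH; have kV := hV_in kH.
have cH : g * f * g^-1 \in H by inH.
have Ti := T2_id2 HS (T1_one HS).
have [Tp _ _ _] := conj_phi gH.
have := lam_pull_Gam cH kH hH (T2_psi fH gH Tx) (T2_idr kH) (T2_idr hH) Tp (T2_idr hV) (T2_idr kV).
rewrite -psi_pull // !pull_unit //.
suff -> : pull (r g #o r g^-1) (p g g^-1) (U 1) = tens (tens (U g) (U 1)) (U g^-1) by [].
rewrite -tobj1 psi_pull ?group1 ?(rho_1 HX) //.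
by rewrite psi2_one // mulg1 mulgV.
Qed.

(* With [x' = tobj f x] and the two sides [q], [q'] of the equation,
   [path1 x' = path1 1 #I q] and [path2 x' = path2 1 #I q']; by coherence
   [path1 = path2], and [path1 1] can be cancelled. *)
Lemma Gam_assoc f x : f \in H -> T2 one1 (r f) x ->
  psi3 X (h * g * f * (h * g)^-1) k (Gam X f h g x) #2 Gam X f k (h * g) x =
  Gam X (g * f * g^-1) k h (psi2 X f g x) #2 Gam X f (k * h) g x.
Proof.
move=> fH Tx.
have gV := gV_in gH; have hV := hV_in hH; have kV := hV_in kH.
have hgH := groupM hH gH; have khH := groupM kH hH.
have cH : g * f * g^-1 \in H by inH.
have c'H : h * g * f * (h * g)^-1 \in H by inH.
have oK := wf_unit kH; have oH := wf_unit hH; have oG := wf_unit gH.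
have oK' := wf_unit kV; have oH' := wf_unit hV; have oG' := wf_unit gV.
have o1 := wf_unit (group1 H); have ox := wf_tobj fH Tx.
have Ti := T2_id2 HS (T1_one HS).
have [? [TG _ _ _]] := T3_Gam hH gH fH Tx.
have Tq1 := T3_psi3 c'H kH TG.
have [? [Tq2 _ _ _]] := T3_Gam kH hgH fH Tx.
have [? [Tq3 _ _ _]] := T3_Gam kH hH cH (T2_psi fH gH Tx).
have [? [Tq4 _ _ _]] := T3_Gam khH gH fH Tx.
(* The contribution of the last factor of [path1], which leaves the trace object unchanged. *)
have Tq5 := T3_id3 HS (T2_psi fH (groupM kH hgH) Tx).
set F := k * h * g * f * (k * h * g)^-1 in Tq4.
have E1 : k * (h * g * f * (h * g)^-1) * k^-1 = F by rewrite /F !invMg !mulgA.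
have E2 : k * (h * g) * f * (k * (h * g))^-1 = F by rewrite /F !invMg !mulgA.
have E3 : k * h * (g * f * g^-1) * (k * h)^-1 = F by rewrite /F !invMg !mulgA.
rewrite E1 in Tq1; rewrite E2 in Tq2 Tq5; rewrite E3 in Tq3.
have E5 : h * (g * f * g^-1) * h^-1 = h * g * f * (h * g)^-1 by rewrite invMg !mulgA.
rewrite E5 in Tq3; rewrite -(mulgA k h g) in Tq4.
set q1 := psi3 _ _ _ _ in Tq1 *; set q2 := Gam X _ _ _ _ in Tq2 *.
set q3 := Gam X _ _ _ (psi2 _ _ _ _) in Tq3 *; set q4 := Gam X _ _ _ x in Tq4 *.
have h1 := mor_ten (mor_ten (mor_id oK) (mor_lam oH oG o1 oG' oH')) (mor_id oK').
have h2 := mor_lam oK (wf_tens oH oG) o1 (wf_tens oG' oH') oK'.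
have h3 := mor_ten (mor_ten (mor_assoc oK oH oG) (mor_id o1)) (mor_assocV oG' oH' oK').
have h4 := mor_lam oK oH (wf_tens (wf_tens oG o1) oG') oH' oK'.
have h5 := mor_lam (wf_tens oK oH) oG o1 oG' (wf_tens oH' oK').
have P1 : path1 (tobj f x) = path1 (U 1) #I (q1 #2 q2).
  rewrite /path1 lam_Gam // -lam_unit // lam_Gam1 //.
  rewrite (psi3_hcomp c'H kH _ (mor_lam oH oG o1 oG' oH') _ _ TG); first last.
  - by rewrite /= invMg !mulgA.
  - by rewrite /= (rho_1 HX).
  - by rewrite /= mulg1 !mulgV mulg1 mulgV.
  rewrite (conj_hcomp (mor_assoc oK oH oG) (mor_assocV oG' oH' oK') fH _ (T3_id3 HS Tx));
    last by rewrite /= !invMg.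
  rewrite psi3_id //=; last exact: groupM.
  rewrite -/q1 -/q2.
  rewrite (hcomp1_cmp h1 h2 _ Tq1 Tq2); last by rewrite /= mulg1 !mulgV mulg1 mulgV mulg1 mulgV.
  rewrite (hcomp1_cmp (mor_cmp h1 h2) h3 _ (T3_comp2 HS Tq1 Tq2) Tq5);
    last by rewrite /= mulg1 !mulgV mulg1 mulgV mulg1 mulgV.
  congr (_ #I _). exact: comp2idr HS _ _ _ _ _ (T3_comp2 HS Tq1 Tq2).
have P2 : path2 (tobj f x) = path2 (U 1) #I (q3 #2 q4).
  rewrite /path2 lam_Gam3 // lam_Gam2 // -/q3 -/q4.
  by rewrite (hcomp1_cmp h4 h5 _ Tq3 Tq4) //= mulg1 !mulgV mulg1 mulgV mulg1 mulgV.
have [_ _ [[_ _ _ _ Tm] [mV [[_ _ _ _ TmV] e1 e2]]]] := mv_hom (mv_path1 o1).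
have og1 : og (cnj (U k) (U h) (tens (tens (U g) (U 1)) (U g^-1)) (U h^-1) (U k^-1)) = 1.
  by rewrite /= mulg1 !mulgV mulg1 mulgV mulg1 mulgV.
have og2 : og (tens (tens (tens (tens (U k) (U h)) (U g)) (U 1))
       (tens (U g^-1) (tens (U h^-1) (U k^-1)))) = 1.
  by rewrite /= !mulgA mulg1 !mulgK mulgV.
have src1 : oF (cnj (U k) (U h) (tens (tens (U g) (U 1)) (U g^-1)) (U h^-1) (U k^-1)) =
   oF (tens (tens (tens (tens (U k) (U h)) (U g)) (U 1))
       (tens (U g^-1) (tens (U h^-1) (U k^-1)))).
  by case: (mv_hom (mv_path1 o1)) => _ _ [[]].
rewrite [tval _]/= in Tm TmV e1 e2.
move: Tm TmV e1 e2.
rewrite [tval _]/= og1 og2 -src1 (rho_1 HX) => Tm TmV e1 e2.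
have LI := L_iso hH gH; have [TL _ _ _] := LI; have [TA _] := T2_T1 HS TL.
have inner : cnj (U h) (U g) (U 1) (U g^-1) (U h^-1) =
    pull (r h #o r g #o r g^-1 #o r h^-1) (Lc X 1 h g) (U 1).
  rewrite -tobj1 src_pull ?group1 ?(rho_1 HX) //.
  by rewrite mulg1 mulgV psi2_one // mulg1 mulgV psi2_one.
(* To cancel [path1] at the identity, its source must be an invertible 2-arrow. By [inner] it is the
   whiskered [Lc X 1 h g] followed by [phi k k^-1]. *)
have LI2 : is_2iso
  (oF (tens (tens (U k) (cnj (U h) (U g) (U 1) (U g^-1) (U h^-1))) (U k^-1))) one1
  (os (tens (tens (U k) (cnj (U h) (U g) (U 1) (U g^-1) (U h^-1))) (U k^-1)))
  (phiV X k k^-1 #1 (r k #l LV X 1 h g #r r k^-1)).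
  rewrite inner /= (phi_1r HX) // mulg1.
  have := Defs.iso_c HS (Defs.iso_r HS (T1_rho kV) (Defs.iso_l HS (T1_rho kH) LI)).
  rewrite (comp0idr HS (T1_rho kH)) => /(_ _ _ _ (conj_phi kH)) I2.
  apply: Defs.iso_e; [|reflexivity|reflexivity].
  have -> : (id2 (r k) #r (r h #o r g #o r g^-1 #o r h^-1)
     #1 r k #l (Lc X 1 h g #1 id2 (r 1)) #1 id2 (r k)) #r r k^-1
     #1 r k #l id2 (r k^-1) #1 p k k^-1 = (r k #l Lc X 1 h g #r r k^-1) #1 p k k^-1.
    rewrite (rho_1 HX). nf2. by [].
  exact: I2.
apply: (hcomp1_inj LI2 (And4 Tm TmV e1 e2)).
- exact: (T3_comp2 HS Tq1 Tq2).
- exact: (T3_comp2 HS Tq3 Tq4).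
by rewrite -P1 (path12 o1) -P2; apply: path12.
Qed.
End GamAssoc.
End Monoidal.

(** * Actions in which the identity acts strictly trivially *)

Section Categories.
Variable C : Defs.cat.
Hypothesis hC : is_category C.

Lemma is_iso_cmp (x y z : ob C) a b : is_iso x y a -> is_iso y z b -> is_iso x z (cmp a b).
Proof.
move=> [a' [ha ha' e1 e2]] [b' [hb hb' e3 e4]]; exists (cmp b' a'); split.
- exact: (hom_cmp hC ha hb).
- exact: (hom_cmp hC hb' ha').
- by rewrite (cat_assoc hC (hom_cmp hC ha hb) hb' ha') -(cat_assoc hC ha hb hb') e3 (cat_idr hC ha).
by rewrite (cat_assoc hC (hom_cmp hC hb' ha') ha hb) -(cat_assoc hC hb' ha' ha) e2 (cat_idr hC hb').
Qed.

Lemma iso_cancell (x y z : ob C) a b c :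
  is_iso x y a -> ishom y z b -> ishom y z c -> cmp a b = cmp a c -> b = c.
Proof.
move=> [a' [ha ha' _ e]] hb hc E.
rewrite -(cat_idl hC hb) -e -(cat_assoc hC ha' ha hb) E.
by rewrite (cat_assoc hC ha' ha hc) e (cat_idl hC hc).
Qed.

Lemma iso_cancelr (x y z : ob C) a b c :
  is_iso y z a -> ishom x y b -> ishom x y c -> cmp b a = cmp c a -> b = c.
Proof.
move=> [a' [ha ha' e _]] hb hc E.
rewrite -(cat_idr hC hb) -e (cat_assoc hC hb ha ha') E.
by rewrite -(cat_assoc hC hc ha ha') e (cat_idr hC hc).
Qed.

Lemma is_iso_hom (x y : ob C) a : is_iso x y a -> ishom x y a.
Proof. by case=> b []. Qed.
End Categories.

Section Functors.
Variables (C D : Defs.cat) (F : ftor C D).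
Hypotheses (hC : is_category C) (hD : is_category D) (hF : is_functor F).

Lemma functor_iso (x y : ob C) a : is_iso x y a -> is_iso (fob F x) (fob F y) (far F a).
Proof.
move=> [b [ha hb e1 e2]]; exists (far F b).
have [ox oy] := hom_ob hC ha.
by split; rewrite -?(far_cmp hF ha hb) -?(far_cmp hF hb ha) ?e1 ?e2 ?(far_id hF) //;
  apply: (far_hom hF).
Qed.

Lemma functor_then (E : Defs.cat) (G : ftor D E) : is_functor G -> is_functor (fthen F G).
Proof.
move=> hG; split=> /= [x ox|x y a ha|x ox|x y z a b ha hb].
- by apply/(fob_ob hG)/(fob_ob hF).
- by apply/(far_hom hG)/(far_hom hF).
- by rewrite (far_id hF) // (far_id hG) //; apply: (fob_ob hF).
by rewrite (far_cmp hF ha hb) (far_cmp hG (far_hom hF ha) (far_hom hF hb)).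
Qed.
End Functors.

Section StrictlyUnital.
Variables (gT : finGroupType) (A : {group gT}).

(** Asks only for functors, with 1 acting as the identity on the nose, as it does on the traces by
    [psi2_1] and [psi3_1]. Equivalences and unit isomorphisms are then consequences. *)
Record strict_unital (C : Defs.cat) (X : cat_action gT C) : Prop := {
  su_cat : is_category C;
  su_fun g : g \in A -> is_functor (act_fun X g);
  su_gam h g : h \in A -> g \in A ->
    is_natiso (fthen (act_fun X g) (act_fun X h)) (act_fun X (h * g))
      (act_gam X h g);
  su_assoc k h g x : k \in A -> h \in A -> g \in A -> isob x ->
    cmp (far (act_fun X k) (act_gam X h g x)) (act_gam X k (h * g) x) =
    cmp (act_gam X k h (fob (act_fun X g) x)) (act_gam X (k * h) g x);
  su_ob1 x : isob x -> fob (act_fun X 1) x = x;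
  su_hom1 x y a : ishom x y a -> far (act_fun X 1) a = a
}.

(** The action of [g^-1] is quasi-inverse to that of [g] through the structure isomorphisms, because
    their target is the action of 1. The unit isomorphism is [act_gam X 1 1]. *)
Lemma strict_unital_action C (X : cat_action gT C) :
  strict_unital X -> is_cat_action A X.
Proof.
move=> [hC hF hG hA h1 h1'].
have o1 := group1 A.
have to_id h g : h \in A -> g \in A -> h * g = 1 ->
    is_natiso (fthen (act_fun X g) (act_fun X h)) (fid C) (act_gam X h g).
  move=> hh hg e; have [i n] := hG h g hh hg; rewrite e in i n; split.
    by move=> x ox; have := i x ox; rewrite h1.
  by move=> x y a ha; rewrite (n x y a ha) (h1' x y a ha).
split=> //.
- move=> g gA; split; first exact: hF.
  have gV : g^-1 \in A by rewrite groupV.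
  exists (act_fun X g^-1); split; first exact: hF.
  by split; [exists (act_gam X g^-1 g)|exists (act_gam X g g^-1)];
    apply: to_id; rewrite ?mulVg ?mulgV.
- (* Associativity at [(1, 1, g)] and [(g, 1, 1)] gives the unit laws. *)
  exists (act_gam X 1 1); split.
  + have [i n] := to_id 1 1 o1 o1 (mulg1 1); split.
      by move=> x ox; have := i x ox; rewrite /= h1 ?h1 //.
    by move=> x y a ha; have := n x y a ha; rewrite /= !(h1' x y a ha).
  + move=> g x gA ox.
    have ogx : isob (fob (act_fun X g) x) by apply: (fob_ob (hF g gA)).
    have [i1 n1] := hG 1 g o1 gA; have [i2 n2] := hG 1 1 o1 o1.
    have I1 := i1 x ox; have I2 := i2 _ ogx; rewrite /= ?mul1g ?mulg1 in I1 I2.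
    rewrite (h1 _ ogx) in I1. rewrite !(h1 _ ogx) in I2.
    have := hA 1 1 g x o1 o1 gA ox; rewrite !mul1g ?mulg1.
    have H1 := is_iso_hom I1. rewrite (h1' _ _ _ H1).
    by apply: (iso_cancelr hC I1); [exact: is_iso_hom I1|exact: is_iso_hom I2].
  + move=> g x gA ox.
    have ogx : isob (fob (act_fun X g) x) by apply: (fob_ob (hF g gA)).
    have [i1 n1] := hG g 1 gA o1; have [i2 n2] := hG 1 1 o1 o1.
    have I1 := i1 x ox; have I2 := i2 _ ox; rewrite /= ?mul1g ?mulg1 in I1 I2.
    rewrite (h1 _ ox) in I1. rewrite !(h1 _ ox) in I2.
    have := hA g 1 1 x gA o1 o1 ox; rewrite ?mul1g ?mulg1 h1 //.
    have H2 := far_hom (hF g gA) (is_iso_hom I2).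
    by move=> E; apply: esym; apply: (iso_cancelr hC I1 _ _ E); [exact: H2|exact: is_iso_hom I1].
Qed.

(** [pre_equivalent] omits the compatibility of [action_equivalent] with the
    unit isomorphisms, which is automatic. *)
Definition pre_equivalent (C D : Defs.cat) (X : cat_action gT C) (Y : cat_action gT D) :=
  exists (F : ftor C D) (t : gT -> ob C -> ar D),
  [/\ is_equivalence F,
      forall g, g \in A ->
        is_natiso (fthen (act_fun X g) F) (fthen F (act_fun Y g)) (t g) &
      forall h g x, h \in A -> g \in A -> isob x ->
        cmp (far F (act_gam X h g x)) (t (h * g) x) =
        cmp (cmp (t h (fob (act_fun X g) x)) (far (act_fun Y h) (t g x)))
            (act_gam Y h g (fob F x))].

(** Compatibility with the structure isomorphisms at [h = g = 1], together with the unit laws, gives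
    the claim at objects of the form [psi_1 y] ([key]). Naturality along the isomorphism [i x] from
    [psi_1 x] to [x] extends it to all objects. *)
Lemma pre_equivalentP C D (X : cat_action gT C) (Y : cat_action gT D) :
  is_cat_action A X -> is_cat_action A Y -> pre_equivalent X Y ->
  action_equivalent A X Y.
Proof.
move=> [hC hXe hXg _ _] [hD hYe hYg _ _] [F [t [hF ht hc]]].
exists F, t; split=> // i j [[ii ni] i1 i2] [[ij nj] j1 j2] x ox.
have o1 := group1 A. have [fF _] := hF.
have [fX _] := hXe 1 o1; have [fY _] := hYe 1 o1.
have [it nt] := ht 1 o1.
have key y : isob y -> far F (i (fob (act_fun X 1) y)) =
   cmp (t 1 (fob (act_fun X 1) y)) (j (fob F (fob (act_fun X 1) y))).
  move=> oy. have oy1 := fob_ob fX oy. have oFy := fob_ob fF oy.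
  have := hc 1 1 y o1 o1 oy; rewrite mulg1 i1 // j1 //.
  have T1 := it y oy; rewrite /= in T1.
  have T2 := it _ oy1; rewrite /= in T2.
  have J1 := ij _ (fob_ob fF oy1); rewrite /= in J1.
  have J2 := ij _ (fob_ob fY oFy); rewrite /= in J2.
  have I1 := ii _ oy1; rewrite /= in I1.
  have e := nj _ _ _ (is_iso_hom T1); rewrite /= in e.
  have T1' := far_hom fY (is_iso_hom T1).
  rewrite -(cat_assoc hD (is_iso_hom T2) T1' (is_iso_hom J2)) e.
  rewrite (cat_assoc hD (is_iso_hom T2) (is_iso_hom J1) (is_iso_hom T1)).
  apply: (iso_cancelr hD T1).
    exact: (far_hom fF (is_iso_hom I1)).
  exact: (hom_cmp hD (is_iso_hom T2) (is_iso_hom J1)).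
have I := ii _ ox; rewrite /= in I. have hI := is_iso_hom I.
have ox1 := fob_ob fX ox.
have XI := functor_iso hC fX I.
have FXI := functor_iso hC fF XI.
have I1 := ii _ ox1; rewrite /= in I1.
have T := it _ ox; have T' := it _ ox1; rewrite /= in T T'.
have J := ij _ (fob_ob fF ox); have J' := ij _ (fob_ob fF ox1); rewrite /= in J J'.
apply: (iso_cancell hD FXI).
- exact: (far_hom fF (is_iso_hom I)).
- exact: (hom_cmp hD (is_iso_hom T) (is_iso_hom J)).
have e1 := ni _ _ _ hI; have e2 := nt _ _ _ hI; rewrite /= in e1 e2.
have e3 := nj _ _ _ (far_hom fF hI); rewrite /= in e3.
rewrite -(far_cmp fF (is_iso_hom XI) hI) e1 (far_cmp fF (is_iso_hom I1) hI).
rewrite key // (cat_assoc hD (is_iso_hom FXI) (is_iso_hom T) (is_iso_hom J)) e2.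
rewrite -(cat_assoc hD (is_iso_hom T') (far_hom fY (far_hom fF hI)) (is_iso_hom J)) e3.
by rewrite (cat_assoc hD (is_iso_hom T') (is_iso_hom J') (far_hom fF hI)).
Qed.

(** A strict isomorphism of actions, in a form that also determines all the
    operations of [X] from those of [Y]. *)
Record strict_iso (C D : Defs.cat) (X : cat_action gT C) (Y : cat_action gT D)
    (U : ftor C D) (V : ftor D C) : Prop := {
  si_ob x : isob x -> isob (fob U x);
  si_hom x y a : ishom x y a -> ishom (fob U x) (fob U y) (far U a);
  si_obV x : isob x -> isob (fob V x);
  si_homV x y a : ishom x y a -> ishom (fob V x) (fob V y) (far V a);
  si_obK x : isob x -> fob V (fob U x) = x;
  si_homK x y a : ishom x y a -> far V (far U a) = a;
  si_obVK x : isob x -> fob U (fob V x) = x;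
  si_homVK x y a : ishom x y a -> far U (far V a) = a;
  si_hom_ob (x y : ob C) a : ishom x y a -> isob x /\ isob y;
  si_id (x : ob C) : isob x -> idm x = far V (idm (fob U x));
  si_cmp (x y z : ob C) a b : ishom x y a -> ishom y z b ->
    cmp a b = far V (cmp (far U a) (far U b));
  si_act g x : g \in A -> isob x ->
    fob (act_fun X g) x = fob V (fob (act_fun Y g) (fob U x));
  si_far g (x y : ob C) a : g \in A -> ishom x y a ->
    far (act_fun X g) a = far V (far (act_fun Y g) (far U a));
  si_gam h g x : h \in A -> g \in A -> isob x ->
    act_gam X h g x = far V (act_gam Y h g (fob U x))
}.

(** * Transport of structure along a strict isomorphism *)

Section StrictIso.
Variables (C D : Defs.cat) (X : cat_action gT C) (Y : cat_action gT D).
Variables (U : ftor C D) (V : ftor D C).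
Hypotheses (hUV : strict_iso X Y U V) (hY : strict_unital Y).
Let hD := su_cat hY.

Lemma strict_iso_cat : is_category C.
Proof.
have cV (x y z : ob C) a b : ishom x y a -> ishom y z b -> ishom x z (cmp a b).
  move=> ha hb; rewrite (si_cmp hUV ha hb).
  have [ox oy] := si_hom_ob hUV ha; have [_ oz] := si_hom_ob hUV hb.
  rewrite -(si_obK hUV ox) -(si_obK hUV oz); apply: (si_homV hUV).
  exact: (hom_cmp hD (si_hom hUV ha) (si_hom hUV hb)).
have iV (x : ob C) : isob x -> ishom x x (idm x).
  move=> ox; rewrite (si_id hUV ox) -{1 2}(si_obK hUV ox).
  by apply/(si_homV hUV)/(hom_id hD)/(si_ob hUV).
have UC (x y z : ob C) a b : ishom x y a -> ishom y z b ->
    far U (cmp a b) = cmp (far U a) (far U b).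
  move=> ha hb; rewrite (si_cmp hUV ha hb).
  exact: (si_homVK hUV (hom_cmp hD (si_hom hUV ha) (si_hom hUV hb))).
have UI (x : ob C) : isob x -> far U (idm x) = idm (fob U x).
  move=> ox; rewrite (si_id hUV ox).
  exact: (si_homVK hUV (hom_id hD (si_ob hUV ox))).
split=> //.
- exact: si_hom_ob hUV.
- move=> w x y z a b c ha hb hc.
  rewrite (si_cmp hUV ha (cV _ _ _ _ _ hb hc)) (si_cmp hUV (cV _ _ _ _ _ ha hb) hc).
  by rewrite (UC _ _ _ _ _ hb hc) (UC _ _ _ _ _ ha hb)
    (cat_assoc hD (si_hom hUV ha) (si_hom hUV hb) (si_hom hUV hc)).
- move=> x y a ha; have [ox oy] := si_hom_ob hUV ha.
  by rewrite (si_cmp hUV (iV _ ox) ha) UI // (cat_idl hD (si_hom hUV ha)) (si_homK hUV ha).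
- move=> x y a ha; have [ox oy] := si_hom_ob hUV ha.
  by rewrite (si_cmp hUV ha (iV _ oy)) UI // (cat_idr hD (si_hom hUV ha)) (si_homK hUV ha).
Qed.

Lemma strict_iso_functor : is_functor U.
Proof.
split; [exact: si_ob hUV|exact: si_hom hUV| |].
  move=> x ox; rewrite (si_id hUV ox).
  exact: (si_homVK hUV (hom_id hD (si_ob hUV ox))).
move=> x y z a b ha hb; rewrite (si_cmp hUV ha hb).
exact: (si_homVK hUV (hom_cmp hD (si_hom hUV ha) (si_hom hUV hb))).
Qed.

Lemma strict_iso_functorV : is_functor V.
Proof.
split; [exact: si_obV hUV|exact: si_homV hUV| |].
  by move=> x ox; rewrite (si_id hUV (si_obV hUV ox)) (si_obVK hUV ox).
move=> x y z a b ha hb.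
by rewrite (si_cmp hUV (si_homV hUV ha) (si_homV hUV hb)) !(si_homVK hUV ha, si_homVK hUV hb).
Qed.

Let fU := strict_iso_functor.
Let fV := strict_iso_functorV.
Let hC := strict_iso_cat.

Lemma strict_iso_U g (x : ob C) : g \in A -> isob x ->
  fob U (fob (act_fun X g) x) = fob (act_fun Y g) (fob U x).
Proof.
move=> gA ox; rewrite (si_act hUV gA ox) (si_obVK hUV) //.
by apply/(fob_ob (su_fun hY gA))/(si_ob hUV).
Qed.

Lemma strict_iso_Uhom g (x y : ob C) a : g \in A -> ishom x y a ->
  far U (far (act_fun X g) a) = far (act_fun Y g) (far U a).
Proof.
move=> gA ha; rewrite (si_far hUV gA ha).
exact: (si_homVK hUV (far_hom (su_fun hY gA) (si_hom hUV ha))).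
Qed.

Lemma strict_iso_Ugam h g (x : ob C) : h \in A -> g \in A -> isob x ->
  far U (act_gam X h g x) = act_gam Y h g (fob U x).
Proof.
move=> hA gA ox; rewrite (si_gam hUV hA gA ox).
have [i _] := su_gam hY hA gA; have := i _ (si_ob hUV ox).
by move/is_iso_hom/(si_homVK hUV).
Qed.

Lemma strict_iso_unital : strict_unital X.
Proof.
have aX g (x : ob C) : g \in A -> isob x -> isob (fob (act_fun X g) x).
  move=> gA ox; rewrite (si_act hUV gA ox).
  by apply/(si_obV hUV)/(fob_ob (su_fun hY gA))/(si_ob hUV).
have aXh g (x y : ob C) a : g \in A -> ishom x y a ->
    ishom (fob (act_fun X g) x) (fob (act_fun X g) y) (far (act_fun X g) a).
  move=> gA ha; have [ox oy] := si_hom_ob hUV ha.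
  rewrite (si_act hUV gA ox) (si_act hUV gA oy) (si_far hUV gA ha).
  by apply/(si_homV hUV)/(far_hom (su_fun hY gA))/(si_hom hUV).
have gX h g (x : ob C) : h \in A -> g \in A -> isob x ->
    is_iso (fob (act_fun X h) (fob (act_fun X g) x)) (fob (act_fun X (h * g)) x)
      (act_gam X h g x).
  move=> hA gA ox; rewrite (si_act hUV (groupM hA gA) ox) (si_act hUV hA (aX _ _ gA ox)).
  rewrite strict_iso_U // (si_gam hUV hA gA ox); apply: (functor_iso hD fV).
  have [i _] := su_gam hY hA gA; exact: (i _ (si_ob hUV ox)).
split.
- exact: hC.
- move=> g gA; split.
  + by move=> x; apply: aX.
  + by move=> x y a; apply: aXh.
  + move=> x ox; rewrite (si_far hUV gA (hom_id hC ox)) (far_id fU ox).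
    rewrite (far_id (su_fun hY gA)) ?(si_act hUV gA ox); last exact: (si_ob hUV).
    rewrite (far_id fV) //.
    by apply/(fob_ob (su_fun hY gA))/(si_ob hUV).
  + move=> x y z a b ha hb; rewrite (si_far hUV gA (hom_cmp hC ha hb)).
    rewrite (far_cmp fU ha hb) (far_cmp (su_fun hY gA) (si_hom hUV ha) (si_hom hUV hb)).
    rewrite (si_cmp hUV (aXh _ _ _ _ gA ha) (aXh _ _ _ _ gA hb)).
    by rewrite (strict_iso_Uhom gA ha) (strict_iso_Uhom gA hb).
- move=> h g hA gA; split; first by move=> x ox; exact: gX.
  move=> x y a ha; have [ox oy] := si_hom_ob hUV ha.
  have hga := aXh _ _ _ _ hA (aXh _ _ _ _ gA ha).
  rewrite /= (si_cmp hUV hga (is_iso_hom (gX _ _ _ hA gA oy))).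
  rewrite (si_cmp hUV (is_iso_hom (gX _ _ _ hA gA ox)) (aXh _ _ _ _ (groupM hA gA) ha)).
  rewrite !strict_iso_Ugam // (strict_iso_Uhom hA (aXh _ _ _ _ gA ha)).
  rewrite (strict_iso_Uhom gA ha) (strict_iso_Uhom (groupM hA gA) ha).
  have [_ n] := su_gam hY hA gA; congr (far V _); exact: (n _ _ _ (si_hom hUV ha)).
- move=> k h g x kA hA gA ox.
  have gx := aX _ _ gA ox. have hg := groupM hA gA; have kh := groupM kA hA.
  have G1 := is_iso_hom (gX _ _ _ hA gA ox).
  have G2 := is_iso_hom (gX _ _ _ kA hg ox).
  have G3 := is_iso_hom (gX _ _ _ kA hA gx).
  have G4 := is_iso_hom (gX _ _ _ kh gA ox).
  rewrite (si_cmp hUV (aXh _ _ _ _ kA G1) G2) (si_cmp hUV G3 G4).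
  rewrite (strict_iso_Uhom kA G1) !strict_iso_Ugam // strict_iso_U //.
  congr (far V _); apply: (su_assoc hY) => //; exact: (si_ob hUV).
- move=> x ox; rewrite (si_act hUV (group1 A) ox) (su_ob1 hY).
    exact: (si_obK hUV).
  exact: (si_ob hUV).
- move=> x y a ha; rewrite (si_far hUV (group1 A) ha) (su_hom1 hY (si_hom hUV ha)).
  exact: (si_homK hUV ha).
Qed.
End StrictIso.

Lemma pre_equivalent_transport (C D C' D' : Defs.cat)
  (X : cat_action gT C) (Y : cat_action gT D) U V
  (X' : cat_action gT C') (Y' : cat_action gT D') U' V' :
  strict_iso X Y U V -> strict_iso X' Y' U' V' ->
  strict_unital Y -> strict_unital Y' ->
  pre_equivalent Y Y' -> pre_equivalent X X'.
Proof.
move=> si si' hY hY' [F [t [[fF [G [fG [[s hs] [s' hs']]]]] ht hc]]].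
have hD := su_cat hY; have hD' := su_cat hY'.
have fU := strict_iso_functor si hY; have fV := strict_iso_functorV si.
have fU' := strict_iso_functor si' hY'; have fV' := strict_iso_functorV si'.
exists (fthen (fthen U F) V'), (fun g x => far V' (t g (fob U x))).
have fF' : is_functor (fthen (fthen U F) V').
  by apply: functor_then => //; apply: functor_then.
split.
- split=> //; exists (fthen (fthen U' G) V); split.
    by apply: functor_then => //; apply: functor_then.
  split.
    exists (fun x => far V (s (fob U x))).
    have [i n] := hs; split=> /= [x ox|x y a ha].
      have oUx := si_ob si ox.
      rewrite (si_obVK si' (fob_ob fF oUx)) -[X in is_iso _ X _](si_obK si ox).
      by apply: (functor_iso hD fV); exact: i.
    have [ox oy] := si_hom_ob si ha.
    have ha' := si_hom si ha. have hFa := far_hom fF ha'.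
    rewrite (si_homVK si' hFa) -[X in _ = cmp _ X](si_homK si ha).
    have hGFa := far_hom fG hFa.
    have I1 := is_iso_hom (i _ (si_ob si oy)); have I2 := is_iso_hom (i _ (si_ob si ox)).
    rewrite -(far_cmp fV hGFa I1) -(far_cmp fV I2 ha').
    congr (far V _); exact: (n _ _ _ ha').
  exists (fun x => far V' (s' (fob U' x))).
  have [i n] := hs'; split=> /= [x ox|x y a ha].
    have oUx := si_ob si' ox.
    rewrite (si_obVK si (fob_ob fG oUx)) -[X in is_iso _ X _](si_obK si' ox).
    by apply: (functor_iso hD' fV'); exact: i.
  have [ox oy] := si_hom_ob si' ha.
  have ha' := si_hom si' ha. have hFa := far_hom fG ha'.
  rewrite (si_homVK si hFa) -[X in _ = cmp _ X](si_homK si' ha).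
  have hGFa := far_hom fF hFa.
  have I1 := is_iso_hom (i _ (si_ob si' oy)); have I2 := is_iso_hom (i _ (si_ob si' ox)).
  rewrite -(far_cmp fV' hGFa I1) -(far_cmp fV' I2 ha').
  congr (far V' _); exact: (n _ _ _ ha').
- move=> g gA; have [i n] := ht g gA; split=> /= [x ox|x y a ha].
    have oUx := si_ob si ox. have oFUx := fob_ob fF oUx.
    rewrite (strict_iso_U si hY gA ox) (si_act si' gA (si_obV si' oFUx)) (si_obVK si' oFUx).
    by apply: (functor_iso hD' fV'); exact: i.
  have [ox oy] := si_hom_ob si ha.
  have ha' := si_hom si ha. have hFa := far_hom fF ha'.
  rewrite (strict_iso_Uhom si hY gA ha) (si_far si' gA (si_homV si' hFa)) (si_homVK si' hFa).
  have I1 := is_iso_hom (i _ (si_ob si oy)); have I2 := is_iso_hom (i _ (si_ob si ox)).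
  have h1 := far_hom fF (far_hom (su_fun hY gA) ha').
  have h2 := far_hom (su_fun hY' gA) hFa.
  rewrite -(far_cmp fV' h1 I1) -(far_cmp fV' I2 h2).
  congr (far V' _); exact: (n _ _ _ ha').
move=> h g x hA gA ox /=.
have oUx := si_ob si ox. have oFUx := fob_ob fF oUx.
have [ih nh] := ht h hA; have [ig ng] := ht g gA.
have [ihg nhg] := ht _ (groupM hA gA).
have [iG _] := su_gam hY hA gA; have [iG' _] := su_gam hY' hA gA.
have ogx := fob_ob (su_fun hY gA) oUx.
have G1 := far_hom fF (is_iso_hom (iG _ oUx)).
have G2 := is_iso_hom (ihg _ oUx).
have G3 := is_iso_hom (ih _ ogx).
have G4 := is_iso_hom (ig _ oUx).
have G4' := far_hom (su_fun hY' hA) G4.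
have G5 := is_iso_hom (iG' _ oFUx).
rewrite (strict_iso_Ugam si hY hA gA ox) (strict_iso_U si hY gA ox).
rewrite (si_far si' hA (si_homV si' G4)) (si_homVK si' G4).
rewrite (si_gam si' hA gA (si_obV si' oFUx)) (si_obVK si' oFUx).
rewrite -(far_cmp fV' G1 G2) -(far_cmp fV' G3 G4').
rewrite -(far_cmp fV' (hom_cmp hD' G3 G4') G5).
by congr (far V' _); apply: hc.
Qed.
End StrictlyUnital.

(** * Actions on families of traces *)

Section Families.
Variables (gT : finGroupType) (S : sig3) (HS : is_strict3 S).
Variables (H : {group gT}) (X : rep3 gT S) (HX : is_rep3 H X).
Local Notation r := (rho X).

(** The #_2-inverse of [Gam], chosen as a function because [T3_Gam] only asserts its existence and
    it enters the components of natural transformations. *)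
Definition GamI f h g x : C3 S :=
  epsilon (inhabits (Gam X f h g x)) (fun b =>
    is_3iso one1 (r (h * g * f * (h * g)^-1))
      (psi2 X (g * f * g^-1) h (psi2 X f g x)) (psi2 X f (h * g) x)
      (Gam X f h g x) b).

Lemma Gam_iso f h g x F : f \in H -> h \in H -> g \in H -> T2 one1 (r f) x ->
  h * g * f * (h * g)^-1 = F ->
  is_3iso one1 (r F) (psi2 X (g * f * g^-1) h (psi2 X f g x)) (psi2 X f (h * g) x)
    (Gam X f h g x) (GamI f h g x).
Proof. move=> fH hH gH Tx <-. exact: (epsilon_spec _ _ (T3_Gam HS HX hH gH fH Tx)). Qed.

Lemma trace_category f : f \in H -> is_category (trace_cat X f).
Proof.
move=> fH; split=> /=.
- by move=> x y a /(T3_T2 HS).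
- by move=> x /(T3_id3 HS).
- by move=> x y z a b; apply: (T3_comp2 HS).
- by move=> w x y z a b c; apply: (comp2A HS).
- by move=> x y a /(comp2idl HS).
- by move=> x y a /(comp2idr HS).
Qed.

Lemma conjH f g : f \in H -> g \in H -> g * f * g^-1 \in H.
Proof. by move=> *; rewrite !groupM ?groupV. Qed.

Lemma T2_psiF f g F x : f \in H -> g \in H -> T2 one1 (r f) x -> g * f * g^-1 = F ->
  T2 one1 (r F) (psi2 X f g x).
Proof. by move=> fH gH Tx <-; apply: (T2_psi HS HX fH gH Tx). Qed.

Lemma T3_psiF f g F x y a : f \in H -> g \in H -> T3 one1 (r f) x y a -> g * f * g^-1 = F ->
  T3 one1 (r F) (psi2 X f g x) (psi2 X f g y) (psi3 X f g a).
Proof. by move=> fH gH Ta <-; apply: (T3_psi3 HS HX fH gH Ta). Qed.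

Lemma psi_GamI f h g k F x : f \in H -> h \in H -> g \in H -> k \in H ->
  T2 one1 (r f) x -> h * g * f * (h * g)^-1 = F ->
  psi3 X F k (GamI f h g x) #2 psi3 X F k (Gam X f h g x) =
  id3 (psi2 X F k (psi2 X f (h * g) x)).
Proof.
move=> fH hH gH kH Tx eF; have FH : F \in H by rewrite -eF conjH ?groupM.
have [T1 T2 _ e] := Gam_iso fH hH gH Tx eF.
rewrite -(psi3_cmp HS HX FH kH T2 T1) e (psi3_id HS HX) //.
by have [] := T3_T2 HS T2.
Qed.

(** The diagram chase of [Gam_transfer], in an arbitrary category: [e1], [e2] and [e3] stand for
    three instances of associativity, and [k], [w] and [y2] are the arrows that are inverted. *)
Lemma square_paste (C : Defs.cat) (o1 o2 o3 o4 o5 o6 o7 o8 : ob C)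
    (p q u v k kI w wI y z y2 y2I t : ar C) : is_category C ->
  ishom o1 o4 p -> ishom o4 o3 q -> ishom o1 o2 u -> ishom o2 o3 v ->
  cmp p q = cmp u v ->
  ishom o8 o3 k -> ishom o3 o8 kI -> cmp k kI = idm o8 ->
  ishom o5 o2 w -> ishom o2 o5 wI -> cmp wI w = idm o2 ->
  ishom o5 o6 y -> ishom o6 o3 z -> cmp y z = cmp w v ->
  ishom o7 o6 y2 -> ishom o6 o7 y2I -> cmp y2I y2 = idm o6 ->
  ishom o7 o8 t -> cmp y2 z = cmp t k ->
  cmp p (cmp q kI) = cmp (cmp (cmp u wI) (cmp y y2I)) t.
Proof.
move=> hC hp hq hu hv e1 hk hkI ek hw hwI ew hy hz e2 hy2 hy2I ey ht e3.
have -> : t = cmp y2 (cmp z kI).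
  by rewrite (cat_assoc hC hy2 hz hkI) e3 -(cat_assoc hC ht hk hkI) ek (cat_idr hC ht).
have hzk := hom_cmp hC hz hkI; have huw := hom_cmp hC hu hwI.
rewrite -(cat_assoc hC huw (hom_cmp hC hy hy2I) (hom_cmp hC hy2 hzk)).
rewrite -(cat_assoc hC hy hy2I (hom_cmp hC hy2 hzk)) (cat_assoc hC hy2I hy2 hzk) ey.
rewrite (cat_idl hC hzk) (cat_assoc hC hy hz hkI) e2 -(cat_assoc hC hw hv hkI).
have hvk := hom_cmp hC hv hkI.
rewrite -(cat_assoc hC hu hwI (hom_cmp hC hw hvk)) (cat_assoc hC hwI hw hvk) ew.
by rewrite (cat_idl hC hvk) (cat_assoc hC hp hq hkI) e1 -(cat_assoc hC hu hv hkI).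
Qed.

Lemma natural_paste (C : Defs.cat) (x1 x2 x3 y1 y2 y3 : ob C)
    (p gx q gy hx hxI t hy hyI : ar C) : is_category C ->
  ishom x1 y1 p -> ishom x1 x2 gx -> ishom x2 y2 q -> ishom y1 y2 gy ->
  ishom x3 x2 hx -> ishom x2 x3 hxI -> cmp hxI hx = idm x2 ->
  ishom x3 y3 t -> ishom y3 y2 hy -> ishom y2 y3 hyI -> cmp hy hyI = idm y3 ->
  cmp p gy = cmp gx q -> cmp t hy = cmp hx q ->
  cmp p (cmp gy hyI) = cmp (cmp gx hxI) t.
Proof.
move=> hC hp hgx hq hgy hhx hhxI ex ht hhy hhyI ey e1 e2.
have -> : t = cmp hx (cmp q hyI).
  by rewrite (cat_assoc hC hhx hq hhyI) -e2 -(cat_assoc hC ht hhy hhyI) ey (cat_idr hC ht).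
have hqI := hom_cmp hC hq hhyI.
rewrite -(cat_assoc hC hgx hhxI (hom_cmp hC hhx hqI)) (cat_assoc hC hhxI hhx hqI) ex.
rewrite (cat_idl hC hqI) (cat_assoc hC hp hgy hhyI) e1.
by rewrite -(cat_assoc hC hgx hq hhyI).
Qed.

(** The compatibility of a change of cocycle with the structure isomorphisms, at a single index. It
    pastes associativity at [(s, a, b)], [(a', s', b)] and [(a', b', s'')], whose products agree by
    [e1] and [e2]. *)
Lemma Gam_transfer f s s' s'' a b a' b' x : f \in H ->
  [/\ s \in H, s' \in H & s'' \in H] -> [/\ a \in H, b \in H, a' \in H & b' \in H] ->
  s * a = a' * s' -> s' * b = b' * s'' -> T2 one1 (r f) x ->
  psi3 X (a * b * f * (a * b)^-1) s (Gam X f a b x)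
    #2 (Gam X f s (a * b) x #2 GamI f (a' * b') s'' x) =
  Gam X (b * f * b^-1) s a (psi2 X f b x) #2 GamI (b * f * b^-1) a' s' (psi2 X f b x)
    #2 psi3 X (s' * b * f * (s' * b)^-1) a' (Gam X f s' b x #2 GamI f b' s'' x)
    #2 Gam X (s'' * f * s''^-1) a' b' (psi2 X f s'' x).
Proof.
move=> fH [sH s'H s''H] [aH bH a'H b'H] e1 e2 Tx.
(* All objects of the diagram lie in the trace at [F], and [F'] is the degree to which [psi_a'] is
   applied. The equations reconcile the different expressions for these degrees. *)
pose F : gT := s * a * b * f * (s * a * b)^-1.
pose F' : gT := s' * b * f * (s' * b)^-1.
have E0 : s * (a * b * f * (a * b)^-1) * s^-1 = F by rewrite /F !invMg !mulgA.
have E1 : a' * F' * a'^-1 = F by rewrite /F /F' e1 !invMg !mulgA.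
have E2 : s * (a * b) * f * (s * (a * b))^-1 = F by rewrite !mulgA.
have E3 : a' * b' * s'' * f * (a' * b' * s'')^-1 = F.
  by rewrite /F e1 -(mulgA a' s') e2 !mulgA.
have E4 : s * a * (b * f * b^-1) * (s * a)^-1 = F by rewrite /F !invMg !mulgA.
have E5 : a' * s' * (b * f * b^-1) * (a' * s')^-1 = F by rewrite -e1.
have E6 : b' * s'' * f * (b' * s'')^-1 = F' by rewrite /F' e2.
have E7 : a' * b' * (s'' * f * s''^-1) * (a' * b')^-1 = F.
  by rewrite -E3 !invMg !mulgA.
have E8 : a' * (s' * b) * f * (a' * (s' * b))^-1 = F by rewrite /F e1 !mulgA.
have E9 : s * a * b * f * (s * a * b)^-1 = F by [].
have E10 : s' * b * f * (s' * b)^-1 = F' by [].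
have FH : F \in H by rewrite /F conjH ?groupM.
have F'H : F' \in H by rewrite /F' conjH ?groupM.
have hC := trace_category FH.
have cH := conjH fH bH; have c''H := conjH fH s''H.
have Tb := T2_psiF fH bH Tx erefl; have Ts'' := T2_psiF fH s''H Tx erefl.
have [Gab _ _ _] := Gam_iso fH aH bH Tx erefl.
have A1 := Gam_assoc HS HX sH aH bH fH Tx.
have A2 := Gam_assoc HS HX a'H s'H bH fH Tx; rewrite E10 in A2.
have A3 := Gam_assoc HS HX a'H b'H s''H fH Tx; rewrite E6 in A3.
have A4 := psi_GamI fH b'H s''H a'H Tx E6.
have h1 := T3_psiF (conjH fH (groupM aH bH)) sH Gab E0.
have [h2 _ _ _] := Gam_iso fH sH (groupM aH bH) Tx E2.
have K := Gam_iso fH (groupM a'H b'H) s''H Tx E3.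
have [h3 _ _ _] := Gam_iso cH sH aH Tb E4.
have [h4 h4' _ e4] := Gam_iso cH a'H s'H Tb E5.
have [h5 _ _ _] := Gam_iso fH (groupM sH aH) bH Tx E9.
have [g1 _ _ _] := Gam_iso fH s'H bH Tx E10.
have [g2 g2' _ _] := Gam_iso fH b'H s''H Tx E6.
have h6 := T3_psiF F'H a'H g1 E1.
have h7 := T3_psiF F'H a'H g2 E1.
have h7' := T3_psiF F'H a'H g2' E1.
have [h8 _ _ _] := Gam_iso c''H a'H b'H Ts'' E7.
have [h9 _ _ _] := Gam_iso fH a'H (groupM s'H bH) Tx E8.
have E11 : s' * (b * f * b^-1) * s'^-1 = F' by rewrite /F' invMg !mulgA.
have E12 : b' * (s'' * f * s''^-1) * b'^-1 = F' by rewrite -E6 invMg !mulgA.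
have E13 : a * (b * f * b^-1) * a^-1 = a * b * f * (a * b)^-1 by rewrite invMg !mulgA.
rewrite E11 in h4 h4' e4; rewrite E13 in h3; rewrite E12 in h8; rewrite E10.

rewrite E10 in h9.
rewrite -(mulgA a' b' s'') -e2 in K; rewrite -e2 in h7 h7' g2' A3 A4.
rewrite (mulgA a' s' b) -e1 in h9; rewrite (mulgA s a b) in h2.
rewrite (mulgA a' s' b) -e1 in K; rewrite -e1 in h4 h4' e4 A2.
have [k k' e7 _] := K.
rewrite (psi3_cmp HS HX F'H a'H g1 g2').
exact: (square_paste hC h1 h2 h3 h5 A1 k k' e7 h4 h4' e4 h6 h9 A2 h7 h7' A4 h8 A3).
Qed.

(** * Families of traces over an index set with a cocycle *)

Section Family.
Variable A : {group gT}.

(** [A] acts on the index type [J] on the left through [j |-> sg g^-1 j], and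
    [e] is a cocycle with values in [H] relating the conjugating elements. *)
Record is_index (J : Type) (fm : J -> gT) (sg : gT -> J -> J)
    (e : gT -> J -> gT) : Prop := {
  ix_fm j : fm j \in H;
  ix_e g j : g \in A -> e g j \in H;
  ix_conj g j : g \in A -> e g j * fm (sg g j) * (e g j)^-1 = fm j;
  ix_sgM h g j : h \in A -> g \in A -> sg (h * g) j = sg g (sg h j);
  ix_eM h g j : h \in A -> g \in A -> e (h * g) j = e h j * e g (sg h j);
  ix_sg1 j : sg 1 j = j;
  ix_e1 j : e 1 j = 1
}.

(* With [J] the fixed points of [f] on the cosets this is the trace of the
   induced representation; with [J] the pairs of a representative [h i] and a
   coset of its centralizer it is the sum of the induced actions. *)
Definition fam_cat (J : Type) (fm : J -> gT) : Defs.cat := {|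
  ob := J -> C2 S; isob := fun x => forall j, T2 one1 (r (fm j)) (x j);
  ar := J -> C3 S;
  ishom := fun x y a => forall j, T3 one1 (r (fm j)) (x j) (y j) (a j);
  idm := fun x j => id3 (x j);
  cmp := fun a b j => a j #2 b j |}.

Definition fam_action (J : Type) (fm : J -> gT) (sg : gT -> J -> J)
    (e : gT -> J -> gT) : cat_action gT (fam_cat fm) :=
  @Defs.Action gT (fam_cat fm)
    (fun g => @Ftor (fam_cat fm) (fam_cat fm)
      (fun x j => psi2 X (fm (sg g j)) (e g j) (x (sg g j)))
      (fun a j => psi3 X (fm (sg g j)) (e g j) (a (sg g j))))
    (fun h g x j => Gam X (fm (sg g (sg h j))) (e h j) (e g (sg h j))
      (x (sg g (sg h j)))).

Lemma fam_category (J : Type) (fm : J -> gT) : (forall j, fm j \in H) ->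
  is_category (fam_cat fm).
Proof.
move=> fH; split=> /=.
- by move=> x y a ha; split=> j; have [] := T3_T2 HS (ha j).
- by move=> x ox j; apply: (T3_id3 HS).
- by move=> x y z a b ha hb j; apply: (T3_comp2 HS (ha j) (hb j)).
- move=> w x y z a b c ha hb hc; apply: functional_extensionality => j.
  exact: (comp2A HS (ha j) (hb j) (hc j)).
- move=> x y a ha; apply: functional_extensionality => j.
  exact: (comp2idl HS (ha j)).
move=> x y a ha; apply: functional_extensionality => j.
exact: (comp2idr HS (ha j)).
Qed.

Lemma fam_iso (J : Type) (fm : J -> gT) (x y : ob (fam_cat fm)) (a b : ar (fam_cat fm)) :
  (forall j, is_3iso one1 (r (fm j)) (x j) (y j) (a j) (b j)) -> is_iso x y a.
Proof.
move=> h; exists b; split=> [j|j||]; try by case: (h j).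
  by apply: functional_extensionality => j; case: (h j).
by apply: functional_extensionality => j; case: (h j).
Qed.

Lemma fam_unital (J : Type) (fm : J -> gT) sg e : is_index fm sg e ->
  strict_unital A (fam_action fm sg e).
Proof.
case=> fH eH ec sM eM s1 e1.
have hC := fam_category fH.
split=> //.
- move=> g gA; split=> /= [x ox j|x y a ha j|x ox|x y z a b ha hb].
  + by rewrite -(ec g j gA); apply: (T2_psi HS HX); auto.
  + by rewrite -(ec g j gA); apply: (T3_psi3 HS HX); auto.
  + by apply: functional_extensionality => j; apply: (psi3_id HS HX); auto.
  apply: functional_extensionality => j.
  exact: (psi3_cmp HS HX (fH _) (eH _ _ gA) (ha _) (hb _)).
- move=> h g hA gA; split=> /= [x ox|x y a ha].
    apply: (@fam_iso _ _ _ _ _ (fun j => GamI (fm (sg g (sg h j))) (e h j) (e g (sg h j))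
      (x (sg g (sg h j))))) => j /=.
    have E : e h j * e g (sg h j) * fm (sg g (sg h j)) * (e h j * e g (sg h j))^-1 = fm j.
      by rewrite -eM // -sM // ec ?groupM.
    have := Gam_iso (fH _) (eH _ _ hA) (eH _ _ gA) (ox (sg g (sg h j))) E.
    by rewrite ec // sM // eM.
  apply: functional_extensionality => j.
  have := Gam_nat HS HX (eH h j hA) (eH g (sg h j) gA) (fH _) (ha (sg g (sg h j))).
  by rewrite ec // sM // eM.
- move=> k h g x kA hA gA ox; apply: functional_extensionality => j /=.
  have := Gam_assoc HS HX (eH k j kA) (eH h (sg k j) hA) (eH g (sg h (sg k j)) gA)
    (fH _) (ox (sg g (sg h (sg k j)))).
  have E : e h (sg k j) * e g (sg h (sg k j)) * fm (sg g (sg h (sg k j))) *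
      (e h (sg k j) * e g (sg h (sg k j)))^-1 = fm (sg k j).
    by rewrite -eM // -sM // ec ?groupM.
  by rewrite E ec // !sM ?groupM // !eM.
- move=> x ox; apply: functional_extensionality => j /=.
  by rewrite s1 e1 (psi2_1 HS HX (fH j) (ox j)).
move=> x y a ha; apply: functional_extensionality => j /=.
by rewrite s1 e1 (psi3_1 HS HX (fH j) (ha j)).
Qed.

(** * Change of the index set and of the cocycle *)

Section Reindexing.
Variables (J J' : Type) (fm : J -> gT) (sg : gT -> J -> J) (e : gT -> J -> gT).
Variables (fm' : J' -> gT) (sg' : gT -> J' -> J') (e' : gT -> J' -> gT).
Variables (be : J' -> J) (be' : J -> J') (s : J' -> gT).
Hypotheses (ix : is_index fm sg e) (ix' : is_index fm' sg' e').
Hypotheses (beK : cancel be be') (be'K : cancel be' be).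
Hypotheses (sH : forall j, s j \in H).
Hypothesis s_conj : forall j, s j * fm (be j) * (s j)^-1 = fm' j.
Hypothesis be_sg : forall g j, g \in A -> be (sg' g j) = sg g (be j).
Hypothesis s_e : forall g j, g \in A -> s j * e g (be j) = e' g j * s (sg' g j).

Let F : ftor (fam_cat fm) (fam_cat fm') := @Ftor (fam_cat fm) (fam_cat fm')
  (fun x j => psi2 X (fm (be j)) (s j) (x (be j)))
  (fun a j => psi3 X (fm (be j)) (s j) (a (be j))).
Let G : ftor (fam_cat fm') (fam_cat fm) := @Ftor (fam_cat fm') (fam_cat fm)
  (fun x j => psi2 X (fm' (be' j)) (s (be' j))^-1 (x (be' j)))
  (fun a j => psi3 X (fm' (be' j)) (s (be' j))^-1 (a (be' j))).

Let s_conjV j : (s (be' j))^-1 * fm' (be' j) * (s (be' j))^-1^-1 = fm j.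
Proof. by rewrite -s_conj be'K invgK !mulgA mulVg mul1g mulgKV. Qed.

(** The quasi-inverse applies [psi] of the inverse elements along the inverse bijection. The two
    natural isomorphisms are [Gam] at [(s^-1, s)] and [(s, s^-1)], whose target is [psi_1], the
    identity. *)
Lemma reindex_equivalence : is_equivalence F.
Proof.
have fH := ix_fm ix; have fH' := ix_fm ix'.
have sVH j : (s (be' j))^-1 \in H by rewrite groupV.
split.
  split=> /= [x ox j|x y a ha j|x ox|x y z a b ha hb].
  - by rewrite -s_conj; apply: (T2_psi HS HX); auto.
  - by rewrite -s_conj; apply: (T3_psi3 HS HX); auto.
  - by apply: functional_extensionality => j; apply: (psi3_id HS HX); auto.
  apply: functional_extensionality => j.
  exact: (psi3_cmp HS HX (fH _) (sH _) (ha _) (hb _)).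
exists G; split.
  split=> /= [x ox j|x y a ha j|x ox|x y z a b ha hb].
  - by rewrite -s_conjV; apply: (T2_psi HS HX); auto.
  - by rewrite -s_conjV; apply: (T3_psi3 HS HX); auto.
  - by apply: functional_extensionality => j; apply: (psi3_id HS HX); auto.
  apply: functional_extensionality => j.
  exact: (psi3_cmp HS HX (fH' _) (sVH _) (ha _) (hb _)).
split.
  exists (fun (x : ob (fam_cat fm)) j => Gam X (fm j) (s (be' j))^-1 (s (be' j)) (x j)).
  split=> /= [x ox|x y a ha].
    apply: (@fam_iso _ _ _ _ _ (fun j => GamI (fm j) (s (be' j))^-1 (s (be' j)) (x j))) => j /=.
    have := @Gam_iso (fm j) (s (be' j))^-1 (s (be' j)) (x j) (fm j) (fH _) (sVH _) (sH _) (ox _).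
    rewrite mulVg mul1g invg1 mulg1 (psi2_1 HS HX (fH j) (ox j)) => /(_ erefl).
    by rewrite be'K -s_conj be'K.
  apply: functional_extensionality => j.
  have := Gam_nat HS HX (sVH j) (sH (be' j)) (fH j) (ha j).
  by rewrite mulVg (psi3_1 HS HX (fH j) (ha j)) -s_conj be'K.
exists (fun (x : ob (fam_cat fm')) j => Gam X (fm' j) (s j) (s j)^-1 (x j)).
have sV j : (s j)^-1 \in H by rewrite groupV.
split=> /= [x ox|x y a ha].
  apply: (@fam_iso _ _ _ _ _ (fun j => GamI (fm' j) (s j) (s j)^-1 (x j))) => j /=.
  have := @Gam_iso (fm' j) (s j) (s j)^-1 (x j) (fm' j) (fH' _) (sH _) (sV _) (ox _).
  rewrite mulgV mul1g invg1 mulg1 (psi2_1 HS HX (fH' j) (ox j)) => /(_ erefl).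
  have := s_conjV (be j); rewrite beK => ->; exact.
apply: functional_extensionality => j.
have := Gam_nat HS HX (sH j) (sV j) (fH' j) (ha j).
rewrite mulgV (psi3_1 HS HX (fH' j) (ha j)).
have := s_conjV (be j); rewrite beK => ->; exact.
Qed.

Lemma reindex_equivalent :
  pre_equivalent A (fam_action fm sg e) (fam_action fm' sg' e').
Proof.
have fH := ix_fm ix; have fH' := ix_fm ix'; have eH := ix_e ix; have eH' := ix_e ix'.
have hD := fam_category fH'.
(* By [s_e], both composite functors are comparable through [Gam] with [psi] of the same element
   [s j * e g (be j) = e' g j * s (sg' g j)]. *)
pose t g (x : ob (fam_cat fm)) (j : J') :=
  Gam X (fm (sg g (be j))) (s j) (e g (be j)) (x (sg g (be j))) #2
  GamI (fm (sg g (be j))) (e' g j) (s (sg' g j)) (x (sg g (be j))).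
have Ec g j : g \in A -> s j * e g (be j) * fm (sg g (be j)) * (s j * e g (be j))^-1 = fm' j.
  move=> gA; rewrite -s_conj -(ix_conj ix (be j) gA) invMg !mulgA //.
have Ec' g j : g \in A ->
    e' g j * s (sg' g j) * fm (sg g (be j)) * (e' g j * s (sg' g j))^-1 = fm' j.
  by move=> gA; rewrite -s_e // Ec.
have I1 g (x : ob (fam_cat fm)) j : g \in A -> isob x ->
  is_3iso one1 (r (fm' j)) (psi2 X (fm (be j)) (s j)
      (psi2 X (fm (sg g (be j))) (e g (be j)) (x (sg g (be j)))))
    (psi2 X (fm (sg g (be j))) (s j * e g (be j)) (x (sg g (be j))))
    (Gam X (fm (sg g (be j))) (s j) (e g (be j)) (x (sg g (be j))))
    (GamI (fm (sg g (be j))) (s j) (e g (be j)) (x (sg g (be j)))).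
  move=> gA ox; have := Gam_iso (fH _) (sH j) (eH g (be j) gA) (ox (sg g (be j))) (Ec g j gA).
  by rewrite (ix_conj ix).
have I2 g (x : ob (fam_cat fm)) j : g \in A -> isob x ->
  is_3iso one1 (r (fm' j)) (psi2 X (fm' (sg' g j)) (e' g j)
      (psi2 X (fm (be (sg' g j))) (s (sg' g j)) (x (be (sg' g j)))))
    (psi2 X (fm (sg g (be j))) (s j * e g (be j)) (x (sg g (be j))))
    (Gam X (fm (sg g (be j))) (e' g j) (s (sg' g j)) (x (sg g (be j))))
    (GamI (fm (sg g (be j))) (e' g j) (s (sg' g j)) (x (sg g (be j)))).
  move=> gA ox; have := Gam_iso (fH _) (eH' g j gA) (sH (sg' g j)) (ox (sg g (be j))) (Ec' g j gA).
  by rewrite s_e // -be_sg // s_conj.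
exists F, t; split.
- exact: reindex_equivalence.
- move=> g gA; split=> /= [x ox|x y a ha].
    pose m j := psi2 X (fm (sg g (be j))) (s j * e g (be j)) (x (sg g (be j))).
    have i1 := @fam_iso _ fm' (fob (fthen (act_fun (fam_action fm sg e) g) F) x) m _ _
      (fun j => I1 g x j gA ox).
    have i2 := @fam_iso _ fm' m (fob (fthen F (act_fun (fam_action fm' sg' e') g)) x) _ _
      (fun j => is_3iso_sym (I2 g x j gA ox)).
    exact: (is_iso_cmp hD i1 i2).
  apply: functional_extensionality => j; rewrite /t /=.
  have [ox oy] := hom_ob (fam_category fH) ha.
  have aj := ha (sg g (be j)).
  have N1 := Gam_nat HS HX (sH j) (eH g (be j) gA) (fH _) aj.
  have N2 := Gam_nat HS HX (eH' g j gA) (sH (sg' g j)) (fH _) aj.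
  have cj := ix_conj ix (be j) gA.
  have cj' : s (sg' g j) * fm (sg g (be j)) * (s (sg' g j))^-1 = fm' (sg' g j).
    by rewrite -be_sg.
  rewrite cj in N1; rewrite cj' -s_e // in N2.
  have [X1 _ _ _] := I1 g x j gA ox. have [Y1 _ _ _] := I1 g y j gA oy.
  have [X2 X2' _ eX] := I2 g x j gA ox. have [Y2 Y2' eY _] := I2 g y j gA oy.
  have Q := T3_psiF (fH _) (groupM (sH j) (eH g (be j) gA)) aj (Ec g j gA).
  have P1 := T3_psiF (fH _) (eH g (be j) gA) aj cj.
  have P2 := T3_psiF (fH _) (sH (sg' g j)) aj cj'.
  have P := T3_psiF (fH _) (sH j) P1 (s_conj j).
  have R := T3_psiF (fH' _) (eH' g j gA) P2 (ix_conj ix' j gA).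
  rewrite be_sg // in X2 X2' eX Y2 Y2' eY *.
  exact: (natural_paste (trace_category (fH' j)) P X1 Q Y1 X2 X2' eX R Y2 Y2' eY N1 N2).
move=> h g x hA gA ox; apply: functional_extensionality => j; rewrite /t /=.
have hb : be (sg' h j) = sg h (be j) by rewrite be_sg.
have hb' : be (sg' g (sg' h j)) = sg g (sg h (be j)) by rewrite !be_sg.
have e2 : s (sg' h j) * e g (sg h (be j)) = e' g (sg' h j) * s (sg' g (sg' h j)).
  by rewrite -hb s_e.
have := Gam_transfer (fH (sg g (sg h (be j))))
  (And3 (sH j) (sH (sg' h j)) (sH (sg' g (sg' h j))))
  (And4 (eH h (be j) hA) (eH g (sg h (be j)) gA) (eH' h j hA) (eH' g (sg' h j) gA))
  (s_e j hA) e2 (ox _).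
have EC : e h (be j) * e g (sg h (be j)) * fm (sg g (sg h (be j))) *
    (e h (be j) * e g (sg h (be j)))^-1 = fm (be j).
  by rewrite -(ix_eM ix) // -(ix_sgM ix) // (ix_conj ix) ?groupM.
have E1 := Ec g (sg' h j) gA; rewrite hb in E1.
have E2 := s_conj (sg' g (sg' h j)); rewrite hb' in E2.
rewrite EC (ix_conj ix) // E1 E2 (ix_sgM ix) // (ix_eM ix) // (ix_eM ix') //.
by rewrite (ix_sgM ix') // hb hb'.
Qed.
End Reindexing.
End Family.
End Families.

(** * The trace of the induced representation *)

Section Cosets.
Variables (gT : finGroupType) (B A : {group gT}) (m : nat) (b : 'I_m -> gT).
Hypothesis hb : coset_reps B A b.

Lemma coset_rep_exists g : g \in B -> exists i, (b i)^-1 * g \in A.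
Proof. by case: hb => _ h /h [i [hi _]]; exists i; rewrite -mem_lcoset. Qed.

Lemma coset_rep_unique g i j : g \in B -> (b i)^-1 * g \in A -> (b j)^-1 * g \in A ->
  i = j.
Proof.
case: hb => _ h /h [k [_ hk]]; rewrite -!mem_lcoset => /hk <- /hk //.
Qed.

Lemma ind_idx_mem g j : g \in B -> ind_elt A b g j \in A.
Proof.
move=> gB; rewrite /ind_elt /ind_idx; case: pickP => [i //|h] /=.
have [i] := coset_rep_exists (groupM (groupVr gB) (hb.1 j)).
by rewrite -groupV !invMg !invgK h.
Qed.

Lemma ind_idx_unique g j i : g \in B -> (b j)^-1 * g * b i \in A -> ind_idx A b g j = i.
Proof.
move=> gB hi; have := ind_idx_mem j gB; rewrite /ind_elt => hk.
apply: (coset_rep_unique (groupM (groupVr gB) (hb.1 j))).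
  by rewrite -groupV !invMg !invgK.
by rewrite -groupV !invMg !invgK.
Qed.

Lemma ind_idxM h g j : h \in B -> g \in B ->
  ind_idx A b (h * g) j = ind_idx A b g (ind_idx A b h j).
Proof.
move=> hB gB; apply: ind_idx_unique; first exact: groupM.
have := groupM (ind_idx_mem j hB) (ind_idx_mem (ind_idx A b h j) gB).
by rewrite /ind_elt !mulgA mulgK.
Qed.

Lemma ind_eltM h g j : h \in B -> g \in B ->
  ind_elt A b (h * g) j = ind_elt A b h j * ind_elt A b g (ind_idx A b h j).
Proof. by move=> hB gB; rewrite /ind_elt ind_idxM // !mulgA mulgK. Qed.

Lemma ind_idx1 j : ind_idx A b 1 j = j.
Proof. by apply: ind_idx_unique; rewrite ?group1 // mulg1 mulVg group1. Qed.

Lemma ind_elt1 j : ind_elt A b 1 j = 1.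
Proof. by rewrite /ind_elt ind_idx1 mulg1 mulVg. Qed.
End Cosets.

(** * Row calculus for matrices with one entry per row *)

Section Rows.
Variable m : nat.

(** Row [j] has [u] in column [k] as its only nonzero entry. This form passes through matrix
    products and entrywise operations, so long composites are evaluated row by row, without
    unfolding [pick] each time. *)
Definition row_at T (a : mat m T) j k u :=
  a j k = Some u /\ forall k', isSome (a j k') -> k' = k.
Definition row_zero T (a : mat m T) j := forall k, a j k = None.

Lemma row_mul T1 T2 T (f : T1 -> T2 -> T) a b j l k u v :
  row_at a j l u -> row_at b l k v -> row_at (matmul f a b) j k (f u v).
Proof.
move=> [ea ua] [eb ub]; split.
  rewrite /matmul; case: pickP => [l'|/(_ l)]; last by rewrite ea eb.
  case E: (a j l') => [u'|] //= _; have := ua l'; rewrite E => /(_ isT) e; subst l'.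
  by move: E; rewrite ea eb => -[->].
move=> k'; rewrite /matmul; case: pickP => [l'|//].
case E: (a j l') => [u'|] //; have := ua l'; rewrite E => /(_ isT) e; subst l'.
by case E': (b l k') => [v'|] //= _ _; apply: ub; rewrite E'.
Qed.

Lemma row_mul_zerol T1 T2 T (f : T1 -> T2 -> T) a b j :
  row_zero a j -> row_zero (matmul f a b) j.
Proof. by move=> h k; rewrite /matmul; case: pickP => // l; rewrite h. Qed.

Lemma row_mul_zeror T1 T2 T (f : T1 -> T2 -> T) a b j l u :
  row_at a j l u -> row_zero b l -> row_zero (matmul f a b) j.
Proof.
move=> [ea ua] h k; rewrite /matmul; case: pickP => // l'.
case E: (a j l') => [u'|] //=; have := ua l'; rewrite E => /(_ isT) ->.
by rewrite h.
Qed.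

Lemma row_map T1 T (f : T1 -> T) (a : mat m T1) j k u :
  row_at a j k u -> row_at (matmap f a) j k (f u).
Proof.
move=> [e h]; split; first by rewrite /matmap e.
by move=> k'; rewrite /matmap; case E: (a j k') => //= _; apply: h; rewrite E.
Qed.

Lemma row_map_zero T1 T (f : T1 -> T) (a : mat m T1) j :
  row_zero a j -> row_zero (matmap f a) j.
Proof. by move=> h k; rewrite /matmap h. Qed.

Lemma row_map2 T1 T2 T (f : T1 -> T2 -> T) (a : mat m T1) b j k u v :
  row_at a j k u -> row_at b j k v -> row_at (matmap2 f a b) j k (f u v).
Proof.
move=> [e h] [e' h']; split; first by rewrite /matmap2 e e'.
by move=> k'; rewrite /matmap2; case E: (a j k') => //= _; apply: h; rewrite E.
Qed.

Lemma row_map2_zerol T1 T2 T (f : T1 -> T2 -> T) (a : mat m T1) b j :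
  row_zero a j -> row_zero (matmap2 f a b) j.
Proof. by move=> h k; rewrite /matmap2 h. Qed.

Lemma row_map2_zeror T1 T2 T (f : T1 -> T2 -> T) (a : mat m T1) b j :
  row_zero b j -> row_zero (matmap2 f a b) j.
Proof. by move=> h k; rewrite /matmap2 h; case: (a j k). Qed.

Lemma eq_rows T (a b : mat m T) :
  (forall j, (exists k u, row_at a j k u /\ row_at b j k u) \/
             (row_zero a j /\ row_zero b j)) -> a = b.
Proof.
move=> h; apply: functional_extensionality => j; apply: functional_extensionality => k.
case: (h j) => [[k0 [u [[e1 h1] [e2 h2]]]]|[-> ->] //].
have := h1 k; have := h2 k.
case: (eqVneq k k0) => [->|ne]; first by rewrite e1 e2.
case: (a j k) (b j k) => [?|] [?|] // => [_ /(_ isT)|_ /(_ isT)|/(_ isT)];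
  by move/eqP; rewrite (negPf ne).
Qed.

Variable (P : pred 'I_m).

Definition diag T (y : {j | P j} -> T) : mat m T :=
  fun j k => if j == k then omap y (insub j) else None.

Lemma row_diag T (y : {j | P j} -> T) j : row_at (diag y) (val j) (val j) (y j).
Proof.
split; first by rewrite /diag eqxx valK.
by move=> k; rewrite /diag; case: eqP.
Qed.

Lemma row_diag_zero T (y : {j | P j} -> T) j : ~~ P j -> row_zero (diag y) j.
Proof. by move=> nP k; rewrite /diag insubN //; case: eqP. Qed.

(** The default [t0] is returned only at a vanishing diagonal entry, and cells of the trace have
    none at the positions in [P]. *)
Definition undiag T (t0 : T) (a : mat m T) (j : {j | P j}) : T :=
  odflt t0 (a (val j) (val j)).

Lemma undiagK T t0 (y : {j | P j} -> T) : undiag t0 (diag y) = y.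
Proof. by apply: functional_extensionality => j; rewrite /undiag /diag eqxx valK. Qed.

Lemma diag_eq T (a : mat m T) (y : {j | P j} -> T) :
  (forall j, row_at a (val j) (val j) (y j)) -> (forall j, ~~ P j -> row_zero a j) ->
  a = diag y.
Proof.
move=> h h0; apply: eq_rows => j; case: (boolP (P j)) => Pj.
  left; exists j, (y (exist _ j Pj)).
  by split; [exact: (h (exist _ j Pj))|exact: (row_diag y (exist _ j Pj))].
by right; split; [exact: h0|exact: row_diag_zero].
Qed.
End Rows.

(** * The induced trace as a family over the fixed cosets *)

Section InducedTrace.
Variables (gT : finGroupType) (S : sig3) (HS : is_strict3 S).
Variables (G H : {group gT}) (X : rep3 gT S) (HX : is_rep3 H X).
Variables (m : nat) (c : 'I_m -> gT) (hc : coset_reps G H c).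
Local Notation Xi := (ind_rep3 H X c).

(* [g] maps the [k]-th coset to the [j]-th one, with [x] as induced element. *)
Definition step g j k x := [/\ g \in G, x \in H & c j * x = g * c k].

Lemma step_mul h g i j k x y : step h i j x -> step g j k y -> step (h * g) i k (x * y).
Proof.
move=> [hG xH e] [gG yH e']; split; rewrite ?groupM //.
by rewrite mulgA e -mulgA e' mulgA.
Qed.

Lemma step_inv g j k x : step g j k x -> step g^-1 k j x^-1.
Proof.
move=> [gG xH e]; split; rewrite ?groupV //.
by apply: (mulgI g); rewrite mulgA -e mulgK mulgA mulgV mul1g.
Qed.

Lemma step1 j : step 1 j j 1.
Proof. by split; rewrite ?group1 ?mulg1 ?mul1g. Qed.

Lemma step_idx g j : g \in G -> step g j (ind_idx H c g j) (ind_elt H c g j).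
Proof.
move=> gG; split=> //; first exact: (ind_idx_mem hc).
by rewrite /ind_elt !mulgA mulgV mul1g.
Qed.

Lemma step_cos g j k x : step g j k x -> cos c j g k = x.
Proof. by case=> _ _ e; rewrite /cos -mulgA -e mulKg. Qed.

Lemma cos_unique g j k k' x : step g j k x -> cos c j g k' \in H -> k' = k.
Proof.
move=> st h; have [gG xH _] := st.
rewrite -(ind_idx_unique hc (g := g) (j := j) gG h).
by apply: (ind_idx_unique hc) => //; rewrite -/(cos c j g k) (step_cos st).
Qed.

Lemma row_rho g j k x : step g j k x -> row_at (rho Xi g) j k (rho X x).
Proof.
move=> st; have [_ xH _] := st; split; first by rewrite /= (step_cos st) xH.
by move=> k' /=; case: ifP => // h _; apply: cos_unique st h.
Qed.

Lemma row_ind2 T (q : gT -> gT -> T) h g k j i x y : step h k j x -> step g j i y ->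
  row_at (ind_mat2 H c q h g) k i (q x y).
Proof.
move=> s1 s2; have [_ xH _] := s1; have [_ yH _] := s2.
split; rewrite /ind_mat2.
  case: pickP => [j' /andP[h1 h2]|/(_ j)]; last by rewrite (step_cos s1) (step_cos s2) xH yH.
  by rewrite (cos_unique s1 h2) (step_cos s1) (step_cos s2).
move=> i'; case: pickP => // j' /andP[h1 h2] _.
by rewrite (cos_unique s1 h2) in h1; apply: cos_unique s2 h1.
Qed.

Lemma row_ind3 T (q : gT -> gT -> gT -> T) h3 h2 h1 l k j i x3 x2 x1 :
  step h3 l k x3 -> step h2 k j x2 -> step h1 j i x1 ->
  row_at (ind_mat3 H c q h3 h2 h1) l i (q x3 x2 x1).
Proof.
move=> s3 s2 s1; have [_ H3 _] := s3; have [_ H2 _] := s2; have [_ H1 _] := s1.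
split; rewrite /ind_mat3.
  case: pickP => [[j' k'] /= /and3P[e1 e2 e3]|/(_ (j, k)) /=]; last first.
    by rewrite (step_cos s1) (step_cos s2) (step_cos s3) H1 H2 H3.
  have ek := cos_unique s3 e3; subst k'; have ej := cos_unique s2 e2; subst j'.
  by rewrite (step_cos s1) (step_cos s2) (step_cos s3).
move=> i'; case: pickP => // [[j' k']] /= /and3P[e1 e2 e3] _.
have ek := cos_unique s3 e3; subst k'; have ej := cos_unique s2 e2; subst j'.
exact: cos_unique s1 e1.
Qed.

(** [rows] finds the nonzero entry in a row of a composite by recursion on its syntax. The
    intermediate columns and group elements are existential variables, which [stp] fills from the
    steps in the context. *)
Ltac stp := lazymatch goal with
  | |- step (_ * _) _ _ _ => eapply step_mul; [stp | stp]
  | |- step 1 _ _ _ => eapply step1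
  | |- _ => eassumption
  end.
Ltac rows := lazymatch goal with
  | |- row_at (rho _ _) _ _ _ => eapply row_rho; stp
  | |- row_at (phi _ _ _) _ _ _ => eapply (row_ind2 (phi X)); [stp | stp]
  | |- row_at (phiV _ _ _) _ _ _ => eapply (row_ind2 (phiV X)); [stp | stp]
  | |- row_at (Phi _ _ _ _) _ _ _ => eapply (row_ind3 (Phi X)); [stp | stp | stp]
  | |- row_at (PhiV _ _ _ _) _ _ _ => eapply (row_ind3 (PhiV X)); [stp | stp | stp]
  | |- row_at (id3 _) _ _ _ => eapply row_map; rows
  | |- row_at (comp0 _ _) _ _ _ => eapply row_mul; [rows | rows]
  | |- row_at (lw2 _ _) _ _ _ => eapply row_mul; [rows | rows]
  | |- row_at (rw2 _ _) _ _ _ => eapply row_mul; [rows | rows]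
  | |- row_at (lw3 _ _) _ _ _ => eapply row_mul; [rows | rows]
  | |- row_at (rw3 _ _) _ _ _ => eapply row_mul; [rows | rows]
  | |- row_at (comp1 _ _) _ _ _ => eapply row_map2; [rows | rows]
  | |- row_at (hcomp1 _ _) _ _ _ => eapply row_map2; [rows | rows]
  | |- row_at (comp2 _ _) _ _ _ => eapply row_map2; [rows | rows]
  | |- _ => eassumption
  end.

Lemma row_psi2 f g w j k e a v : step g j k a -> step f k k e ->
  row_at w k k v -> row_at (psi2 Xi f g w) j j (psi2 X e a v).
Proof. move=> s1 s2 hw; have s1' := step_inv s1. rewrite /psi2. rows. Qed.

Lemma row_psi3 f g w j k e a v : step g j k a -> step f k k e ->
  row_at w k k v -> row_at (psi3 Xi f g w) j j (psi3 X e a v).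
Proof. move=> s1 s2 hw; have s1' := step_inv s1. rewrite /psi3. rows. Qed.

Lemma row_Gam f h g w i j k e a b v : step h i j a -> step g j k b -> step f k k e ->
  row_at w k k v -> row_at (Gam Xi f h g w) i i (Gam X e a b v).
Proof.
move=> s1 s2 s3 hw; have s1' := step_inv s1; have s2' := step_inv s2.
rewrite /Gam /LV /LamV /RV /Lam. rows.
Qed.

Lemma zero_psi2 f g w j k a : step g j k a -> row_zero w k ->
  row_zero (psi2 Xi f g w) j.
Proof.
move=> s1 hw; do 2 apply: row_map2_zerol; apply: row_map2_zeror.
apply: row_mul_zerol; apply: row_mul_zeror hw; rows.
Qed.

Lemma zero_psi3 f g w j k a : step g j k a -> row_zero w k ->
  row_zero (psi3 Xi f g w) j.
Proof.
move=> s1 hw; do 2 apply: row_map2_zerol; apply: row_map2_zeror.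
apply: row_mul_zerol; apply: row_mul_zeror hw; rows.
Qed.

Lemma zero_Gam f h g w i j k a b : step h i j a -> step g j k b ->
  row_zero w k -> row_zero (Gam Xi f h g w) i.
Proof.
move=> s1 s2 hw; apply: row_map2_zerol; apply: row_map2_zeror.
apply: row_map_zero; apply: row_mul_zerol; apply: row_mul_zeror hw; rows.
Qed.

Variable f : gT.
Hypothesis fG : f \in G.

(* The diagonal positions at which the induced functor of [f] does not vanish. *)
Definition fixd := [pred j | cos c j f j \in H].

Definition fix_elt (j : {j | fixd j}) := cos c (val j) f (val j).
(** The default [j] of [insubd] is never reached for [g] in the centralizer of [f], which preserves
    the set of fixed cosets ([fixd_idx]). *)
Definition fix_idx g (j : {j | fixd j}) : {j | fixd j} := insubd j (ind_idx H c g (val j)).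
Definition fix_cocycle g (j : {j | fixd j}) := ind_elt H c g (val j).

Lemma fixdP j : reflect (exists x, step f j j x) (fixd j).
Proof.
apply: (iffP idP) => [h|[x st]]; last by rewrite /= (step_cos st); case: st.
by exists (cos c j f j); split=> //; rewrite /cos !mulgA mulgV mul1g.
Qed.

Lemma fix_conj g j k x y : g \in 'C_G[f] -> step g j k x -> step f j j y ->
  step f k k (x^-1 * y * x).
Proof.
case/setIP=> gG /cent1P cf st st'.
have := step_mul (step_mul (step_inv st) st') st.
by rewrite -mulgA -cf mulKg.
Qed.

Lemma fixd_idx g j : g \in 'C_G[f] -> fixd (ind_idx H c g j) = fixd j.
Proof.
move=> gC; have [gG _] := setIP gC; have st := step_idx j gG.
apply/fixdP/fixdP => [[x h]|[x h]]; last by eexists; apply: fix_conj gC st h.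
by eexists; apply: (fix_conj (groupVr gC) (step_inv st) h).
Qed.

Lemma val_fix_idx g j : g \in 'C_G[f] -> val (fix_idx g j) = ind_idx H c g (val j).
Proof. by move=> gC; rewrite val_insubd fixd_idx // (valP j). Qed.

Lemma step_fix j : step f (val j) (val j) (fix_elt j).
Proof. by have /fixdP[x st] := valP j; rewrite /fix_elt (step_cos st). Qed.

Lemma step_fix_idx g j : g \in 'C_G[f] ->
  step g (val j) (val (fix_idx g j)) (fix_cocycle g j).
Proof.
by move=> gC; rewrite val_fix_idx //; apply: step_idx; case/setIP: gC.
Qed.

Lemma fix_index : is_index H 'C_G[f] fix_elt fix_idx fix_cocycle.
Proof.
have CG g : g \in 'C_G[f] -> g \in G by case/setIP.
split.
- by move=> j; case: (step_fix j).
- by move=> g j gC; case: (step_fix_idx j gC).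
- move=> g j gC.
  have -> : fix_elt (fix_idx g j) = _ := step_cos (fix_conj gC (step_fix_idx j gC) (step_fix j)).
  move: (fix_cocycle g j) (fix_elt j) => e x; by rewrite !mulgA mulgV mul1g mulgK.
- move=> h g j hC gC; apply: val_inj; rewrite !val_fix_idx ?groupM //.
  by apply: (ind_idxM hc); apply: CG.
- move=> h g j hC gC; rewrite /fix_cocycle val_fix_idx //.
  by apply: (ind_eltM hc); apply: CG.
- move=> j; apply: val_inj; rewrite val_fix_idx ?group1 //; exact: (ind_idx1 hc).
by move=> j; apply: (ind_elt1 hc).
Qed.

Let U : ftor (trace_cat Xi f) (fam_cat X fix_elt) :=
  @Ftor (trace_cat Xi f) (fam_cat X fix_elt)
    (undiag (id2 one1)) (undiag (id3 (id2 one1))).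
Let V : ftor (fam_cat X fix_elt) (trace_cat Xi f) :=
  @Ftor (fam_cat X fix_elt) (trace_cat Xi f) (@diag _ fixd _) (@diag _ fixd _).

Lemma mat_T1_one : mat_T1 (one1 : C1 (mat_sig3 S m)).
Proof.
split=> /=.
- by move=> j k F; case: eqP => // _ [<-]; apply: (T1_one HS).
- by move=> j k k'; case: eqP => // -> _; case: eqP.
- by move=> j j' k; case: eqP => // -> _; case: eqP.
Qed.

Lemma mat_T1_rho : mat_T1 (rho Xi f).
Proof.
have st := fun j => step_idx j fG.
split=> /=.
- by move=> j k F; case: ifP => // h [<-]; have [] := rho_iso HX h.
- move=> j k k'; case: ifP => // h; case: ifP => // h' _ _.
  by rewrite (cos_unique (st j) h) (cos_unique (st j) h').
move=> j j' k; case: ifP => // h; case: ifP => // h' _ _.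
have inv i : cos c i f k \in H -> cos c k f^-1 i \in H.
  by rewrite -groupV /cos !invMg !invgK mulgA.
have st' := step_idx k (groupVr fG).
by rewrite (cos_unique st' (inv _ h)) (cos_unique st' (inv _ h')).
Qed.

Lemma trace_obP (x : mat m (C2 S)) : T2 (one1 : C1 (mat_sig3 S m)) (rho Xi f) x <->
  exists2 y, (forall j, T2 one1 (rho X (fix_elt j)) (y j)) & x = diag y.
Proof.
split=> [[_ _ h]|[y hy ->]].
  exists (undiag (id2 one1) x).
    move=> j; have := h (val j) (val j); rewrite /= eqxx (valP j : cos c _ _ _ \in H) /=.
    by case=> w e; rewrite /undiag e.
  apply: diag_eq => [j|j nP k].
    have := h (val j) (val j); rewrite /= eqxx (valP j : cos c _ _ _ \in H) /= => [[w e _]].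
    split; first by rewrite /undiag e.
    move=> k; have := h (val j) k; rewrite /=; case: eqP => // _ ->; done.
  have nP' : (cos c j f j \in H) = false by apply: negPf nP.
  by have := h j k; rewrite /=; case: eqP => // <-; rewrite nP'.
split; [exact: mat_T1_one|exact: mat_T1_rho|move=> j k].
rewrite /= /diag; case: eqP => // <-; case: ifP => Pj /=; last by rewrite insubF.
have := hy (exist _ j Pj); rewrite insubT /=; by exists (y (exist _ j Pj)).
Qed.

Lemma trace_homP (x y : mat m (C2 S)) (a : mat m (C3 S)) :
  T3 (one1 : C1 (mat_sig3 S m)) (rho Xi f) x y a <->
  exists x' y' a', [/\ forall j, T3 one1 (rho X (fix_elt j)) (x' j) (y' j) (a' j),
    x = diag x', y = diag y' & a = diag a'].
Proof.
split=> [[hx hy h]|[x' [y' [a' [h -> -> ->]]]]].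
  have [x' hx' ex] := (trace_obP x).1 hx; have [y' hy' ey] := (trace_obP y).1 hy.
  exists x', y', (undiag (id3 (id2 one1)) a); split=> //.
    move=> j; have := h (val j) (val j).
    rewrite /= eqxx (valP j : cos c _ _ _ \in H) /= => [[u [v [w [e1 e2 e3]]]]].
    rewrite /undiag e3 /=; move: e1 e2; rewrite ex ey /diag eqxx valK /=.
    by move=> [->] [->].
  apply: diag_eq => [j|j nP k].
    have := h (val j) (val j).
    rewrite /= eqxx (valP j : cos c _ _ _ \in H) /= => [[u [v [w [_ _ e3 _]]]]].
    split; first by rewrite /undiag e3.
    by move=> k; have := h (val j) k; rewrite /=; case: eqP => // _ ->.
  have nP' : (cos c j f j \in H) = false by apply: negPf nP.
  by have := h j k; rewrite /=; case: eqP => // <-; rewrite nP'.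
split.
- by apply/trace_obP; exists x' => // j; have [] := T3_T2 HS (h j).
- by apply/trace_obP; exists y' => // j; have [] := T3_T2 HS (h j).
move=> j k; rewrite /= /diag; case: eqP => // <-; case: ifP => Pj /=; last by rewrite insubF.
have := h (exist _ j Pj); rewrite insubT /= => hj.
by exists (x' (exist _ j Pj)), (y' (exist _ j Pj)), (a' (exist _ j Pj)).
Qed.

Lemma trace_strict_iso :
  strict_iso 'C_G[f] (trace_action Xi f) (fam_action X fix_elt fix_idx fix_cocycle) U V.
Proof.
have CG g : g \in 'C_G[f] -> g \in G by case/setIP.
have psiE g (y : {j | fixd j} -> C2 S) : g \in 'C_G[f] ->
  psi2 Xi f g (diag y) =
    diag (fun j => psi2 X (fix_elt (fix_idx g j)) (fix_cocycle g j) (y (fix_idx g j))).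
  move=> gC; apply: diag_eq => j.
    exact: row_psi2 (step_fix_idx j gC) (step_fix _) (row_diag _ _).
  move=> nP; apply: zero_psi2 (step_idx j (CG _ gC)) _.
  by apply: row_diag_zero; rewrite fixd_idx.
have psi3E g (y : {j | fixd j} -> C3 S) : g \in 'C_G[f] ->
  psi3 Xi f g (diag y) =
    diag (fun j => psi3 X (fix_elt (fix_idx g j)) (fix_cocycle g j) (y (fix_idx g j))).
  move=> gC; apply: diag_eq => j.
    exact: row_psi3 (step_fix_idx j gC) (step_fix _) (row_diag _ _).
  move=> nP; apply: zero_psi3 (step_idx j (CG _ gC)) _.
  by apply: row_diag_zero; rewrite fixd_idx.
have mapE (y : {j | fixd j} -> C2 S) : matmap (@id3 S) (diag y) = diag (fun j => id3 (y j)).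
  apply: diag_eq => j; first exact: row_map (row_diag _ _).
  by move=> nP; apply/row_map_zero/row_diag_zero.
have cmpE (y z : {j | fixd j} -> C3 S) :
    matmap2 (@comp2 S) (diag y) (diag z) = diag (fun j => y j #2 z j).
  apply: diag_eq => j; first exact: row_map2 (row_diag _ _) (row_diag _ _).
  by move=> nP; apply/row_map2_zerol/row_diag_zero.
split=> /=.
- by move=> x /trace_obP[y hy ->]; rewrite undiagK.
- by move=> x y a /trace_homP[x' [y' [a' [h -> -> ->]]]]; rewrite !undiagK.
- by move=> y hy; apply/trace_obP; exists y.
- by move=> x y a h; apply/trace_homP; exists x, y, a.
- by move=> x /trace_obP[y hy ->]; rewrite undiagK.
- by move=> x y a /trace_homP[x' [y' [a' [h _ _ ->]]]]; rewrite undiagK.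
- by move=> y _; rewrite undiagK.
- by move=> x y a _; rewrite undiagK.
- by move=> x y a [].
- by move=> x /trace_obP[y hy ->]; rewrite undiagK mapE.
- move=> x y z a b /trace_homP[x' [y' [a' [h _ _ ->]]]].
  by case/trace_homP=> [_ [z' [b' [_ _ _ ->]]]]; rewrite !undiagK cmpE.
- by move=> g x gC /trace_obP[y hy ->]; rewrite undiagK; exact: psiE.
- move=> g x y a gC /trace_homP[x' [y' [a' [h _ _ ->]]]].
  by rewrite undiagK; exact: psi3E.
move=> h g x hC gC /trace_obP[y hy ->]; rewrite undiagK.
apply: diag_eq => j.
  exact: row_Gam (step_fix_idx j hC) (step_fix_idx _ gC) (step_fix _) (row_diag _ _).
move=> nP; apply: zero_Gam (step_idx j (CG _ hC)) (step_idx _ (CG _ gC)) _.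
by apply: row_diag_zero; rewrite !fixd_idx.
Qed.
End InducedTrace.

(** * The induced action on the traces of the representatives *)

Section SumTrace.
Variables (gT : finGroupType) (S : sig3) (HS : is_strict3 S).
Variables (G H : {group gT}) (X : rep3 gT S) (HX : is_rep3 H X).
Variables (f : gT) (n : nat) (h r : 'I_n -> gT).
Hypothesis hH : forall i, h i \in H.
Hypothesis hr : forall i, r i \in G /\ (r i)^-1 * f * r i = h i.
Variables (d : 'I_n -> nat) (b : forall i, 'I_(d i) -> gT).
Hypothesis hb : forall i, coset_reps 'C_G[h i] 'C_H[h i] (@b i).

Definition pts := {i : 'I_n & 'I_(d i)}.
Definition sum_elt (p : pts) := h (tag p).
Definition sum_idx g (p : pts) : pts :=
  Tagged (fun i => 'I_(d i)) (ind_idx 'C_H[h (tag p)] (@b (tag p)) (g ^ r (tag p)) (tagged p)).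
Definition sum_cocycle g (p : pts) :=
  ind_elt 'C_H[h (tag p)] (@b (tag p)) (g ^ r (tag p)) (tagged p).

Lemma conj_cent g i : g \in 'C_G[f] -> g ^ r i \in 'C_G[h i].
Proof.
case/setIP=> gG /cent1P cf; have [rG <-] := hr i.
rewrite inE groupJ //=; apply/cent1P.
have -> : (r i)^-1 * f * r i = f ^ r i by rewrite /conjg mulgA.
by rewrite /commute -!conjMg cf.
Qed.

Lemma sum_index : is_index H 'C_G[f] sum_elt sum_idx sum_cocycle.
Proof.
have mem g p : g \in 'C_G[f] -> sum_cocycle g p \in 'C_H[h (tag p)].
  by move=> gC; apply: (ind_idx_mem (hb _)); apply: conj_cent.
split.
- by move=> p; apply: hH.
- by move=> g p /(mem g p) /setIP[].
- move=> g p /(mem g p) /setIP[_ /cent1P e]; rewrite {1}/sum_elt /=.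
  by rewrite e mulgK.
- move=> g k [i j] gC kC; rewrite /sum_idx /= conjMg.
  by rewrite (ind_idxM (hb i)) //; apply: conj_cent.
- move=> g k [i j] gC kC; rewrite /sum_cocycle /= conjMg.
  by rewrite (ind_eltM (hb i)) //; apply: conj_cent.
- by move=> [i j]; rewrite /sum_idx /= conj1g (ind_idx1 (hb i)).
by move=> [i j]; rewrite /sum_cocycle /= conj1g (ind_elt1 (hb i)).
Qed.

Let C := sum_cat (fun i => pow_cat (trace_cat X (h i)) (d i)).
Let U : ftor C (fam_cat X sum_elt) :=
  @Ftor C (fam_cat X sum_elt)
    (fun x p => x (tag p) (tagged p)) (fun x p => x (tag p) (tagged p)).
Let V : ftor (fam_cat X sum_elt) C :=
  @Ftor (fam_cat X sum_elt) C
    (fun x i j => x (Tagged (fun i => 'I_(d i)) j))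
    (fun x i j => x (Tagged (fun i => 'I_(d i)) j)).

(** Currying: a family over pairs [(i, j)] is a family over [i] of families over [j], and all cells
    are computed by the same formulas. *)
Lemma sum_strict_iso :
  strict_iso 'C_G[f]
   (sum_action (fun i => ind_action 'C_H[h i] (@b i) (trace_action X (h i))) r)
   (fam_action X sum_elt sum_idx sum_cocycle) U V.
Proof.
split=> //=.
- by move=> x hx [i j]; apply: hx.
- by move=> x y a ha [i j]; apply: ha.
- by move=> x hx i j; apply: (hx (Tagged _ j)).
- by move=> x y a ha i j; apply: (ha (Tagged _ j)).
- by move=> x _; apply: functional_extensionality => [[i j]].
- by move=> x y a _; apply: functional_extensionality => [[i j]].
move=> x y a ha; split=> i j; by have [] := T3_T2 HS (ha i j).
Qed.

(** * The bijection between pairs and fixed cosets *)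

Variables (m : nat) (c : 'I_m -> gT).
Hypotheses (hc : coset_reps G H c) (sHG : H \subset G) (fG : f \in G).
Hypothesis h_cover : (f ^: G) :&: H = \bigcup_(i < n) (h i ^: H).
Hypothesis h_distinct : injective (fun i => h i ^: H).

Definition pt_rep (p : pts) := r (tag p) * @b (tag p) (tagged p).

Lemma pt_repG p : pt_rep p \in G.
Proof.
by rewrite groupM ?(hr _).1 //; case/setIP: ((hb (tag p)).1 (tagged p)).
Qed.

Lemma pt_rep_conj p : (pt_rep p)^-1 * f * pt_rep p = h (tag p).
Proof.
have /setIP[_ /cent1P e] := (hb (tag p)).1 (tagged p).
rewrite /pt_rep invMg !mulgA -(mulgA _ _ (r _)) -(mulgA _ _ (f * _)).
by rewrite [_^-1 * (f * _)]mulgA (hr _).2 -mulgA -e mulKg.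
Qed.

Local Notation J := {j | fixd H c f j}.

Lemma pt_idx_ex p : exists j : J, (c (val j))^-1 * pt_rep p \in H.
Proof.
have [j hj] := coset_rep_exists hc (pt_repG p).
suff Pj : fixd H c f j by exists (exist _ j Pj).
have -> : fixd H c f j = (((c j)^-1 * pt_rep p) * h (tag p) * ((c j)^-1 * pt_rep p)^-1 \in H).
  rewrite -pt_rep_conj /= /cos; congr (_ \in H).
  move: (pt_rep p) (c j) => u v.
  by rewrite invMg invgK !mulgA !mulgK.
exact: (groupM (groupM hj (hH _)) (groupVr hj)).
Qed.

Definition pt_idx p : J := proj1_sig (constructive_indefinite_description _ (pt_idx_ex p)).
(** The element [s] of [H] by which the two representatives of one coset differ:
    [c_j = (r_i b) s]. *)
Definition pt_elt p := (pt_rep p)^-1 * c (val (pt_idx p)).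

Lemma pt_elt_in p : pt_elt p \in H.
Proof.
rewrite /pt_elt /pt_idx; case: constructive_indefinite_description => j /= hj.
by rewrite -groupV invMg invgK.
Qed.

Lemma pt_idx_unique p (j : J) : (c (val j))^-1 * pt_rep p \in H -> pt_idx p = j.
Proof.
move=> hj; apply: val_inj; apply: (coset_rep_unique hc (pt_repG p)) hj.
by have := pt_elt_in p; rewrite -groupV invMg invgK.
Qed.

(** If [r_i b] and [r_i' b'] lie in the same coset of [H], then conjugating [f] by them shows that
    [h_i] and [h_i'] are conjugate in [H], so [i = i']. Then [b^-1 b'] lies in [H] and centralizes
    [h_i], so [b] and [b'] represent the same coset. *)
Lemma pt_idx_inj : injective pt_idx.
Proof.
move=> p q e.
have zH : (pt_rep p)^-1 * pt_rep q \in H.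
  have := groupM (pt_elt_in p) (groupVr (pt_elt_in q)).
  rewrite /pt_elt e; move: (pt_rep p) (pt_rep q) (c _) => u v w.
  by rewrite invMg invgK mulgA mulgK.
have ez : h (tag q) = h (tag p) ^ ((pt_rep p)^-1 * pt_rep q).
  rewrite -!pt_rep_conj; move: (pt_rep p) (pt_rep q) => u v.
  by rewrite /conjg !invMg invgK !mulgA !mulgK.
have et : tag p = tag q.
  by apply: h_distinct => /=; rewrite ez; apply/esym/class_eqP/memJ_class.
case: p q e zH ez et => [i k] [i' k'] /= e zH ez et; subst i'.
congr (Tagged _ _).
move: zH; rewrite /pt_rep /= invMg -mulgA mulKg => zH.
have kC := (hb i).1 k; have kC' := (hb i).1 k'.
apply: (coset_rep_unique (hb i) kC'); first rewrite inE zH /=.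
  by case/setIP: (groupM (groupVr kC) kC').
by rewrite mulVg group1.
Qed.

(** For a fixed coset, [c_j^-1 f c_j] lies in [H] and is [h_i] conjugated by some [x] in [H]. Then
    [r_i^-1 c_j x^-1] centralizes [h_i], and its coset supplies the second component of the pair. *)
Lemma pt_idx_surj (j : J) : exists p, pt_idx p = j.
Proof.
have jH : cos c (val j) f (val j) \in H := valP j.
have cG := hc.1 (val j).
have : cos c (val j) f (val j) \in (f ^: G) :&: H.
  rewrite inE jH andbT; apply/imsetP; exists (c (val j)) => //.
  by rewrite /cos /conjg mulgA.
rewrite h_cover => /bigcupP[i _ /imsetP[x xH ex]].
have [rG er] := hr i; have xG := subsetP sHG _ xH.
have uC : (r i)^-1 * c (val j) * x^-1 \in 'C_G[h i].
  apply/setIP; split; first by rewrite !groupM ?groupV.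
  apply/cent1P.
  have E : h i ^ ((r i)^-1 * c (val j) * x^-1) = h i.
    have -> : h i = f ^ r i by rewrite -er /conjg mulgA.
    rewrite -mulgA conjgM conjgK conjgM.
    have -> : f ^ c (val j) = h i ^ x by rewrite -ex /cos /conjg mulgA.
    by rewrite conjgK -er /conjg mulgA.
  by rewrite /commute (conjgC (h i)) E.
have [k hk] := coset_rep_exists (hb i) uC.
exists (Tagged (fun i => 'I_(d i)) k); apply: pt_idx_unique.
rewrite /pt_rep /=; case/setIP: hk => hk _.
have := groupM (groupVr xH) (groupVr hk).
by move: (@b i k) => u; rewrite !invMg !invgK !mulgA mulVg mul1g.
Qed.

Lemma pt_rep_sum g p : g \in 'C_G[f] ->
  g * pt_rep (sum_idx g p) = pt_rep p * sum_cocycle g p.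
Proof.
move=> gC; rewrite /pt_rep /sum_idx /sum_cocycle /ind_elt /=.
by rewrite /conjg !mulgA mulgK mulgV mul1g.
Qed.

(** Both sides are the index of the coset [g^-1 r_i b H]. *)
Lemma pt_idx_sum g p : g \in 'C_G[f] -> pt_idx (sum_idx g p) = fix_idx g (pt_idx p).
Proof.
move=> gC; apply: pt_idx_unique.
have [_ eH e1] := step_fix_idx hc fG (pt_idx p) gC.
have aH := ix_e sum_index p gC; have e2 := pt_rep_sum p gC.
have := groupM (groupVr eH) (groupM (groupVr (pt_elt_in p)) aH).
suff -> : (c (val (fix_idx g (pt_idx p))))^-1 * pt_rep (sum_idx g p) =
  (fix_cocycle g (pt_idx p))^-1 * ((pt_elt p)^-1 * sum_cocycle g p) by [].
rewrite /pt_elt; move: e1 e2.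
move: (c _) (c _) (pt_rep _) (pt_rep _) (fix_cocycle _ _) (sum_cocycle _ _).
move=> u v w z s a e1 e2.
have -> : u = g^-1 * (v * s) by rewrite e1 mulKg.
have -> : z = g^-1 * (w * a) by rewrite -e2 mulKg.
by rewrite !invMg !invgK !mulgA mulgK.
Qed.

Lemma sum_equivalent :
  pre_equivalent 'C_G[f] (trace_action (ind_rep3 H X c) f)
   (sum_action (fun i => ind_action 'C_H[h i] (@b i) (trace_action X (h i))) r).
Proof.
have ix := fix_index hc fG; have ix' := sum_index.
apply: (pre_equivalent_transport (trace_strict_iso HS HX hc fG) sum_strict_iso
  (fam_unital HS HX ix) (fam_unital HS HX ix')).
pose be' j := proj1_sig (constructive_indefinite_description _ (pt_idx_surj j)).
have be'K : cancel be' pt_idx.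
  by move=> j; rewrite /be'; case: constructive_indefinite_description.
apply: (reindex_equivalent HS HX ix ix' (be := pt_idx) (be' := be') (s := pt_elt)) => //.
- by move=> p; apply: pt_idx_inj; rewrite be'K.
- exact: pt_elt_in.
- move=> p; rewrite /sum_elt -pt_rep_conj /fix_elt /pt_elt /cos.
  move: (pt_rep p) (c _) => u v; by rewrite invMg invgK !mulgA !mulgK.
- by move=> g p; apply: pt_idx_sum.
move=> g p gC; rewrite {2}/pt_elt pt_idx_sum //.
have [_ _ e1] := step_fix_idx hc fG (pt_idx p) gC; have e2 := pt_rep_sum p gC.
rewrite /pt_elt; move: e1 e2.
move: (c _) (c _) (pt_rep _) (pt_rep _) (fix_cocycle _ _) (sum_cocycle _ _).
move=> u v w z s a e1 e2.
(* Solving for the two representatives [u] and [z] of the translated coset reduces both sides to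
   [w^-1 * v * s]. *)
have -> : u = g^-1 * (v * s) by rewrite e1 mulKg.
have -> : z = g^-1 * (w * a) by rewrite -e2 mulKg.
by rewrite !invMg !invgK !mulgA mulgV mul1g mulgK.
Qed.
End SumTrace.

Theorem theorem5p1 (gT : finGroupType) (G H : {group gT}) (sHG : H \subset G)
  (K : fieldType) (V : klinear2cat K)
  (W : sub3 (Vstar V)) (hW : is_strict_sub3 W)
  (R : rep3 gT (sub3_sig W)) (hR : is_rep3 H R)
  (m : nat) (c : 'I_m -> gT) (hc : coset_reps G H c)
  (f : gT) (fG : f \in G)
  (n : nat) (h r : 'I_n -> gT)
  (h_cover : (f ^: G) :&: H = \bigcup_(i < n) (h i ^: H))
  (h_distinct : injective (fun i => h i ^: H))
  (hr : forall i, r i \in G /\ (r i)^-1 * f * r i = h i)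
  (d : 'I_n -> nat) (b : forall i, 'I_(d i) -> gT)
  (hb : forall i, coset_reps 'C_G[h i] 'C_H[h i] (b i)) :
  let trace_ind := trace_action (ind_rep3 H R c) f in
  let ind_trace :=
    sum_action
      (fun i => ind_action 'C_H[h i] (b i) (trace_action R (h i))) r in
  [/\ is_cat_action 'C_G[f] trace_ind,
      is_cat_action 'C_G[f] ind_trace &
      action_equivalent 'C_G[f] trace_ind ind_trace].
Proof.
have HS := W_strict hW.
have hH i : h i \in H.
  have : h i \in (f ^: G) :&: H.
    by rewrite h_cover; apply/bigcupP; exists i => //; apply: class_refl.
  by case/setIP.
move=> trace_ind ind_trace.
have a1 : is_cat_action 'C_G[f] trace_ind.
  apply: (@strict_unital_action _ 'C_G[f]).
  apply: (strict_iso_unital (trace_strict_iso HS hR hc fG)).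
  exact: (fam_unital HS hR (fix_index hc fG)).
have a2 : is_cat_action 'C_G[f] ind_trace.
  apply: (@strict_unital_action _ 'C_G[f]).
  apply: (strict_iso_unital (sum_strict_iso HS G H R f h r b)).
  exact: (fam_unital HS hR (sum_index hH hr hb)).
split=> //; apply: (@pre_equivalentP _ 'C_G[f]) => //.
exact: (sum_equivalent HS hR hH hr hb hc sHG fG h_cover h_distinct).
Qed.
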